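(* Let $\mathcal C$ be a class of topological semigroups such that either $\mathcal C=\mathsf{T_{1}S}$ or $\mathsf{T_{z}S}\subseteq\mathcal C\subseteq\mathsf{T_{2}S}$. Then any subsemigroup of an injectively $\mathcal C$-closed commutative semigroup is injectively $\mathcal C$-closed.
   Context: A topological semigroup is a topological space endowed with a continuous associative binary operation. $\mathsf{T_{1}S}$ is the class of topological semigroups satisfying the separation axiom $T_1$ (all finite subsets are closed); $\mathsf{T_{2}S}$ is the class of Hausdorff topological semigroups; $\mathsf{T_{z}S}$ is the class of Hausdorff zero-dimensional topological semigroups, where a space is zero-dimensional if it has a base of clopen sets. A (discrete) semigroup $X$ is injectively $\mathcal C$-closed if, $X$ being endowed with the discrete topology, for every injective homomorphism $h:X\to Y$ to a topological semigroup $Y\in\mathcal C$ the image $h[X]$ is closed in $Y$. *)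

(* Defs.v *)
From HB Require Import structures.
From mathcomp Require Import all_boot all_classical topology.

Set Implicit Arguments.
Unset Strict Implicit.
Unset Printing Implicit Defensive.

Local Open Scope classical_set_scope.

HB.mixin Record isTopologicalSemigroup T of Topological T & Semigroup T := {
  mulg_continuous : continuous (fun z : T * T => (z.1 * z.2)%g)
}.

#[short(type="topSemigroupType")]
HB.structure Definition TopologicalSemigroup :=
  {T of Topological T & Semigroup T & isTopologicalSemigroup T}.

(* The library's [zero_dimensional] only asks that clopen sets separate points,
   which is weaker than the existence of a base of clopen sets. *)
Definition has_clopen_base (T : topologicalType) : Prop :=
  exists B : set (set T), basis B /\ B `<=` clopen.

(* [accessible_space] amounts to all finite subsets being closed, see
   [accessible_finite_set_closed]. *)
Definition T1S (Y : topSemigroupType) : Prop := accessible_space Y.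

Definition T2S (Y : topSemigroupType) : Prop := hausdorff_space Y.

Definition TzS (Y : topSemigroupType) : Prop :=
  hausdorff_space Y /\ has_clopen_base Y.

(* [X] carries the discrete topology, so continuity of [h] is automatic and
   no topology on [X] appears. *)
Definition injectively_closed (C : topSemigroupType -> Prop)
    (X : semigroupType) : Prop :=
  forall (Y : topSemigroupType) (h : {multiplicative X -> Y}),
    C Y -> injective h -> closed (range h).

(* Main.v *)
(* Adjoin a unit to [X] to get a monoid [M].  A set of filters on [M], compatible
   with the multiplication, gives a zero-dimensional Hausdorff semigroup
   containing [M]: its points are the traces of the filters on the subsets of [M]
   decided by all of them.  If [M] is closed, then each of the filters agrees on
   decided sets with a neighbourhood filter of a point of [M].
   Choosing the filters suitably, one finds that in [M]
   - chains of idempotents and maximal subgroups are finite, and there is [N]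
     with all [x ^+ N] idempotent;
   - no infinite [A] has [A * A] a singleton, nor, if no element of [A] lies in
     a subgroup, all of [A * A] covered by subgroups;
   - in the T1 case there are finitely many idempotents, since otherwise a
     second copy of some idempotent could be added to [M].
   All this is inherited by subsemigroups [S] and makes the image of [S] under an
   injective homomorphism [h] closed.  Let [G] be an ultrafilter on [S] with
   [h @ G --> y].  The limit [y ^+ N] of idempotents is [h e] for an idempotent
   [e].  If elements of subgroups are in [G] then [y = h e * y], and [e * x] takes
   finitely many values near [G].  If [x ^+ N = e] for [G]-almost all [x] then [G]
   is principal.  In the remaining case, a greedy choice along [G] contradicts
   the second condition. *)
Require Import Defs.
From HB Require Import structures.
From mathcomp Require Import all_boot all_classical topology zify.

Set Implicit Arguments.
Unset Strict Implicit.
Unset Printing Implicit Defensive.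

Local Open Scope classical_set_scope.
Local Open Scope group_scope.

(** * Extending a semigroup by filters *)

(** Traces on decided sets make every extension Hausdorff and zero-dimensional at once; what has to
    be designed is a family of filters with enough decided sets to separate points and to determine
    products. For chains, constant products, powers of one element and quasi-cyclic groups, [M] can
    stay discrete. A profinite completion or a limit of idempotents cannot leave [e] isolated, hence
    the separate neighbourhood filters [cnb]. Finiteness of a maximal subgroup splits into two
    cases. On elements of squarefree order the profinite topology works, since there every subgroup
    is closed, and a countable infinite group cannot be complete. If only finitely many elements
    have squarefree order, an infinite group contains a quasi-cyclic one; that has no proper
    subgroup of finite index, so a filter is built by hand. The bounds on exponents of regular
    elements and on indices both rest on one topology, in which an antichain of idempotents
    converges to an idempotent [e] below it. *)

Section Decided.
Variables (M : Type) (Phi : set (set_system M)).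

Definition decided : set_system M :=
  [set W | forall F, Phi F -> F W \/ F (~` W)].

Hypothesis PhiF : forall F, Phi F -> ProperFilter F.

Lemma decidedC W : decided W -> decided (~` W).
Proof. by move=> dW F /dW; rewrite setCK => -[]; [right|left]. Qed.

Lemma decidedI V W : decided V -> decided W -> decided (V `&` W).
Proof.
move=> dV dW F PF; have FF := PhiF PF.
have [FV|FV] := dV _ PF; last by right; apply: filterS FV => x nV [].
have [FW|FW] := dW _ PF; last by right; apply: filterS FW => x nW [].
by left; apply: filterI.
Qed.

Lemma decidedT : decided setT.
Proof. by move=> F PF; have FF := PhiF PF; left; apply: filterT. Qed.

End Decided.

(* [cpt] are the points of the extension of [M], as filters on [M], and
   [cnb x] is the trace on [M] of the neighbourhood filter of [x]. *)
Record completion (M : semigroupType) := Completion {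
  cpt : set (set_system M);
  cnb : M -> set_system M;
  cnb_cpt : forall x, cpt (cnb x);
  cpt_proper : forall F, cpt F -> ProperFilter F;
  cnb_mem : forall x W, cnb x W -> W x;
  cnb_sep : forall x y, x <> y -> exists W, [/\ decided cpt W, cnb x W & ~ W y];
  cptM : forall F G, cpt F -> cpt G -> exists2 H, cpt H &
    forall W, decided cpt W -> H W -> exists P Q,
      [/\ decided cpt P, F P, decided cpt Q, G Q &
          forall x y, P x -> Q y -> W (x * y)];
  cnbM : forall x y W, decided cpt W -> cnb (x * y) W -> exists P Q,
      [/\ decided cpt P, cnb x P, decided cpt Q, cnb y Q &
          forall u v, P u -> Q v -> W (u * v)] }.

Section CompletionSpace.
Variables (M : semigroupType) (D : completion M).
Local Notation dec := (decided (cpt D)).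

Definition trace (F : set_system M) : set_system M := [set W | dec W /\ F W].

(** Points are traces rather than filters, because filters that agree on all decided sets could not
    be separated. *)
Definition cspace := {t : set_system M | exists2 F, cpt D F & t = trace F}.

HB.instance Definition _ := gen_eqMixin cspace.
HB.instance Definition _ := gen_choiceMixin cspace.

Definition cpoint F (DF : cpt D F) : cspace :=
  exist _ (trace F) (ex_intro2 _ _ F DF erefl).

Lemma cspace_dec (y : cspace) W : sval y W -> dec W.
Proof. by case: y => t /= [F DF ->] []. Qed.

Lemma cspaceI (y : cspace) V W : sval y V -> sval y W -> sval y (V `&` W).
Proof.
case: y => t /= [F DF ->] [dV FV] [dW FW]; have FF := cpt_proper DF.
by split; [apply: decidedI; first exact: (@cpt_proper _ D)|apply: filterI].
Qed.

Lemma cspaceT (y : cspace) : sval y setT.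
Proof.
case: y => t /= [F DF ->]; have FF := cpt_proper DF.
by split; [apply: decidedT; exact: (@cpt_proper _ D)|apply: filterT].
Qed.

Lemma cspace_ex (y : cspace) W : sval y W -> exists x, W x.
Proof.
case: y => t /= [F DF ->] [dW FW]; have FF := cpt_proper DF.
exact: filter_ex FW.
Qed.

Lemma cspaceC (y : cspace) W : dec W -> sval y W \/ sval y (~` W).
Proof.
case: y => t /= [F DF ->] dW; have [FW|FW] := dW _ DF; first by left.
by right; split=> //; apply: decidedC.
Qed.

Lemma cspaceP (y z : cspace) : (forall W, sval y W -> sval z W) -> y = z.
Proof.
move=> yz; suff e : sval y = sval z.
  by case: y z e {yz} => [s ys] [t zt] /= e; subst t; congr exist; exact: Prop_irrelevance.
apply/funext => W; apply/propext; split=> [/yz//|zW].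
have [//|/yz nzW] := cspaceC y (cspace_dec zW).
by have [x []] := cspace_ex (cspaceI zW nzW).
Qed.

Definition lim2 (y z r : cspace) := forall W, sval r W -> exists P Q,
  [/\ sval y P, sval z Q & forall u v, P u -> Q v -> W (u * v)].

(** Two limits would be separated by a decided set and its complement, while some [u] and [v] in [M]
    approximate [y] and [z] well enough for both. *)
Lemma lim2_uniq y z r s : lim2 y z r -> lim2 y z s -> r = s.
Proof.
move=> rl sl; apply: cspaceP => W rW.
have [//|sW] := cspaceC s (cspace_dec rW).
have [P [Q [yP zQ PQ]]] := rl _ rW; have [P' [Q' [yP' zQ' PQ']]] := sl _ sW.
have [u [Pu P'u]] := cspace_ex (cspaceI yP yP').
have [v [Qv Q'v]] := cspace_ex (cspaceI zQ zQ').
by case: (PQ' u v P'u Q'v); apply: PQ.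
Qed.

Lemma lim2_ex y z : exists r, lim2 y z r.
Proof.
have [F DF eF] := svalP y; have [G DG eG] := svalP z.
have [H DH HW] := cptM DF DG; exists (cpoint DH) => W /= [dW /(HW _ dW)].
by move=> [P [Q [dP FP dQ GQ PQ]]]; exists P, Q; rewrite eF eG.
Qed.

Definition cmul y z := sval (cid (lim2_ex y z)).

Lemma cmulP y z : lim2 y z (cmul y z).
Proof. exact: (svalP (cid (lim2_ex y z))). Qed.

(** Associativity passes from [M] to the extension by density: a disagreement would be visible on
    three elements of [M]. *)
Lemma cmulA : associative cmul.
Proof.
move=> x y z; apply: cspaceP => W W1.
have [//|W2] := cspaceC (cmul (cmul x y) z) (cspace_dec W1).
have [A [R [xA rR AR]]] := cmulP W1; have [B [C [yB zC BC]]] := cmulP rR.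
have [R' [C' [rR' zC' RC']]] := cmulP W2.
have [A' [B' [xA' yB' AB']]] := cmulP rR'.
have [a [Aa A'a]] := cspace_ex (cspaceI xA xA').
have [b [Bb B'b]] := cspace_ex (cspaceI yB yB').
have [c [Cc C'c]] := cspace_ex (cspaceI zC zC').
by case: (RC' (a * b) c (AB' _ _ A'a B'b) C'c); rewrite -mulgA; apply/AR/BC.
Qed.

HB.instance Definition _ := isSemigroup.Build cspace cmulA.

Definition copen : set_system cspace :=
  [set V | forall y, V y -> exists2 W, sval y W & forall z : cspace, sval z W -> V z].

Lemma copenT : copen setT.
Proof. by move=> y _; exists setT => //; exact: cspaceT. Qed.

Lemma copenI : setI_closed copen.
Proof.
move=> U V oU oV y [/oU[P yP PU] /oV[Q yQ QV]].
exists (P `&` Q); first exact: cspaceI.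
have sub (z : cspace) A B : dec B -> A `<=` B -> sval z A -> sval z B.
  move=> dB AB zA; have [//|zB] := cspaceC z dB.
  by have [x [/AB]] := cspace_ex (cspaceI zA zB).
by move=> z zPQ; split; [apply: PU|apply: QV]; apply: sub zPQ => [|x []//];
  apply: cspace_dec; eassumption.
Qed.

Lemma copen_bigU (I : Type) (f : I -> set cspace) :
  (forall i, copen (f i)) -> copen (\bigcup_i f i).
Proof. by move=> of_ y [i _ /of_[W yW Wf]]; exists W => // z /Wf; exists i. Qed.

HB.instance Definition _ :=
  isOpenTopological.Build cspace copenT copenI copen_bigU.

Definition cstar (W : set M) : set cspace := [set y | sval y W].

Lemma cstar_open W : open (cstar W).
Proof. by move=> y yW; exists W. Qed.

Lemma cstar_clopen W : dec W -> clopen (cstar W).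
Proof.
move=> dW; split; first exact: cstar_open.
rewrite (_ : cstar W = ~` cstar (~` W)); first exact/open_closedC/cstar_open.
apply/seteqP; split=> y /= yW; last by have [|/yW] := cspaceC y dW.
by move=> yW'; have [x []] := cspace_ex (cspaceI yW yW').
Qed.

Lemma nbhs_cspaceP (y : cspace) (V : set cspace) :
  nbhs y V -> exists2 W, sval y W & cstar W `<=` V.
Proof.
rewrite nbhsE => -[U [oU yU] UV]; have [W yW WU] := oU _ yU.
by exists W => // z /WU /UV.
Qed.

Lemma cmul_continuous : continuous (fun z : cspace * cspace => (z.1 * z.2)%g).
Proof.
move=> [y z] V /nbhs_cspaceP[W /= yzW WV]; apply: filterS WV _.
have [P [Q [yP zQ PQ]]] := cmulP yzW.
exists (cstar P, cstar Q).
  by split; apply: open_nbhs_nbhs; split=> //; exact: cstar_open.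
move=> [p q] [/= pP qQ]; rewrite /cstar /=.
have [//|pqW] := cspaceC (cmul p q) (cspace_dec yzW).
have [P' [Q' [pP' qQ' PQ']]] := cmulP pqW.
have [u [Pu P'u]] := cspace_ex (cspaceI pP pP').
have [v [Qv Q'v]] := cspace_ex (cspaceI qQ qQ').
by case: (PQ' u v P'u Q'v); apply: PQ.
Qed.

HB.instance Definition _ := isTopologicalSemigroup.Build cspace cmul_continuous.

Lemma cspace_TzS : TzS cspace.
Proof.
split; last first.
  exists [set cstar W | W in dec]; split; last first.
    by move=> _ [W dW <-]; exact: cstar_clopen.
  split=> [_ [W dW <-]|y V /nbhs_cspaceP[W yW WV]]; first exact: cstar_open.
  by exists (cstar W) => //; split=> //; exists W => //; apply: cspace_dec yW.
move=> p q clpq; apply: cspaceP => W pW.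
have [//|qW] := cspaceC q (cspace_dec pW).
have nb V (y : cspace) : sval y V -> nbhs y (cstar V).
  by move=> yV; apply: open_nbhs_nbhs; split=> //; exact: cstar_open.
have [r [rW rW']] := clpq _ _ (nb _ _ pW) (nb _ _ qW).
by have [x []] := cspace_ex (cspaceI rW rW').
Qed.

Definition cemb x : cspace := cpoint (@cnb_cpt _ D x).

Lemma cembM : {morph cemb : x y / x * y}.
Proof.
move=> x y; apply: (lim2_uniq (y := cemb x) (z := cemb y)); last exact: cmulP.
move=> W [dW xyW]; have [P [Q [dP xP dQ yQ PQ]]] := cnbM dW xyW.
by exists P, Q.
Qed.

HB.instance Definition _ := isMultiplicative.Build M cspace cemb cembM.

Lemma cemb_inj : injective cemb.
Proof.
move=> x y xy; apply: contrapT => /(cnb_sep D)[W [dW xW]]; apply.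
have : sval (cemb x) W by [].
by rewrite xy => -[_ /cnb_mem].
Qed.

(** Every basic set [cstar W] around the point of [F] contains the elements of [W], so this point is
    in the closure of [M]. *)
Lemma closed_completion : injectively_closed TzS M ->
  forall F, cpt D F -> exists x, forall W, dec W -> F W <-> cnb D x W.
Proof.
move=> ic F DF.
have cl : closed (range cemb) := ic cspace cemb cspace_TzS cemb_inj.
have [V /nbhs_cspaceP[W yW WV]|x _ xF] := cl (cpoint DF).
  have [x Wx] := cspace_ex yW; exists (cemb x); split; first by exists x.
  apply: WV; have [//|[_ /cnb_mem//]] := cspaceC (cemb x) (cspace_dec yW).
exists x => W dW; suff : sval (cpoint DF) W <-> sval (cemb x) W.
  by move=> /= [h1 h2]; split=> h; [apply h1|apply h2].
by rewrite -xF.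
Qed.

End CompletionSpace.

(** * Ultrafilters *)

Lemma ultraP T (F : set_system T) : ProperFilter F ->
  (forall W, F W \/ F (~` W)) -> UltraFilter F.
Proof.
move=> FF dF; split=> // G GF FG; apply/seteqP; split=> // W GW.
have [//|/FG nGW] := dF W.
by have [x []] := filter_ex (filterI GW nGW).
Qed.

Lemma ultra_fmap S T (f : S -> T) (F : set_system S) :
  UltraFilter F -> UltraFilter (fmap f F).
Proof.
move=> UF; apply: ultraP => W.
exact: (in_ultra_setVsetC (f @^-1` W)).
Qed.

Lemma ultra_or T (F : set_system T) (A B : set T) : UltraFilter F ->
  F (A `|` B) -> F A \/ F B.
Proof.
move=> UF FAB; have [|nA] := in_ultra_setVsetC A UF; first by left.
by right; apply: filterS (filterI FAB nA) => x [[]].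
Qed.

Lemma ultra_finite T U (F : set_system T) (f : T -> U) (A : set U) :
  UltraFilter F -> finite_set A -> F (f @^-1` A) ->
  exists2 a, A a & F [set x | f x = a].
Proof.
move=> UF fA FA.
suff H : forall s : seq {classic U}, F (f @^-1` [set` s]) ->
    exists2 a, a \in s & F [set x | f x = a].
  move: fA => /(@finite_seqP {classic U})[s sE].
  by move: FA; rewrite sE => /H[a sa Fa]; exists a.
elim=> [|a s IH].
  by move=> F0; have [x] := filter_ex F0.
move=> Fs; have : F ([set x | f x = a] `|` f @^-1` [set` s]).
  by apply: filterS Fs => x /=; rewrite inE => /orP[/eqP|]; [left|right].
move=> /ultra_or[|/IH[b sb Fb]]; first by exists a => //; exact: mem_head.
by exists b => //; rewrite inE sb orbT.
Qed.

(** A fixed nonprincipal ultrafilter on the indices. Pushing a sequence forward along it gives a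
    limit, and it serves as a pigeonhole principle that keeps infinitely many indices. *)
Definition uoo : set_system nat := sval (cid (ultraFilterLemma eventually_filter)).

#[global] Instance uoo_ultra : UltraFilter uoo.
Proof. by rewrite /uoo; case: cid => F []. Qed.

Lemma uoo_ge n : uoo [set m | n <= m]%N.
Proof. by rewrite /uoo; case: cid => F [_] /=; apply; exists n. Qed.

Lemma uoo_inj T (c : nat -> T) x : injective c -> ~ uoo [set i | c i = x].
Proof.
move=> c_inj Fx.
have [i ix] := filter_ex Fx.
have [j [jx ij]] := filter_ex (filterI Fx (uoo_ge i.+1)).
by move: ij; rewrite /= (c_inj j i) ?ltnn// jx ix.
Qed.

Lemma commACA (S : semigroupType) (mulC : commutative (@mul S)) (x y u v : S) :
  (x * u) * (y * v) = (x * y) * (u * v).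
Proof. by rewrite -mulgA (mulgA u) (mulC u y) -!mulgA. Qed.

(** * Extensions in which the monoid stays discrete *)

Section CommMonoid.
Variables (M : monoidType).
Hypothesis mulC : commutative (@mul M).
Hypothesis ic : injectively_closed TzS M.

Section DiscretePoint.
Variables (F : set_system M).
Hypothesis FF : ProperFilter F.

(** All elements of [M] are isolated. With the limit of [F] its translates have to be added, to keep
    the extension closed under multiplication by [M]. *)
Let Phi : set (set_system M) := [set G |
  (exists x, G = principal_filter x) \/ (exists z, G = fmap (mul z) F)].

Hypothesis F_dec1 : forall x z : M,
  F [set u | z * u = x] \/ F [set u | z * u <> x].

Hypothesis F_mul : forall x y, exists2 K, Phi K &
  forall W, decided Phi W -> K W -> exists P Q,
    [/\ decided Phi P, F [set u | P (x * u)], decided Phi Q, F [set u | Q (y * u)] &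
        forall u v, P u -> Q v -> W (u * v)].

Let Phi_proper G : Phi G -> ProperFilter G.
Proof.
case=> -[x ->]; first by have [] := principal_filter_ultra x.
exact: fmap_proper_filter.
Qed.

Let pfilt x : Phi (principal_filter x).
Proof. by left; exists x. Qed.

Let pfilt_mem x (W : set M) : principal_filter x W -> W x.
Proof. by move/principal_filterP. Qed.

Let dec1 x : decided Phi [set x].
Proof.
move=> _ [[y ->]|[z ->]]; last exact: F_dec1.
by case: (pselect (y = x)) => [->|yx]; [left|right]; apply/principal_filterP.
Qed.

Let dec_mul x W : decided Phi W -> decided Phi [set u | W (x * u)].
Proof.
move=> dW _ [[y ->]|[z ->]].
  by case: (pselect (W (x * y))) => Wxy; [left|right]; apply/principal_filterP.
have [FW|FW] := dW (fmap (mul (x * z)) F) (or_intror (ex_intro _ _ erefl));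
  [left|right]; by apply: (filterS (F := F)) FW => u /=; rewrite mulgA.
Qed.

Let pfilt_sep x y : x <> y ->
  exists W, [/\ decided Phi W, principal_filter x W & ~ W y].
Proof. by move=> xy; exists [set x]; split=> //= yx; exact: xy. Qed.

Let PhiM G H : Phi G -> Phi H -> exists2 K, Phi K &
    forall W, decided Phi W -> K W -> exists P Q,
      [/\ decided Phi P, G P, decided Phi Q, H Q &
          forall x y, P x -> Q y -> W (x * y)].
Proof.
case=> -[x ->] [] [y ->]; last exact: F_mul.
- exists (principal_filter (x * y)) => // W _ /principal_filterP Wxy.
  by exists [set x], [set y]; split; [exact: dec1|exact/principal_filterP|
    exact: dec1|exact/principal_filterP|move=> _ _ -> ->].
- exists (fmap (mul (x * y)) F); first by right; exists (x * y).
  move=> W dW FW; exists [set x], [set u | W (x * u)].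
  split; [exact: dec1|exact/principal_filterP|exact: dec_mul| |by move=> _ u ->].
  by apply: (filterS (F := F)) FW => u /=; rewrite mulgA.
- exists (fmap (mul (x * y)) F); first by right; exists (x * y).
  move=> W dW FW; exists [set u | W (y * u)], [set y].
  split; [exact: dec_mul| |exact: dec1|exact/principal_filterP
         |by move=> u _ ? ->; rewrite mulC].
  by apply: (filterS (F := F)) FW => u /=; rewrite mulgA (mulC y).
Qed.

Let PhiN x y W : decided Phi W -> principal_filter (x * y) W -> exists P Q,
  [/\ decided Phi P, principal_filter x P, decided Phi Q, principal_filter y Q &
      forall u v, P u -> Q v -> W (u * v)].
Proof.
move=> _ /principal_filterP Wxy.
by exists [set x], [set y]; split; [exact: dec1|exact/principal_filterP|
    exact: dec1|exact/principal_filterP|move=> _ _ -> ->].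
Qed.

Lemma discrete_principal : exists x, F [set x].
Proof.
pose D := Completion pfilt Phi_proper pfilt_mem pfilt_sep PhiM PhiN.
have [|x /= xF] := @closed_completion _ D ic F.
  by right; exists 1; apply/funext => W; congr F; apply/funext => u; rewrite /= mul1g.
by exists x; apply/(xF [set x] (dec1 _))/principal_filterP.
Qed.

End DiscretePoint.

(** For an ultrafilter all sets are decided, so only products of two translates matter: those of [x]
    and [y] converge to [x * y * c] in the first case and to the translate by [x * y] in the
    second. *)
Lemma ultra_principal (F : set_system M) : UltraFilter F ->
  (exists c, exists2 P, F P & forall x y, P x -> P y -> x * y = c) \/
  (forall W, F W -> exists2 P, F P & forall x y, P x -> P y -> W (x * y)) ->
  exists x, F [set x].
Proof.
move=> UF FF; apply: discrete_principal.
  by move=> x z; exact: (in_ultra_setVsetC [set u | z * u = x]).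
move=> x y; set Phi := [set _ | _].
have Phi_dec W : decided Phi W.
  move=> G PG; apply: in_ultra_setVsetC.
  by case: PG => -[z ->]; [exact: principal_filter_ultra|exact: ultra_fmap].
case: FF => [[c [P FP Pc]]|FI].
  exists (principal_filter (x * y * c)); first by left; exists (x * y * c).
  move=> W _ /principal_filterP Wc.
  exists (mul x @` P), (mul y @` P); split=> //.
  + by apply: (filterS (F := F)) FP => u Pu /=; exists u.
  + by apply: (filterS (F := F)) FP => u Pu /=; exists u.
  + move=> _ _ [u Pu <-] [v Pv <-].
    by rewrite (commACA mulC) (Pc u v).
exists (fmap (mul (x * y)) F); first by right; exists (x * y).
move=> W _ /FI[P FP PW].
exists (mul x @` P), (mul y @` P); split=> //.
+ by apply: (filterS (F := F)) FP => u Pu /=; exists u.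
+ by apply: (filterS (F := F)) FP => u Pu /=; exists u.
+ by move=> _ _ [u Pu <-] [v Pv <-]; rewrite (commACA mulC); exact: PW.
Qed.

(** The third hypothesis makes the generated filter multiplicatively idempotent. The last two stand
    in for the ultrafilter property: they make singletons and the images of the [U n] under
    translations decided. *)
Lemma base_principal (U : nat -> set M) :
  (forall m n, (m <= n)%N -> U n `<=` U m) -> (forall n, U n !=set0) ->
  (forall n, exists m, forall x y, U m x -> U m y -> U n (x * y)) ->
  (forall z w, exists n, (forall u, U n u -> z * u = w) \/
                         (forall u, U n u -> z * u <> w)) ->
  (forall z z' n, exists m, (forall u, U m u -> exists2 v, U n v & z' * u = z * v) \/
                         (forall u v, U m u -> U n v -> z' * u <> z * v)) ->
  exists x n, U n `<=` [set x].
Proof.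
move=> Ule U0 UM U1 U2; pose F := filter_from setT U.
have FF : ProperFilter F.
  apply: filter_from_proper => [|n _]; last exact: U0.
  apply: filter_fromT_filter; first by exists 0%N.
  move=> i j; exists (maxn i j) => x Ux; split; apply: Ule Ux;
    [exact: leq_maxl|exact: leq_maxr].
have FU n : F (U n) by exists n.
have [|x y|x [n _ nx]] := @discrete_principal F FF; last by exists x, n.
  move=> x z; have [n [nzx|nzx]] := U1 z x; [left|right];
    exact: (filterS (F := F)) (FU n).
set Phi := [set _ | _]; exists (fmap (mul (x * y)) F).
  by right; exists (x * y).
have decU z n : decided Phi (mul z @` U n).
  move=> _ [[w ->]|[z' ->]].
    case: (pselect ((mul z @` U n) w)) => zw; [left|right];
      exact/principal_filterP.
  have [m [mz|mz]] := U2 z z' n; [left|right].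
    by apply: (filterS (F := F)) (FU m) => u /mz[v Uv e]; exists v.
  by apply: (filterS (F := F)) (FU m) => u Uu [v Uv e]; exact: (mz u v).
move=> W _ [n _ nW]; have [m mn] := UM n.
exists (mul x @` U m), (mul y @` U m); split=> //.
+ by apply: (filterS (F := F)) (FU m) => u Pu /=; exists u.
+ by apply: (filterS (F := F)) (FU m) => u Pu /=; exists u.
+ by move=> _ _ [u Pu <-] [v Pv <-]; rewrite (commACA mulC); apply/nW/mn.
Qed.

(** The case [i = j] says that the [c i] are idempotent, so this excludes infinite chains for the
    order in which [e] is below [f] when [e * f = e]. *)
Definition chain_finite (S : magmaType) := forall c : nat -> S, injective c ->
  ~ forall i j, c i * c j = c i \/ c i * c j = c j.

Definition nonsingular (S : magmaType) := forall (c : S) (a : nat -> S),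
  injective a -> ~ forall i j, a i * a j = c.

(** Every subset of a chain is closed under multiplication, so any ultrafilter on it meets the
    second condition of [ultra_principal]. *)
Lemma closed_chain_finite : chain_finite M.
Proof.
move=> c c_inj cc.
have [||x /=] := @ultra_principal (fmap c uoo); first exact: ultra_fmap.
  right=> W cW; exists (W `&` range c).
    by apply: (filterS (F := uoo)) cW => i Wi; split=> //; exists i.
  by move=> x y [Wx [i _ xi]] [Wy [j _ yj]]; rewrite -xi -yj; case: (cc i j) => ->; rewrite ?xi ?yj.
exact: uoo_inj.
Qed.

Lemma closed_nonsingular : nonsingular M.
Proof.
move=> c a a_inj ac.
have [||x /=] := @ultra_principal (fmap a uoo); first exact: ultra_fmap.
  left; exists c, (range a); first by apply: (filterS (F := uoo)) filterT => i _; exists i.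
  by move=> _ _ [i _ <-] [j _ <-].
exact: uoo_inj.
Qed.

End CommMonoid.

(** * Choice of sequences, and the order on idempotents *)

Lemma dependent_choice T (D : set T) (R : T -> T -> Prop) d0 : D d0 ->
  (forall d, D d -> exists2 d', D d' & R d d') ->
  exists2 c : nat -> T, c 0%N = d0 & forall n, D (c n) /\ R (c n) (c n.+1).
Proof.
move=> Dd0 DR.
have /choice[f fP] : forall d, exists d', D d -> D d' /\ R d d'.
  move=> d; case: (pselect (D d)) => [/DR[d' Dd' Rd']|nD]; first by exists d'.
  by exists d0.
exists (fun n => iter n f d0) => //= n.
suff Dn : D (iter n f d0) by split; last by have [] := fP _ Dn.
by elim: n => //= n /fP[].
Qed.

Lemma greedy (T : eqType) (Q : set T) (R : T -> T -> Prop) :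
  (forall s : seq T, (forall x, x \in s -> Q x) ->
     exists2 y, Q y & forall x, x \in s -> R x y) ->
  exists2 a : nat -> T, forall n, Q (a n) & forall i j, (i < j)%N -> R (a i) (a j).
Proof.
move=> gr; have [y0 _ _] := gr [::] (fun x xs => False_ind _ (notF xs)).
have /choice[f fP] : forall s : seq T, exists y, (forall x, x \in s -> Q x) ->
    Q y /\ forall x, x \in s -> R x y.
  move=> s; case: (pselect (forall x, x \in s -> Q x)) => [/gr[y]|nQ].
    by exists y.
  by exists y0.
pose s n := iter n (fun s => f s :: s) [::].
have sQ n : forall x, x \in s n -> Q x.
  elim: n => [//|n IH] x; rewrite inE => /orP[/eqP->|/IH//].
  by have [] := fP _ IH.
exists (fun n => f (s n)) => [n|i j ij]; first by have [] := fP _ (sQ n).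
apply: (fP _ (sQ j)).2; elim: j ij => // j IH; rewrite ltnS leq_eqVlt inE.
by move=> /orP[/eqP->|/IH->]; rewrite ?eqxx ?orbT.
Qed.

Definition idem (S : magmaType) : set S := [set e | e * e = e].

Section Idempotents.
Variables (S : semigroupType).
Hypothesis mulC : commutative (@mul S).
Hypothesis cf : chain_finite S.

Lemma idem_mul (e f : S) : idem e -> idem f -> idem (e * f).
Proof.
by rewrite /idem /= => ee ff; rewrite -mulgA (mulgA f) (mulC f e) -!mulgA ff !mulgA ee.
Qed.

(** Iterating the step gives a strictly descending sequence of idempotents, which is an injective
    chain. *)
Lemma no_descent (D : set S) d0 : D `<=` @idem S -> D d0 ->
  ~ forall d, D d -> exists2 d', D d' & d' * d = d' /\ d' <> d.
Proof.
move=> DE Dd0 /(dependent_choice Dd0)[c _ cP].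
have c_le i k : c (i + k)%N * c i = c (i + k)%N.
  elim: k => [|k IH]; first by rewrite addn0; apply/DE/(cP i).1.
  have [_ [e _]] := cP (i + k)%N.
  by rewrite addnS -[in LHS]e -mulgA IH e.
have c_le' i j : (i <= j)%N -> c j * c i = c j.
  by move=> ij; rewrite -(subnKC ij); exact: c_le.
have c_lt i j : (i < j)%N -> c i <> c j.
  move=> ij eij; have [_ [_]] := cP i; apply.
  by rewrite -(cP i).2.1 mulC eij; exact: c_le'.
apply: (@cf c) => [i j eij|i j].
  by case: (ltngtP i j) => // /c_lt; rewrite eij.
by have [/ltnW/c_le'|/ltnW/c_le'|->] := ltngtP i j;
  [rewrite mulC; right|left|left; apply/DE/(cP j).1].
Qed.

Lemma no_ascent (D : set S) d0 : D `<=` @idem S -> D d0 ->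
  ~ forall d, D d -> exists2 d', D d' & d * d' = d /\ d' <> d.
Proof.
move=> DE Dd0 /(dependent_choice Dd0)[c _ cP].
have c_le i k : c i * c (i + k)%N = c i.
  elim: k => [|k IH]; first by rewrite addn0; apply/DE/(cP i).1.
  have [_ [e _]] := cP (i + k)%N.
  by rewrite addnS -[in LHS]IH -mulgA e.
have c_le' i j : (i <= j)%N -> c i * c j = c i.
  by move=> ij; rewrite -(subnKC ij); exact: c_le.
have c_lt i j : (i < j)%N -> c i <> c j.
  move=> ij eij; have [_ [e]] := cP i; apply.
  by rewrite -[LHS](c_le' _ _ ij) -eij mulC.
apply: (@cf c) => [i j eij|i j].
  by case: (ltngtP i j) => // /c_lt; rewrite eij.
by have [/ltnW/c_le'|/ltnW/c_le'|->] := ltngtP i j;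
  [left|rewrite mulC; right|left; apply/DE/(cP j).1].
Qed.

Lemma idem_minimal (D : set S) d0 : D `<=` @idem S -> D d0 ->
  exists2 e, D e & forall d, D d -> d * e = d -> d = e.
Proof.
move=> DE Dd0; apply: contrapT => nmin; apply: (no_descent DE Dd0) => d Dd.
apply: contrapT => nd; apply: nmin; exists d => // d' Dd' d'd.
by apply: contrapT => d'nd; apply: nd; exists d'.
Qed.

Lemma idem_maximal (D : set S) d0 : D `<=` @idem S -> D d0 ->
  exists2 e, D e & forall d, D d -> e * d = e -> d = e.
Proof.
move=> DE Dd0; apply: contrapT => nmin; apply: (no_ascent DE Dd0) => d Dd.
apply: contrapT => nd; apply: nmin; exists d => // d' Dd' d'd.
by apply: contrapT => d'nd; apply: nd; exists d'.
Qed.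

Lemma idem_least (D : set S) d0 : D `<=` @idem S -> D d0 ->
  (forall d d', D d -> D d' -> D (d * d')) ->
  exists2 e, D e & forall d, D d -> e * d = e.
Proof.
move=> DE Dd0 DM; have [e De emin] := idem_minimal DE Dd0.
exists e => // d Dd; apply: emin; first exact: DM.
by rewrite -mulgA (mulC d) mulgA (DE _ De).
Qed.

End Idempotents.

Lemma fact_dvdn m n : (m <= n)%N -> (m`! %| n`!)%N.
Proof. by move=> mn; rewrite (fact_split mn) dvdn_mulr. Qed.

Section CommMonoid.
Variables (M : monoidType).
Hypothesis mulC : commutative (@mul M).

Lemma expg_mulC (x y : M) n : (x * y) ^+ n = x ^+ n * y ^+ n.
Proof. exact/expgMn/mulC. Qed.

Lemma expg_period (z x : M) i p m k : (i <= m)%N ->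
  z * x ^+ i = z * x ^+ (i + p) -> z * x ^+ m = z * x ^+ (m + k * p).
Proof.
move=> im e; elim: k => [|k IH]; first by rewrite mul0n addn0.
have -> : (m + k.+1 * p = (i + p) + (m - i + k * p))%N by rewrite mulSn; lia.
rewrite IH [in RHS]expgnDr mulgA -e -mulgA -expgnDr; congr (_ * _ ^+ _); lia.
Qed.

Lemma expg_idem (x : M) i j : (0 < i < j)%N -> x ^+ i = x ^+ j ->
  exists2 n, (0 < n)%N & idem (x ^+ n).
Proof.
move=> /andP[i0 ij] e; have p0 : (0 < j - i)%N by rewrite subn_gt0.
exists (i * (j - i))%N; first by rewrite muln_gt0 i0.
have im : (i <= i * (j - i))%N by rewrite leq_pmulr.
have := @expg_period 1 x i (j - i) _ i im; rewrite !mul1g subnKC 1?ltnW//.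
by rewrite /idem /= -expgnDr => <-.
Qed.

Hypothesis ic : injectively_closed TzS M.

(** The powers of [x] whose exponents are large and divisible by n! generate a multiplicatively
    idempotent filter. Since it contains a singleton, two distinct powers coincide. *)
Lemma closed_periodic (x : M) : exists2 n, (0 < n)%N & idem (x ^+ n).
Proof.
pose I n : set nat := [set i | [/\ (0 < i)%N, (n <= i)%N & (n`! %| i)%N]].
have Ile m n : (m <= n)%N -> I n `<=` I m.
  move=> mn i [i0 ni di]; split=> //; first exact: leq_trans ni.
  exact: dvdn_trans (fact_dvdn mn) di.
have In n : I n (n.+1)`!.
  split; [exact: fact_gt0|apply: leq_trans (fact_geq _); exact: leqnSn|].
  exact/fact_dvdn/leqnSn.
have [|||||y [n yn]] := @base_principal _ mulC ic (fun n => (fun i => x ^+ i) @` I n).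
- by move=> m n /Ile Imn _ [i /Imn Ii <-]; exists i.
- by move=> n; exists (x ^+ (n.+1)`!), (n.+1)`!.
- move=> n; exists n => _ _ [i [i0 ni di] <-] [j [j0 nj dj] <-].
  exists (i + j)%N; last by rewrite expgnDr.
  by split; [rewrite addn_gt0 i0|rewrite (leq_trans ni)// leq_addr|rewrite dvdn_add].
- move=> z w.
  (* If the sequence [z * x ^+ i] repeats, it is eventually periodic and becomes constant on
     exponents divisible by the period; otherwise it takes the value [w] at most once. *)
  case: (pselect (exists i p, (0 < p)%N /\ z * x ^+ i = z * x ^+ (i + p))).
    move=> [i [p [p0 e]]]; pose n := (i + p)%N; exists n.
    have const a b : I n a -> I n b -> z * x ^+ a = z * x ^+ b.
      wlog ab : a b / (a <= b)%N.
        by move=> H Ia Ib; case: (leqP a b) => [/H->//|/ltnW/H->].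
      move=> [_ na da] [_ nb db].
      have pd m : (n`! %| m)%N -> (p %| m)%N.
        by apply: dvdn_trans; rewrite dvdn_fact// p0 leq_addl.
      have /dvdnP[k kE] : (p %| b - a)%N by rewrite dvdn_sub// pd.
      rewrite -(subnKC ab) kE; apply: expg_period e.
      by apply: leq_trans na; exact: leq_addr.
    case: (pselect (exists2 a, I n a & z * x ^+ a = w)) => [[a Ia <-]|na].
      by left=> _ [b Ib <-]; exact: const.
    by right=> _ [b Ib <-] e'; apply: na; exists b.
  move=> inj; case: (pselect (exists i, z * x ^+ i = w)) => [[i iw]|ni].
    exists i.+1; right=> _ [j [_ ij _] <-] jw; apply: inj.
    by exists i, (j - i)%N; rewrite subn_gt0 ij subnKC 1?ltnW// iw jw.
  by exists 0%N; right=> _ [i _ <-] iw; apply: ni; exists i.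
- move=> z z' n.
  (* One coincidence propagates: multiplying it by [x ^+ (k - j)] turns [z' * x ^+ k] into [z] times
     a power whose exponent is still in [I n]. *)
  case: (pselect (exists i j, [/\ I n i, I n j & z' * x ^+ j = z * x ^+ i])).
    move=> [i [j [Ii Ij e]]]; exists (n + j)%N; left=> _ [k [k0 nk dk] <-].
    exists (x ^+ (i + (k - j))%N).
      exists (i + (k - j))%N => //; have [i0 ni di] := Ii; have [j0 nj dj] := Ij.
      split; [by rewrite addn_gt0 i0|exact: leq_trans ni (leq_addr _ _)|].
      apply: dvdn_add => //; apply: dvdn_sub => //; apply: dvdn_trans dk.
      exact/fact_dvdn/leq_addr.
    have jk : (j <= k)%N by apply: leq_trans nk; exact: leq_addl.
    by rewrite -{1}(subnKC jk) !expgnDr !mulgA e.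
  move=> nij; exists n; right=> _ _ [j Ij <-] [i Ii <-] e.
  by apply: nij; exists i, j.
pose a := (n.+1)`!; pose b := (a * 2)%N.
have a0 : (0 < a)%N by rewrite fact_gt0.
have Ia : I n a := In n.
have Ib : I n b.
  have [_ na da] := Ia; split; first by rewrite muln_gt0 a0.
    by rewrite (leq_trans na)// leq_pmulr.
  exact: dvdn_mulr.
apply: (@expg_idem x a b).
  by rewrite a0 /= ltn_Pmulr.
by rewrite (yn (x ^+ a) (imageP _ Ia)) (yn (x ^+ b) (imageP _ Ib)).
Qed.

End CommMonoid.

(** * Finiteness of the maximal subgroups *)

Section TorsionGroups.
Variables (M : monoidType).
Hypothesis mulC : commutative (@mul M).
Hypothesis ic : injectively_closed TzS M.
Variables (e : M).

(* Since all elements are torsion, a submonoid is a subgroup. *)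
Definition torsion_group (G : set M) :=
  [/\ G e, forall g h, G g -> G h -> G (g * h), forall g, G g -> e * g = g &
      forall g, G g -> exists2 n, (0 < n)%N & g ^+ n = e].

Lemma torsion_groupX G g n : torsion_group G -> G g -> (0 < n)%N -> G (g ^+ n).
Proof.
case=> _ GM _ _ Gg; elim: n => // -[|n] IH _ //.
by rewrite expgS; apply: GM => //; apply: IH.
Qed.

Lemma torsion_groupV G g : torsion_group G -> G g -> exists2 g', G g' & g * g' = e.
Proof.
move=> GG Gg; have [Ge _ eg tg] := GG; have [n n0 gn] := tg _ Gg.
(* The inverse is [g ^+ n.-1], except for [n = 1], because [g ^+ 0] is the unit of [M] and not
   [e]. *)
case: n n0 gn => // -[|n] _ gn; first by exists e; rewrite // mulC eg.
by exists (g ^+ n.+1); [exact: torsion_groupX|rewrite -expgS].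
Qed.

Lemma torsion_group_cancel G g u v : torsion_group G -> G g ->
  e * u = u -> e * v = v -> u * g = v * g -> u = v.
Proof.
move=> GG /(torsion_groupV GG)[g' _ gg'] eu ev uv.
by rewrite -eu -ev -gg' ![g * g' * _]mulC !mulgA uv.
Qed.

Definition subgroup (G K : set M) :=
  [/\ K `<=` G, K e & forall g h, K g -> K h -> K (g * h)].

Lemma subgroup_torsion G K : torsion_group G -> subgroup G K -> torsion_group K.
Proof. by move=> [_ _ eg tg] [KG Ke KM]; split=> // g /KG; [exact: eg|exact: tg]. Qed.

Lemma subgroup_div G K k g : torsion_group G -> subgroup G K -> K k -> G g ->
  K (k * g) -> K g.
Proof.
move=> GG KK Kk Gg; have [k' Kk' kk'] := torsion_groupV (subgroup_torsion GG KK) Kk.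
have [_ _ KM] := KK; have [_ _ eg _] := GG.
by move=> /(KM _ _ Kk'); rewrite mulgA (mulC k') kk' eg.
Qed.

Definition coset a (K : set M) : set M := mul a @` K.

Definition finite_index (G K : set M) :=
  subgroup G K /\ exists s : seq M, (forall t, t \in s -> G t) /\
    forall g, G g -> exists2 t, t \in s & coset t K g.

Lemma coset_mem G K a : torsion_group G -> subgroup G K -> G a -> coset a K a.
Proof.
by move=> [_ _ eg _] [_ Ke _] Ga; exists e => //; rewrite /= mulC eg.
Qed.

Lemma coset_eq G K a z b w : torsion_group G -> subgroup G K ->
  G a -> G b -> e * z = z -> e * w = w ->
  coset (z * a) K `&` coset (w * b) K !=set0 -> coset (z * a) K = coset (w * b) K.
Proof.
move=> GG KK; have KT := subgroup_torsion GG KK.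
suff H a' z' b' w' : G a' -> G b' -> e * z' = z' -> e * w' = w' ->
    coset (z' * a') K `&` coset (w' * b') K !=set0 ->
    coset (z' * a') K `<=` coset (w' * b') K.
  move=> Ga Gb ez ew zw; apply/seteqP; split; apply: H => //.
  by rewrite setIC.
move=> Ga Gb ez ew [_ [[k Kk <-] [l Kl kl]]] _ [m Km <-].
have [k' Kk' kk'] := torsion_groupV KT Kk; have [KG _ KM] := KK.
exists (l * (k' * m)); first exact: KM _ _ Kl (KM _ _ Kk' Km).
have [_ _ eg _] := GG.
by rewrite mulgA kl -!mulgA (mulgA k) kk' eg//; exact: KG.
Qed.

Lemma finite_indexI G K L : torsion_group G -> finite_index G K ->
  finite_index G L -> finite_index G (K `&` L).
Proof.
move=> GG [KK [s [sG sP]]] [LL [t [tG tP]]].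
have KL : subgroup G (K `&` L).
  have [KG Ke KM] := KK; have [LG Le LM] := LL; split=> // [g [/KG]//|].
  by move=> g h [Kg Lg] [Kh Lh]; split; [exact: KM|exact: LM].
split=> //; have [Ge GM eg _] := GG.
(* [r] selects a representative in each nonempty intersection of a coset of [K] with a coset of
   [L]. *)
have /choice[r rP] : forall ab : M * M, exists x,
    G x /\ ((coset ab.1 K `&` coset ab.2 L `&` G) !=set0 ->
     (coset ab.1 K `&` coset ab.2 L) x).
  move=> ab; case: (pselect ((coset ab.1 K `&` coset ab.2 L `&` G) !=set0)).
    by move=> [x [xab Gx]]; exists x.
  by move=> nab; exists e.
exists [seq r (a, b) | a <- s, b <- t]; split.
  by move=> _ /allpairsP[ab [_ _ ->]]; exact: (rP _).1.
move=> g Gg; have [a sa ag] := sP g Gg; have [b tb bg] := tP g Gg.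
exists (r (a, b)); first by apply/allpairsP; exists (a, b).
have [Gr [| rK rL]] := rP (a, b); first by exists g.
have [Ga Gb] := (sG _ sa, tG _ tb).
have [r' Gr' rr'] := torsion_groupV GG Gr.
have div (N : set M) c : subgroup G N -> G c -> coset c N (r (a, b)) ->
    coset c N g -> N (r' * g).
  move=> NN Gc [k Nk kr] [l Nl lg]; have [NG _ NM] := NN.
  apply: (subgroup_div GG NN Nk); first exact: GM.
  suff -> : k * (r' * g) = l by [].
  apply: (torsion_group_cancel GG Gc); [|exact/eg/NG|].
    by rewrite eg//; exact: (GM _ _ (NG _ Nk) (GM _ _ Gr' Gg)).
  by rewrite (mulC l) lg (mulC _ c) mulgA kr mulgA rr' eg.
exists (r' * g); first by split; [exact: (div _ a)|exact: (div _ b)].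
by rewrite /= mulgA rr' eg.
Qed.

Section Cauchy.
Variables (G : set M).
Hypothesis GG : torsion_group G.
(** Every subgroup of [G] is closed in the profinite topology. For separating points this is applied
    to the stabilizers in [G] of elements of [M]. *)
Hypothesis sepG : forall S g, subgroup G S -> G g -> ~ S g ->
  exists K, [/\ finite_index G K, S `<=` K & ~ K g].

Definition cauchy (u : set_system M) := ProperFilter u /\
  forall K, finite_index G K -> exists2 a, G a & u (coset a K).

(** The translate by [z] of the point that [u] defines in the profinite completion of [G]. *)
Definition cauchy_at (u : set_system M) z : set_system M := filter_from
  [set aK : M * set M | [/\ G aK.1, finite_index G aK.2 & u (coset aK.1 aK.2)]]
  (fun aK => coset (z * aK.1) aK.2).

Lemma cosetM z a K : coset (z * a) K = mul z @` coset a K.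
Proof.
apply/seteqP; split=> [_ [k Kk <-]|_ [_ [k Kk <-] <-]].
  by exists (a * k); [exists k|rewrite mulgA].
by exists k => //; rewrite /= mulgA.
Qed.

Let Ge : G e. Proof. by case: GG. Qed.
Let GM g h : G g -> G h -> G (g * h). Proof. by case: GG => _ + _ _; apply. Qed.
Let eG g : G g -> e * g = g. Proof. by case: GG => _ _ + _; apply. Qed.

Lemma finite_indexT : finite_index G G.
Proof.
split; first by split.
exists [:: e]; split=> [t|g Gg]; first by rewrite inE => /eqP->.
by exists e; [exact: mem_head|exists g => //; exact: eG].
Qed.

Lemma cauchy_coset_eq u K a b : cauchy u -> finite_index G K -> G a -> G b ->
  u (coset a K) -> u (coset b K) -> coset a K = coset b K.
Proof.
move=> [uF _] [KK _] Ga Gb ua ub; rewrite -(eG Ga) -(eG Gb).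
apply: (coset_eq GG) => //; rewrite ?eG//.
exact: (filter_ex (filterI ua ub)).
Qed.

Lemma cauchy_at_proper u z : cauchy u -> ProperFilter (cauchy_at u z).
Proof.
move=> cu; have [uF uK] := cu.
apply: filter_from_proper => [|[a K] [/= Ga [KK _] uaK]]; last first.
  by exists (z * a * e), e => //; case: KK.
apply: filter_from_filter.
  by have [a Ga ua] := uK _ finite_indexT; exists (a, G); split=> //; exact: finite_indexT.
move=> [a K] [b L] [/= Ga fK ua] [/= Gb fL ub].
have fKL := finite_indexI GG fK fL; have [c Gc uc] := uK _ fKL.
exists (c, K `&` L); first by split.
have cK : coset c K = coset a K.
  apply: (cauchy_coset_eq cu) => //; apply: filterS uc.
  by move=> _ [k [Kk _] <-]; exists k.
have cL : coset c L = coset b L.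
  apply: (cauchy_coset_eq cu) => //; apply: filterS uc.
  by move=> _ [k [_ Kk] <-]; exists k.
rewrite /= !cosetM -cK -cL => _ [_ [k [Kk Lk] <-] <-].
by split; exists (c * k) => //; exists k.
Qed.

Lemma cauchy_principal : cauchy (principal_filter e).
Proof.
split=> [|K [[KG Ke KM] _]]; first by have [] := principal_filter_ultra e.
by exists e => //; apply/principal_filterP; exists e; rewrite //= eG.
Qed.

(** A coset [v K] lies in [e M], since [K] does. For [v] outside [e M] it misses [v] and cannot be a
    neighbourhood, so such [v] stay isolated. *)
Let Phi : set (set_system M) := [set F |
  (exists2 v, e * v <> v & F = principal_filter v) \/
  (exists u z, [/\ cauchy u, e * z = z & F = cauchy_at u z])].

Let nb x : set_system M := if pselect (e * x = x) is left _
  then cauchy_at (principal_filter e) x else principal_filter x.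

Let nb_in x : e * x = x -> nb x = cauchy_at (principal_filter e) x.
Proof. by move=> ex; rewrite /nb; case: pselect. Qed.

Let nb_out x : e * x <> x -> nb x = principal_filter x.
Proof. by move=> ex; rewrite /nb; case: pselect. Qed.

Let nb_Phi x : Phi (nb x).
Proof.
rewrite /nb; case: pselect => ex; last by left; exists x.
by right; exists (principal_filter e), x; split=> //; exact: cauchy_principal.
Qed.

Let Phi_proper F : Phi F -> ProperFilter F.
Proof.
case=> [[v _ ->]|[u [z [cu _ ->]]]]; last exact: cauchy_at_proper.
by have [] := principal_filter_ultra v.
Qed.

Let principal_coset K : finite_index G K -> principal_filter e (coset e K).
Proof.
by move=> [KK _]; apply/principal_filterP; exact: (coset_mem GG KK).
Qed.

Let nb_mem x W : nb x W -> W x.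
Proof.
rewrite /nb; case: pselect => ex; last by move/principal_filterP.
move=> [[a K] [/= Ga [KK _]]] /principal_filterP[k Kk ak] aW; apply: aW.
by exists k => //=; rewrite -mulgA [a * k]ak mulC.
Qed.

Let cauchy_at_in u z W : (forall x, e * x = x -> W x) -> e * z = z -> cauchy u ->
  cauchy_at u z W.
Proof.
move=> We ez [uF uK]; have [a Ga ua] := uK _ finite_indexT.
exists (a, G); first by split=> //; exact: finite_indexT.
by move=> _ [k Gk <-]; apply: We; rewrite !mulgA ez.
Qed.

Let dec_out v : e * v <> v -> decided Phi [set v].
Proof.
move=> ev _ [[w ew ->]|[u [z [cu ez ->]]]].
  by case: (pselect (w = v)) => [->|wv]; [left|right]; apply/principal_filterP.
by right; apply: cauchy_at_in => // x ex /= xv; apply: ev; rewrite -xv.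
Qed.

Let dec_coset z a K : e * z = z -> G a -> finite_index G K ->
  decided Phi (coset (z * a) K).
Proof.
move=> ez Ga fK _ [[w ew ->]|[u [w [cu ew ->]]]].
  by case: (pselect (coset (z * a) K w)); [left|right]; apply/principal_filterP.
have [_ uK] := cu; have [b Gb ub] := uK _ fK.
case: (pselect (coset (w * b) K `&` coset (z * a) K !=set0)) => [|ne].
  move/(coset_eq GG fK.1 Gb Ga ew ez) => wz; left; exists (b, K); first by split.
  by rewrite /= wz.
right; exists (b, K); first by split.
by move=> x wx zx; apply: ne; exists x.
Qed.

Let nb_sep x y : x <> y -> exists W, [/\ decided Phi W, nb x W & ~ W y].
Proof.
move=> xy; case: (pselect (e * x = x)) => ex; last first.
  exists [set x]; rewrite nb_out//; split=> [|//|/= yx]; last exact: xy.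
  exact: dec_out.
case: (pselect (e * y = y)) => ey; last first.
  exists [set x | e * x = x]; split=> //; last first.
    rewrite nb_in//; apply: cauchy_at_in => //; exact: cauchy_principal.
  move=> _ [[w ew ->]|[u [z [cu ez ->]]]].
    by right; apply/principal_filterP.
  by left; exact: cauchy_at_in.
have nbK K : finite_index G K -> nb x (coset (x * e) K).
  move=> fK; rewrite nb_in//; exists (e, K) => //; split=> //.
  exact: principal_coset.
have decK K : finite_index G K -> decided Phi (coset (x * e) K) by exact: dec_coset.
have xe : x * e = x by rewrite mulC.
case: (pselect (coset (x * e) G y)) => [[g Gg]|nG]; last first.
  exists (coset (x * e) G); split=> //; [apply: decK|apply: nbK]; exact: finite_indexT.
(* Here [y = x * g]. The stabilizer [S] of [x] does not contain [g], so some [K] of finite index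
   above [S] avoids [g], and then [x K] avoids [y]. *)
rewrite /= xe => xgy; pose S := [set s | G s /\ x * s = x].
have SS : subgroup G S.
  split=> [s []//|//|s t [Gs xs] [Gt xt]].
  by split; [exact: GM|rewrite mulgA xs].
have [|K [fK SK nKg]] := sepG SS Gg.
  by move=> [_ xg]; apply: xy; rewrite -xgy xg.
exists (coset (x * e) K); split; [exact: decK|exact: nbK|].
rewrite xe => -[k Kk /= xky]; apply: nKg.
have [KK _] := fK; have [KG _ KM] := KK; have Gk := KG _ Kk.
have [k' Kk' kk'] := torsion_groupV (subgroup_torsion GG KK) Kk.
apply: (subgroup_div GG KK Kk') => //; apply: SK; split; first exact/GM/Gg/KG.
by rewrite (mulC k') mulgA xgy -xky -mulgA kk'.
Qed.

Let PhiM F H : Phi F -> Phi H -> exists2 L, Phi L &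
    forall W, decided Phi W -> L W -> exists P Q,
      [/\ decided Phi P, F P, decided Phi Q, H Q &
          forall x y, P x -> Q y -> W (x * y)].
Proof.
have half v u z W : e * v <> v -> cauchy u -> e * z = z ->
    cauchy_at u (v * z) W -> exists P Q, [/\ decided Phi P, principal_filter v P,
      decided Phi Q, cauchy_at u z Q & forall x y, P x -> Q y -> W (x * y)].
  move=> ev cu ez [[a K] [/= Ga fK ua] aW]; exists [set v], (coset (z * a) K).
  split; [exact: dec_out|exact/principal_filterP|exact: dec_coset| |].
    by exists (a, K).
  by move=> _ _ -> [k Kk <-]; apply: aW; exists k => //; rewrite /= !mulgA.
move=> [[v ev ->]|[u [z [cu ez ->]]]] [[w ew ->]|[u' [z' [cu' ez' ->]]]].
- exists (nb (v * w)) => // W _ /nb_mem Wvw; exists [set v], [set w].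
  by split; [exact: dec_out|exact/principal_filterP|exact: dec_out|
    exact/principal_filterP|move=> _ _ -> ->].
- exists (cauchy_at u' (v * z')).
    by right; exists u', (v * z'); split=> //; rewrite mulgA (mulC e) -mulgA ez'.
  by move=> W _; exact: half.
- exists (cauchy_at u (w * z)).
    by right; exists u, (w * z); split=> //; rewrite mulgA (mulC e) -mulgA ez.
  move=> W _ /half[]// P [Q [dP wP dQ uQ PQ]]; exists Q, P; split=> // x y Qx Py.
  by rewrite mulC; exact: PQ.
(* The product of the two points in the profinite completion. *)
pose uu : set_system M := filter_from [set PQ : set M * set M | u PQ.1 /\ u' PQ.2]
  (fun PQ => [set x * y | x in PQ.1 & y in PQ.2]).
have [uF uK] := cu; have [uF' uK'] := cu'.
have uuM K a b : finite_index G K -> u (coset a K) -> u' (coset b K) ->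
    uu (coset (a * b) K).
  move=> [[_ _ KM] _] ua ub; exists (coset a K, coset b K) => //.
  move=> _ [_ [k Kk <-] [_ [l Kl <-] <-]]; exists (k * l); first exact: KM.
  by rewrite /= (commACA mulC).
have cuu : cauchy uu.
  split; last first.
    move=> K fK; have [a Ga ua] := uK _ fK; have [b Gb ub] := uK' _ fK.
    by exists (a * b); [exact: GM|exact: uuM].
  apply: filter_from_proper => [|[P Q] [/= uP uQ]]; last first.
    by have [x Px] := filter_ex uP; have [y Qy] := filter_ex uQ; exists (x * y), x => //; exists y.
  apply: filter_from_filter.
    by exists (setT, setT); split; exact: filterT.
  move=> [P Q] [P' Q'] [/= uP uQ] [/= uP' uQ'].
  exists (P `&` P', Q `&` Q'); first by split; exact: filterI.
  by move=> _ [x [Px P'x] [y [Qy Q'y] <-]]; split; exists x => //; exists y.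
exists (cauchy_at uu (z * z')).
  by right; exists uu, (z * z'); split=> //; rewrite mulgA ez.
move=> W _ [[c K] [/= Gc fK uc] cW].
have [a Ga ua] := uK _ fK; have [b Gb ub] := uK' _ fK.
exists (coset (z * a) K), (coset (z' * b) K); split; [exact: dec_coset| |exact: dec_coset| |].
- by exists (a, K).
- by exists (b, K).
have cE := cauchy_coset_eq cuu fK Gc (GM Ga Gb) uc (uuM _ _ _ fK ua ub).
move=> _ _ [k Kk <-] [l Kl <-]; apply: cW; rewrite cosetM cE -cosetM.
have [[_ _ KM] _] := fK; exists (k * l); first exact: KM.
by rewrite /= [RHS](commACA mulC) [in RHS](commACA mulC z).
Qed.

Let nbM x y W : decided Phi W -> nb (x * y) W -> exists P Q,
  [/\ decided Phi P, nb x P, decided Phi Q, nb y Q &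
      forall u v, P u -> Q v -> W (u * v)].
Proof.
move=> dW.
have half v z : e * v <> v -> e * z = z -> nb (v * z) W -> exists P Q,
    [/\ decided Phi P, nb v P, decided Phi Q, nb z Q &
      forall x y, P x -> Q y -> W (x * y)].
  move=> ev ez; rewrite (nb_out ev) (nb_in ez) nb_in; last first.
    by rewrite mulgA (mulC e) -mulgA ez.
  move=> [[a K] [/= Ga fK ua] aW]; exists [set v], (coset (z * a) K).
  split; [exact: dec_out|exact/principal_filterP|exact: dec_coset| |].
    by exists (a, K).
  by move=> _ _ -> [k Kk <-]; apply: aW; exists k => //; rewrite /= !mulgA.
case: (pselect (e * x = x)) => ex; case: (pselect (e * y = y)) => ey.
- rewrite nb_in ?mulgA ?ex// => -[[a K] [/= Ga fK /principal_filterP ua] aW].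
  rewrite (nb_in ex) (nb_in ey).
  have cK := principal_coset fK.
  exists (coset (x * e) K), (coset (y * e) K).
  split; [exact: dec_coset|by exists (e, K)|exact: dec_coset|by exists (e, K)|].
  have cE : coset a K = coset e K.
    by apply: (cauchy_coset_eq cauchy_principal) => //; exact/principal_filterP.
  move=> _ _ [k Kk <-] [l Kl <-]; apply: aW; rewrite cosetM cE -cosetM.
  have [[_ _ KM] _] := fK; exists (k * l); first exact: KM.
  by rewrite /= [RHS](commACA mulC) [in RHS](commACA mulC x) (eG Ge).
- rewrite mulC => /half[]// P [Q [dP yP dQ xQ PQ]]; exists Q, P; split=> // u v Qu Pv.
  by rewrite mulC; exact: PQ.
- exact: half.
- move=> /nb_mem Wxy; rewrite (nb_out ex) (nb_out ey); exists [set x], [set y].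
  by split; [exact: dec_out|exact/principal_filterP|exact: dec_out|
    exact/principal_filterP|move=> _ _ -> ->].
Qed.

(** The point of the completion given by [u] must come from some [x] in [M]. The singletons outside
    [e M] are decided, which puts [x] in [e M], and the decided coset [e G] then puts it in [G]. *)
Lemma cauchy_cvg u : cauchy u ->
  exists2 x, G x & forall K, finite_index G K -> u (coset x K).
Proof.
move=> cu; pose D := Completion nb_Phi Phi_proper nb_mem nb_sep PhiM nbM.
have [|x /= xu] := @closed_completion _ D ic (cauchy_at u e).
  by right; exists u, e; split=> //; exact: eG.
have ex : e * x = x.
  apply: contrapT => ex; have [|[a K] [/= Ga [KK _] ua] aX] := (xu _ (dec_out ex)).2.
    by rewrite nb_out//; exact/principal_filterP.
  have /aX/= xa := coset_mem GG KK (GM Ge Ga).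
  by apply: ex; rewrite -xa mulgA !eG.
have [uF uK] := cu.
have xe : x * e = x by rewrite mulC.
have nbK K : finite_index G K -> nb x (coset x K).
  move=> fK; rewrite nb_in//; exists (e, K); last by rewrite xe.
  by split=> //; exact: principal_coset.
have Gx : G x.
  have [a Ga ua] := uK _ finite_indexT.
  have /(xu _ (dec_coset (eG Ge) Ge finite_indexT)).1/nb_mem[g Gg <-] :
      cauchy_at u e (coset (e * e) G).
    exists (a, G); first by split=> //; exact: finite_indexT.
    by move=> _ [g Gg <-]; exists (a * g); [exact: GM|rewrite /= (eG Ge) mulgA].
  by rewrite /= (eG Ge) eG.
exists x => // K fK; have := dec_coset ex Ge fK; rewrite xe => /xu[_].
move=> /(_ (nbK _ fK))[[a L] [/= Ga _ ua] aL].
by apply: filterS ua; rewrite -[X in coset X _](eG Ga).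
Qed.

Lemma finite_index_infinite K : finite_index G K -> infinite_set G -> infinite_set K.
Proof.
move=> [_ [s [_ sP]]] infG fK; apply: infG.
apply: (@sub_finite_set _ _ (\bigcup_(t in [set` s]) coset t K)).
  by move=> g /sP[t ts tg]; exists t.
by apply: bigcup_finite => // t _; exact: finite_image.
Qed.

(* Nested cosets [c n K n] are chosen so that [h n] is not in the [n]-th one:
   a Cauchy ultrafilter containing all of them has no limit. *)
Lemma countable_torsion_finite (h : nat -> M) :
  (forall n, G (h n)) -> (forall g, G g -> exists n, h n = g) -> finite_set G.
Proof.
move=> Gh hG; apply: contrapT => infG.
pose D : set (nat * (M * set M)) := [set s | G s.2.1 /\ finite_index G s.2.2].
pose R (s s' : nat * (M * set M)) := [/\ s'.1 = s.1.+1,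
  coset s'.2.1 s'.2.2 `<=` coset s.2.1 s.2.2 & ~ coset s'.2.1 s'.2.2 (h s.1)].
have [|[n [c K]] [/= Gc fK]|s s0 sP] := @dependent_choice _ D R (0%N, (e, G)).
- by split=> //; exact: finite_indexT.
- have [[KG Ke KM] _] := fK; have KK := fK.1.
  have infK := finite_index_infinite fK infG.
  (* [K] is infinite, so the current coset has an element [c * k] other than [h n]; separating [e]
     from the quotient of [h n] by [c * k] then gives a smaller coset of [c * k] without [h n]. *)
  have [k Kk ckh] : exists2 k, K k & c * k <> h n.
    apply: contrapT => nk; apply: infK; have [c' Gc' cc'] := torsion_groupV GG Gc.
    apply: (@sub_finite_set _ _ [set c' * h n]) => // k Kk /=.
    have <- : c * k = h n by apply: contrapT => ckh; apply: nk; exists k.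
    by rewrite mulgA (mulC c') cc' eG//; exact: KG.
  have Gck : G (c * k) by apply/GM/KG.
  have [d Gd cd] := torsion_groupV GG Gck.
  have SS : subgroup G [set e].
    by split=> [_ ->|//|_ _ -> ->]; [exact: Ge|rewrite /= eG].
  have [|dn|L [fL _ nL]] := @sepG [set e] (d * h n) SS; first exact: GM.
    by apply: ckh; rewrite -[LHS](eG Gck) mulC -dn mulgA cd eG.
  exists (n.+1, (c * k, K `&` L)).
    by split=> //=; exact: finite_indexI.
  split=> //= [_ [l [Kl _] <-]|[l [Kl Ll] e']].
    by exists (k * l); [exact: KM|rewrite /= mulgA].
  apply: nL; rewrite -e' /= (mulgA d) (mulC d) cd eG//; exact: KG.
pose c n := (s n).2.1; pose K n := (s n).2.2.
have s1 n : (s n).1 = n by elim: n => [|n IH]; [rewrite s0|have [_ [->]] := sP n; rewrite IH].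
have fK n : finite_index G (K n) by have [[]] := sP n.
have Gc n : G (c n) by have [[]] := sP n.
have KS n : coset (c n.+1) (K n.+1) `<=` coset (c n) (K n) by have [_ []] := sP n.
have nh n : ~ coset (c n.+1) (K n.+1) (h n) by have [_ [_ _]] := sP n; rewrite s1.
have Kle m n : (m <= n)%N -> coset (c n) (K n) `<=` coset (c m) (K m).
  move=> mn; rewrite -(subnKC mn); elim: (n - m)%N => [|i IH]; rewrite ?addn0//.
  by rewrite addnS; apply: subset_trans IH; exact: KS.
have UF : ProperFilter (filter_from setT (fun n => coset (c n) (K n))).
  apply: filter_from_proper => [|n _]; last first.
    by exists (c n); apply: (coset_mem GG (fK n).1).
  apply: filter_fromT_filter; first by exists 0%N.
  move=> i j; exists (maxn i j) => x Ux; split; apply: Kle Ux;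
    [exact: leq_maxl|exact: leq_maxr].
have [u [uU Uu]] := ultraFilterLemma UF.
have ucK n : u (coset (c n) (K n)) by apply: Uu; exists n.
have uG : u G.
  apply: filterS (ucK 0%N) => _ [k Kk <-]; apply: GM (Gc _) _.
  by have [[KG _ _] _] := fK 0%N; exact: KG.
have cu : cauchy u.
  split; first exact: ultra_proper.
  (* Finitely many cosets of [L] cover [G], so the ultrafilter contains one of them. *)
  move=> L [LL [t [tG tP]]].
  have /choice[f fP] : forall g, exists a, G g -> a \in t /\ coset a L g.
    by move=> g; case: (pselect (G g)) => [/tP[a ta ag]|nG]; [exists a|exists e].
  have [|a ta ua] := @ultra_finite _ _ u f [set` t] uU (finite_seq _).
    by apply: filterS uG => g /fP[].
  exists a; first exact: tG.
  by apply: filterS (filterI ua uG) => g [<- /fP[]].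
have [x Gx xu] := cauchy_cvg cu; have [n nx] := hG _ Gx.
apply: (nh n); rewrite nx.
rewrite -(cauchy_coset_eq cu (fK n.+1) Gx (Gc n.+1) (xu _ (fK n.+1)) (ucK n.+1)).
exact: (coset_mem GG (fK n.+1).1).
Qed.

End Cauchy.
End TorsionGroups.

(** * Groups whose elements have squarefree order *)

Definition squarefree n := (0 < n)%N /\ forall p, prime p -> (logn p n <= 1)%N.

Lemma squarefree_dvdn m n : squarefree n -> (m %| n)%N -> squarefree m.
Proof.
move=> [n0 sn] mn; split; first exact: dvdn_gt0 mn.
by move=> p pp; apply: leq_trans (sn p pp); exact: dvdn_leq_log.
Qed.

Lemma squarefree_lcm m n : squarefree m -> squarefree n -> squarefree (lcmn m n).
Proof.
move=> [m0 sm] [n0 sn]; split; first by rewrite lcmn_gt0 m0.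
by move=> p pp; rewrite logn_lcm// geq_max sm// sn.
Qed.

Lemma squarefree_prime_power n r : squarefree n -> (1 < n)%N ->
  (forall p, prime p -> (p %| n)%N -> p = r) -> n = r.
Proof.
move=> [n0 sn] n1 nr; have pp := pdiv_prime n1.
have pr := nr _ pp (pdiv_dvd n); rewrite pr in pp.
have /dvdnP[m nE] : (r %| n)%N by rewrite -pr pdiv_dvd.
have [m1|m1] := leqP m 1.
  by case: m m1 nE => [|[|//]] _ nE; [rewrite nE in n0|rewrite nE mul1n].
have r_m : (r %| m)%N.
  rewrite -(nr (pdiv m)) ?pdiv_dvd ?pdiv_prime//.
  by rewrite nE dvdn_mulr// pdiv_dvd.
have := sn r pp; rewrite leqNgt => /negP[].
rewrite nE -pfactor_dvdn -?nE// nE expnS expn1; exact: dvdn_mul.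
Qed.

Section TorsionGroups.
Variables (M : monoidType).
Hypothesis mulC : commutative (@mul M).
Variables (e : M) (G : set M).
Hypothesis GG : torsion_group e G.

Lemma subgroupX K g n : subgroup e G K -> K g -> (0 < n)%N -> K (g ^+ n).
Proof. by move=> KK; exact: (torsion_groupX (subgroup_torsion GG KK)). Qed.

Lemma subgroup_coprime K g a b : subgroup e G K -> G g -> (0 < a)%N -> (0 < b)%N ->
  coprime a b -> K (g ^+ a) -> K (g ^+ b) -> K g.
Proof.
move=> KK Gg a0 b0 ab Ka Kb; case: (egcdnP b a0) => u v uv _.
move: uv; rewrite (eqP ab) => uv.
have u0 : (0 < u)%N by case: u uv => //; rewrite mul0n addn1.
have : K (g ^+ (u * a)%N) by rewrite mulnC expgnA; exact: subgroupX.
rewrite uv addn1 expgSr; case: (posnP v) => [->|v0]; first by rewrite mul0n mul1g.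
apply: (subgroup_div mulC GG KK _ Gg); rewrite mulnC expgnA; exact: subgroupX.
Qed.

(** Let [K] be maximal among the subgroups containing [S] and missing [g]. Then [g] lies in every
    subgroup strictly above [K]. This forces all elements outside [K] to have the same prime order
    modulo [K], and the powers of [g] to represent all cosets. *)
Lemma squarefree_separated :
  (forall g, G g -> exists2 n, squarefree n & g ^+ n = e) ->
  forall S g, subgroup e G S -> G g -> ~ S g ->
    exists K, [/\ finite_index e G K, S `<=` K & ~ K g].
Proof.
move=> sfG S g SS Gg nSg; have [Ge GM eG _] := GG.
pose P K := [/\ subgroup e G K, S `<=` K & ~ K g].
have [F FP tF|K [KP Kmax]] := @Zorn_bigcup M [set K | K = set0 \/ P K].
  case: (pselect (exists2 K, F K & P K)) => [[K0 FK0 PK0]|nF]; last first.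
    left; apply/seteqP; split=> // x [K FK Kx].
    by have [K0|PK] := FP _ FK; [rewrite K0 in Kx|apply: nF; exists K].
  have PF K x : F K -> K x -> P K by move=> /FP[->|].
  right; have [[KG Ke KM] SK nKg] := PK0; split.
  - split=> [x [K FK Kx]||x y [K FK Kx] [L FL Ly]].
    + by have [[+ _ _] _ _] := PF _ _ FK Kx; apply.
    + by exists K0.
    + have [KL|LK] := tF _ _ FK FL.
        exists L => //; have [[_ _ LM] _ _] := PF _ _ FL Ly.
        by apply: LM => //; exact: KL.
      exists K => //; have [[_ _ LM] _ _] := PF _ _ FK Kx.
      by apply: LM => //; exact: LK.
  - by move=> x /SK; exists K0.
  - by move=> [K FK Kg]; have [_ _] := PF _ _ FK Kg; exact.
have {KP} PK : P K.
  case: KP => // K0; exfalso; apply: (Kmax S); last by right; split.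
  rewrite K0; split=> // S0; have [_ Se _] := SS.
  exact: (S0 _ Se).
have [KK SK nKg] := PK; have [KG Ke KM] := KK.
exists K; split=> //; split=> //.
have ext h : G h -> ~ K h -> exists k t, K k /\ g = k * h ^+ t.
  move=> Gh nKh; apply: contrapT => nkt.
  pose L := [set x | exists k t, K k /\ x = k * h ^+ t].
  apply: (Kmax L).
    split=> [k Kk|LK]; first by exists k, 0%N; rewrite expg0 mulg1.
    by apply/nKh/LK; exists e, 1%N; rewrite expg1 eG.
  right; split=> //; last first.
    by move=> x /SK Kx; exists x, 0%N; rewrite expg0 mulg1.
  split=> [_ [k [t [Kk ->]]]||_ _ [k [t [Kk ->]]] [l [s [Kl ->]]]].
  - case: t => [|t]; first by rewrite expg0 mulg1; exact: KG.
    by apply: GM; [exact: KG|exact: (torsion_groupX GG)].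
  - by exists e, 0%N; rewrite expg0 mulg1.
  - exists (k * l), (t + s)%N; split; first exact: KM.
    by rewrite (commACA mulC) -expgnDr.
have uniq_r r r' : prime r -> prime r' -> K (g ^+ r) -> K (g ^+ r') -> r = r'.
  move=> rp rp' Kr Kr'; apply/eqP/negP => rr'; apply: nKg.
  apply: (subgroup_coprime KK Gg _ _ _ Kr Kr'); rewrite ?prime_gt0//.
  by rewrite prime_coprime// dvdn_prime2//; exact/negP.
have [n [n0 _] gn] := sfG _ Gg.
(* Exponents are reduced to the range from 1 to [n] instead of starting at 0, because [g ^+ 0] is
   the unit of [M]. *)
have gmod u : (0 < u)%N -> g ^+ u = g ^+ (u.-1 %% n).+1.
  move=> u0; rewrite -{1}(prednK u0) {1}(divn_eq u.-1 n).
  case: (posnP (u.-1 %/ n)) => [->|d0]; first by rewrite mul0n add0n.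
  rewrite -addnS expgnDr mulnC expgnA gn.
  suff -> : e ^+ (u.-1 %/ n) = e by rewrite eG//; exact: (torsion_groupX GG).
  by case: (u.-1 %/ n)%N d0 => // d _; elim: d => // d IH; rewrite expgS IH eG.
exists [seq g ^+ i.+1 | i <- iota 0 n]; split.
  by move=> _ /mapP[i _ ->]; exact: (torsion_groupX GG).
move=> h Gh; case: (pselect (K h)) => [Kh|nKh].
  exists e; last by exists h => //; exact: eG.
  apply/mapP; exists n.-1; last by rewrite prednK.
  by rewrite mem_iota; lia.
have [q [q0 sq] hq] := sfG _ Gh.
have exd : exists d, (0 < d)%N && `[< K (h ^+ d) >].
  by exists q; rewrite q0 hq; apply/asboolP.
case: (ex_minnP exd) => d /andP[d0 /asboolP Kd] dmin.
have dq : (d %| q)%N.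
  rewrite /dvdn; apply/negPn/negP; rewrite -lt0n => r0.
  have : (d <= q %% d)%N.
    apply: dmin; rewrite r0; apply/asboolP.
    case: (posnP (q %/ d)) => [qd|qd].
      by move: hq; rewrite {1}(divn_eq q d) qd mul0n add0n => ->.
    apply: (subgroup_div mulC GG KK (subgroupX KK Kd qd)).
      exact: (torsion_groupX GG).
    by rewrite -expgnA -expgnDr mulnC -divn_eq hq.
  by rewrite leqNgt ltn_mod d0.
have d1 : (1 < d)%N.
  by case: d d0 Kd {dmin dq} => [|[|//]] // _; rewrite expg1.
(* By minimality of [d], the power [h ^+ (d / r)] is not in [K], so modulo [K] the element [g] is a
   power of it and is killed by [r]. *)
have rK r : prime r -> (r %| d)%N -> K (g ^+ r).
  move=> rp /dvdnP[c dE]; have c0 : (0 < c)%N by case: c dE d0 => // ->.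
  have nKc : ~ K (h ^+ c).
    move=> Kc; have : (d <= c)%N by apply: dmin; rewrite c0; apply/asboolP.
    by rewrite dE leqNgt ltn_Pmulr// prime_gt1.
  have [k [t [Kk gE]]] := ext _ (torsion_groupX GG Gh c0) nKc.
  rewrite gE (expg_mulC mulC) -!expgnA (mulnC t) mulnA -dE.
  have Kr := subgroupX KK Kk (prime_gt0 rp).
  case: t {gE} => [|t]; first by rewrite muln0 expg0 mulg1.
  by apply: KM => //; rewrite expgnA; exact: subgroupX.
have pd := pdiv_prime d1; have Kpd := rK _ pd (pdiv_dvd d).
have dr : d = pdiv d.
  apply: squarefree_prime_power => //; first exact: (squarefree_dvdn (conj q0 sq)).
  by move=> p pp /(rK _ pp) Kp; exact: uniq_r.
have [k [t [Kk gE]]] := ext _ Gh nKh.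
have t0 : (0 < t)%N.
  by case: t gE => // gE; case: nKg; rewrite gE expg0 mulg1.
have cop : coprime t d.
  rewrite coprime_sym {1}dr prime_coprime// -dr; apply/negP => /dvdnP[s tE].
  apply: nKg; rewrite gE; apply: KM => //; rewrite tE mulnC expgnA.
  by apply: subgroupX => //; case: s tE t0 => // ->.
(* Modulo [K], [g] is [h ^+ t] with [t] invertible modulo the order [d] of [h], so conversely [h] is
   a power [g ^+ u]. *)
case: (egcdnP d t0) => u v uv _; move: uv; rewrite (eqP cop) => uv.
have u0 : (0 < u)%N by case: u uv => //; rewrite mul0n addn1.
exists (g ^+ u).
  apply/mapP; exists (u.-1 %% n)%N; last exact: gmod.
  by rewrite mem_iota /= add0n ltn_mod.
have [l Kl lE] : exists2 l, K l & g ^+ u = l * h.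
  rewrite gE (expg_mulC mulC) -expgnA (mulnC t) uv addn1 expgSr mulgA.
  have Ku := subgroupX KK Kk u0.
  case: (posnP v) => [->|v0]; first by exists (k ^+ u); rewrite // mul0n mulg1.
  exists (k ^+ u * h ^+ (v * d)%N) => //; apply: KM => //.
  by rewrite mulnC expgnA; exact: subgroupX.
have [l' Kl' ll'] := torsion_groupV mulC (subgroup_torsion GG KK) Kl.
by exists l' => //; rewrite /= lE mulC mulgA (mulC l') ll' eG.
Qed.

End TorsionGroups.

(** * Quasi-cyclic groups *)

Section Pruefer.
Variables (M : monoidType).
Hypothesis mulC : commutative (@mul M).
Hypothesis ic : injectively_closed TzS M.
Variables (p : nat) (y : nat -> M).
Hypotheses (p_prime : prime p) (y1 : y 1%N <> y 0%N).
Hypotheses (ey : forall i, y 0%N * y i = y i) (yp : forall i, y i.+1 ^+ p = y i).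
Local Notation e := (y 0%N).

Lemma pruefer_exp i k : y (i + k)%N ^+ (p ^ k)%N = y i.
Proof.
elim: k => [|k IH]; first by rewrite addn0 expn0 expg1.
by rewrite addnS expnS expgnA yp IH.
Qed.

Lemma pruefer_expe i n : (0 < n)%N -> y i ^+ (p ^ i * n)%N = e.
Proof.
move=> n0; rewrite expgnA (pruefer_exp 0).
by case: n n0 => // n _; elim: n => // n IH; rewrite expgS IH ey.
Qed.

Let cyc j : set M := [set c | exists t, c = e * y j ^+ t].

Let cyc_e j c : cyc j c -> e * c = c.
Proof. by move=> [t ->]; rewrite mulgA ey. Qed.

Let cyc_ex j m : (0 < m)%N -> cyc j (y j ^+ m).
Proof. by case: m => // m _; exists m.+1; rewrite expgS mulgA ey. Qed.

Let cycM j c d : cyc j c -> cyc j d -> cyc j (c * d).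
Proof.
by move=> [s ->] [t ->]; exists (s + t)%N; rewrite (commACA mulC) ey expgnDr.
Qed.

Let cyc_le i j c : (i <= j)%N -> cyc i c -> cyc j c.
Proof.
move=> ij [t ->]; exists (p ^ (j - i) * t)%N.
by rewrite expgnA -[in y j](subnKC ij) pruefer_exp.
Qed.

Let cycV j c : cyc j c -> exists2 d, cyc j d & c * d = e.
Proof.
have p0 := prime_gt0 p_prime.
move=> [t ->]; exists (e * y j ^+ (t * (p ^ j).-1)); first by eexists.
rewrite (commACA mulC) ey -expgnDr -[X in (X + _)%N]muln1 -mulnDr add1n prednK; last first.
  by rewrite expn_gt0 p0.
case: (posnP t) => [->|t0]; first by rewrite mul0n expg0 mulg1.
by rewrite mulnC pruefer_expe// ey.
Qed.

(** The index [l ^ 2] exceeds [l.-1 ^ 2] by [(2 * l).-1], so [y (l ^ 2) ^+ m] is outside the group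
    of the previous level. A collision after multiplication by [z] would put some [y j] with
    [j > l.-1 ^ 2 >= k] into the stabilizer of [e * z], and with it [y k]. *)
Let level_inj z k l m c : y k * z <> e * z -> (k < l)%N -> (0 < m < p ^ (2 * l).-1)%N ->
  cyc (l.-1 ^ 2)%N c -> y (l ^ 2)%N ^+ m * z <> c * z.
Proof.
move=> ykz kl /andP[m0 mlt] cb yz.
set b := (l.-1 ^ 2)%N in cb; set q := (l ^ 2)%N in yz; set d := (2 * l).-1 in mlt.
have qE : q = (b + d)%N by rewrite /q /b /d; case: l kl {mlt q b d cb yz} => // l _; nia.
have kb : (k <= b)%N.
  by rewrite /b; case: l kl {mlt q b d cb yz qE} => // l; rewrite ltnS /= => kl; nia.
have [c' [t c'E] cc'] := cycV cb.
pose N n := y q ^+ n * (e * z) = e * z.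
have NM n a : N n -> N (a * n)%N.
  move=> Nn; elim: a => [|a IH]; first by rewrite /N mul0n expg0 mul1g.
  by rewrite /N mulSn expgnDr -mulgA IH.
have ND n n' : N n' -> N (n + n')%N -> N n.
  by move=> Nn'; rewrite /N expgnDr -mulgA Nn'.
(* [A] is the exponent of [y q] in the quotient of [y q ^+ m] by [c]. It is not divisible by
   [p ^ d], so its gcd with [p ^ q] is [p ^ v] for some [v < d]. *)
pose A := (m + p ^ d * t)%N.
have NA : N A.
  have yb : y q ^+ (p ^ d)%N = y b by rewrite qE pruefer_exp.
  rewrite /N /A expgnDr expgnA yb (mulC e z) (commACA mulC (y q ^+ m) z) yz (mulC (y b ^+ t) e) -c'E.
  by rewrite (mulC (c * z)) mulgA (mulC c') cc' (mulC z).
have NB : N (p ^ q)%N.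
  by rewrite /N -[X in _ ^+ X]muln1 pruefer_expe// mulgA ey.
have A0 : (0 < A)%N by rewrite /A addn_gt0 m0.
have Ng : N (gcdn A (p ^ q)).
  by case: (egcdnP (p ^ q) A0) => u v uv _; apply: (ND _ (v * p ^ q)%N);
    rewrite 1?addnC -?uv; exact: NM.
have /(dvdn_pfactor _ _ p_prime)[v vq gE] := dvdn_gcdr A (p ^ q).
have vd : (v < d)%N.
  rewrite ltnNge; apply/negP => dv.
  have : (p ^ d %| A)%N.
    by apply: dvdn_trans (dvdn_gcdl A (p ^ q)); rewrite gE dvdn_exp2l.
  by rewrite /A dvdn_addl ?dvdn_mulr// gtnNdvd.
apply: ykz; have kq : (k <= q - v)%N by rewrite qE; lia.
have yv n : y (q - v)%N ^+ n * (e * z) = e * z.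
  elim: n => [|n IH]; first by rewrite expg0 mul1g.
  rewrite expgS -mulgA IH.
  by move: Ng; rewrite gE /N -{1}(subnK vq) pruefer_exp.
have yk : y (q - v)%N ^+ (p ^ (q - v - k))%N = y k.
  by rewrite -{1}(subnKC kq) pruefer_exp.
by have := yv (p ^ (q - v - k))%N; rewrite yk mulgA (mulC _ e) ey.
Qed.

Let cyc_z z j c : (forall k, y k * z = e * z) -> cyc j c -> c * z = e * z.
Proof.
move=> yz [t ->]; elim: t => [|t IH]; first by rewrite expg0 mulg1.
have -> : e * y j ^+ t.+1 * z = e * y j ^+ t * (y j * z) by rewrite expgSr !mulgA.
by rewrite yz mulgA (mulC (e * _) e) -mulgA IH mulgA ey.
Qed.

(** In [U n], the exponent [m] at level [l] may go up to [2 ^ (l - n)]. Passing from [n.+1] to [n]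
    doubles the bound, which accommodates products within a level; in a product of two levels the
    lower factor is absorbed into [c]. The quadratic spacing of levels keeps [2 ^ (l - n)] below
    [p ^ (2 * l).-1], as [level_inj] requires. *)
Lemma no_pruefer : False.
Proof.
have p2 := prime_gt1 p_prime.
pose U n : set M := [set g | exists l m c, [/\ (n.+2 <= l)%N, (0 < m <= 2 ^ (l - n))%N,
  cyc (l.-1 ^ 2)%N c & g = y (l ^ 2)%N ^+ m * c]].
have mlt l n m : (n.+2 <= l)%N -> (0 < m <= 2 ^ (l - n))%N -> (0 < m < p ^ (2 * l).-1)%N.
  move=> nl /andP[-> ml] /=; apply: leq_ltn_trans ml _.
  apply: (@leq_trans (2 ^ (2 * l).-1)); first by rewrite ltn_exp2l//; lia.
  by rewrite leq_exp2r//; lia.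
have ce j : cyc j e by exists 0%N; rewrite expg0 mulg1.
have Uy n : U n (y (n.+2 ^ 2)%N).
  exists n.+2, 1%N, e; split=> //; first by rewrite expn_gt0.
  by rewrite expg1 mulC ey.
have lsq l : (l <= l ^ 2)%N by nia.
have Ucyc n g : U n g -> exists j, cyc j g.
  move=> [l [m [c [nl /andP[m0 _] cc ->]]]]; exists (l ^ 2)%N; apply: cycM.
    exact: cyc_ex.
  by apply: cyc_le cc; rewrite leq_exp2r// leq_pred.
have [|||||x [n Ux]] := base_principal mulC ic (U := U).
- move=> i j ij g [l [m [c [jl /andP[m0 ml] cc gE]]]]; exists l, m, c; split=> //.
    by apply: leq_trans jl; rewrite !ltnS.
  by rewrite m0 (leq_trans ml)// leq_pexp2l// leq_sub2l.
- by move=> n; exists (y (n.+2 ^ 2)%N).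
- move=> n; exists n.+1 => g g' Ug Ug'.
  have half l m c l' m' c' : (l < l')%N -> (n.+2 < l')%N ->
      (0 < m)%N -> (0 < m' <= 2 ^ (l' - n.+1))%N ->
      cyc (l.-1 ^ 2)%N c -> cyc (l'.-1 ^ 2)%N c' ->
      U n ((y (l ^ 2)%N ^+ m * c) * (y (l' ^ 2)%N ^+ m' * c')).
    move=> ll' nl' m0 /andP[m'0 ml'] cc cc'.
    exists l', m', ((y (l ^ 2)%N ^+ m * c) * c'); split=> //.
    - exact: ltnW.
    - by rewrite m'0 (leq_trans ml')// leq_pexp2l//; lia.
    - apply: cycM => //; apply: cycM.
        by apply: (@cyc_le (l ^ 2)); [rewrite leq_exp2r//; lia|exact: cyc_ex].
      by apply: cyc_le cc; rewrite leq_exp2r//; lia.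
    - by rewrite mulgA (mulC (_ * c)) -mulgA.
  case: Ug Ug' => [l [m [c [nl mb cc ->]]]] [l' [m' [c' [nl' mb' cc' ->]]]].
  have [m0 ml] := andP mb; have [m'0 ml'] := andP mb'.
  case: (ltngtP l l') => ll'; [exact: half| |].
    by rewrite mulC; exact: half.
  subst l'; exists l, (m + m')%N, (c * c'); split=> //.
  - exact: ltnW.
  - rewrite addn_gt0 m0 /= (leq_trans (leq_add ml ml'))// addnn -mul2n -expnS.
    by rewrite leq_pexp2l//; lia.
  - exact: cycM.
  - by rewrite (commACA mulC) expgnDr.
- move=> z w; case: (pselect (forall k, y k * z = e * z)) => [yz|/existsNP[k ykz]].
    case: (pselect (e * z = w)) => ezw; exists 0%N; [left|right].
      by move=> u /Ucyc[j cu]; rewrite mulC (cyc_z yz cu).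
    by move=> u /Ucyc[j cu]; rewrite mulC (cyc_z yz cu).
  (* As [z] is not stabilized by [y k], levels beyond [k] do not collide after multiplication by
     [z]. So [w] is attained on at most one such level. *)
  have coll l m c l' m' c' : (l < l')%N -> (k < l')%N -> (0 < m)%N ->
      (0 < m' < p ^ (2 * l').-1)%N ->
      cyc (l.-1 ^ 2)%N c -> cyc (l'.-1 ^ 2)%N c' ->
      z * (y (l ^ 2)%N ^+ m * c) <> z * (y (l' ^ 2)%N ^+ m' * c').
    move=> ll' kl' m0 mb' cc cc' e'.
    have [d' cd' cd] := cycV cc'.
    have cg : cyc (l'.-1 ^ 2)%N (y (l ^ 2)%N ^+ m * c * d').
      apply: cycM => //; apply: cycM.
        by apply: (@cyc_le (l ^ 2)); [rewrite leq_exp2r//; lia|exact: cyc_ex].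
      by apply: cyc_le cc; rewrite leq_exp2r//; lia.
    apply: (level_inj (z := e * z) _ kl' mb' cg).
      by rewrite !mulgA (mulC _ e) !ey.
    transitivity (z * (y (l' ^ 2)%N ^+ m' * c') * d').
      by rewrite -cd !mulgA (mulC _ z) !mulgA.
    by rewrite -e' [RHS]mulgA (mulC _ e) (cyc_e cg) [RHS]mulC !mulgA.
  case: (pselect (exists2 u, U k u & z * u = w)) => [|nw]; last first.
    by exists k; right=> u Uu zu; apply: nw; exists u.
  move=> [_ [l [m [c [kl /andP[m0 _] cc ->]]]] zw].
  exists (maxn k l); right=> _ [l' [m' [c' [kl' mb' cc' ->]]]] zw'.
  have mb := mlt _ _ _ kl' mb'.
  have [ll' kl''] : (l < l')%N /\ (k < l')%N by lia.
  exact: (coll _ _ _ _ _ _ ll' kl'' m0 mb cc cc' (etrans zw (esym zw'))).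
- move=> z z' n.
  (* If [z' * u = z * v], then on [e M] the element [z'] acts like [z * v * u'] with [u'] inverse to
     [u], and on deep levels [v * u'] is absorbed into [c]. *)
  case: (pselect (exists u v, [/\ U n u, U n v & z' * u = z * v])) => [|nuv].
    move=> [u [v [/Ucyc[i cu] /Ucyc[j cv] uv]]].
    have [u' cu' uu'] := cycV cu.
    exists (n + i + j)%N; left=> _ [l [m [c [nl mb cc ->]]]].
    have lsq1 : (n + i + j <= l.-1 ^ 2)%N by apply: leq_trans (lsq _); lia.
    exists (y (l ^ 2)%N ^+ m * (c * (v * u'))).
      have [m0 ml] := andP mb.
      exists l, m, (c * (v * u')); split=> //; first by lia.
        by rewrite m0 (leq_trans ml)// leq_pexp2l//; lia.
      apply: cycM => //; apply: cycM.
        by apply: cyc_le cv; lia.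
      by apply: cyc_le cu'; lia.
    set Y := y _ ^+ m.
    transitivity (Y * c * (z' * (u * u'))).
      by rewrite [LHS]mulC uu' (mulC z') [RHS]mulgA -(mulgA Y c e) (mulC c) (cyc_e cc).
    by rewrite (mulgA z') uv -(mulgA z) (mulgA (Y * c)) (mulC (Y * c) z) -!mulgA.
  by exists n; right=> u v Uu Uv uv; apply: nuv; exists u, v.
have n1 := Ux _ (Uy n).
have n2 : U n (y (n.+3 ^ 2)%N).
  exists n.+3, 1%N, e; split=> //; first by rewrite expn_gt0.
  by rewrite expg1 mulC ey.
have n2' := Ux _ n2.
apply: (@level_inj e 1 n.+3 1 (y (n.+2 ^ 2)%N)) => //.
- by rewrite mulC ey (ey 0).
- apply: (@mlt _ 0%N) => //; first exact: expn_gt0.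
- by rewrite -[y _]expg1; exact: cyc_ex.
- by rewrite expg1 n1 n2'.
Qed.

End Pruefer.

Lemma infinite_seq T (A : set T) : infinite_set A ->
  exists2 a : nat -> T, injective a & forall n, A (a n).
Proof.
elim/Ppointed: T A => T A; first by rewrite emptyE; case; exact: finite_set0.
move=> /infiniteP/ppcard_leP[f]; exists f => [i j fij|n].
  by apply: (@inj _ _ _ f); rewrite ?inE.
exact: funS.
Qed.

Lemma injective_infinite T (A : set T) (a : nat -> T) :
  injective a -> (forall n, A (a n)) -> infinite_set A.
Proof.
move=> ai aA fA.
have [|x _] := @ultra_finite _ _ uoo a A _ fA; last exact: uoo_inj.
by apply: (filterS (F := uoo)) filterT => n _; exact: aA.
Qed.

(** * Finiteness of a maximal subgroup *)

Section MaximalSubgroups.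
Variables (M : monoidType).
Hypothesis mulC : commutative (@mul M).
Hypothesis ic : injectively_closed TzS M.

Definition maxgroup (e : M) : set M :=
  [set x | e * x = x /\ exists2 n, (0 < n)%N & x ^+ n = e].

Variables (e : M).
Hypothesis ee : idem e.

Lemma expg_unit n : (0 < n)%N -> e ^+ n = e.
Proof. by case: n => // n _; elim: n => // n IH; rewrite expgS IH. Qed.

Lemma maxgroup_torsion : torsion_group e (maxgroup e).
Proof.
split=> [|g h [eg [m m0 gm]] [eh [n n0 hn]]|g []//|g []//].
  by split=> //; exists 1%N.
split; first by rewrite mulgA eg.
exists (m * n)%N; first by rewrite muln_gt0 m0.
by rewrite expg_mulC// expgnA gm mulnC expgnA hn !expg_unit.
Qed.
Let HH := maxgroup_torsion.

Let sf := [set g | maxgroup e g /\ exists2 n, squarefree n & g ^+ n = e].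

Let sfM g h : sf g -> sf h -> sf (g * h).
Proof.
move=> [Hg [m sm gm]] [Hh [n sn hn]]; split; first by have [_ HM _ _] := HH; exact: HM.
exists (lcmn m n); first exact: squarefree_lcm.
rewrite expg_mulC//; have [l0 _] := squarefree_lcm sm sn.
have /dvdnP[a aE] := dvdn_lcml m n; have /dvdnP[b bE] := dvdn_lcmr m n.
rewrite {1}aE bE (mulnC a) (mulnC b) !expgnA gm hn !expg_unit//.
- by case: b bE l0 => // ->.
- by case: a aE l0 => // ->.
Qed.

(** Infinitely many elements of [sf] would generate a countable infinite group inside [sf],
    enumerated by codes of lists of indices. *)
Lemma squarefree_torsion_finite : finite_set sf.
Proof.
apply: contrapT => /infinite_seq[a ai asf].
pose pr := foldr (fun i x => a i * x) e.
have epr l : e * pr l = pr l.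
  by elim: l => //= i l IH; rewrite mulgA; have [[-> _] _] := asf i.
have prM l l' : pr (l ++ l') = pr l * pr l'.
  by elim: l => [|i l IH] /=; [rewrite epr|rewrite -mulgA -IH].
have prsf l : sf (pr l).
  elim: l => [|i l IH] /=; last exact: sfM.
  split; first by split=> //; exists 1%N.
  by exists 1%N => //; split=> // p _; rewrite logn1.
pose G := range pr.
have GG : torsion_group e G.
  split.
  - by exists [::].
  - by move=> _ _ [l _ <-] [l' _ <-]; exists (l ++ l').
  - by move=> _ [l _ <-].
  - by move=> _ [l _ <-]; have [[]] := prsf l.
apply: (@injective_infinite _ G a) => //.
  move=> n; exists [:: n] => //=.
  by rewrite mulC; have [[-> _] _] := asf n.
apply: (@countable_torsion_finite _ mulC ic e G GG _ (fun n => pr (odflt [::] (unpickle n)))).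
- apply: squarefree_separated => // _ [l _ <-].
  by have [_] := prsf l.
- by move=> n; eexists.
- by move=> _ [l _ <-]; exists (pickle l); rewrite pickleK.
Qed.

(** Let [q] be a common exponent of the finitely many elements of squarefree order. Every element is
    then killed by a power of [q], and taking [q]-th powers has finite fibres. In an infinite group,
    König's lemma for the tree in which [h] is a child of [h ^+ q] gives an infinite branch, and
    this contains a quasi-cyclic group. *)
Lemma maxgroup_finite : finite_set (maxgroup e).
Proof.
apply: contrapT => infH; have [He HM eH tH] := HH.
have [q [q0 sq] sfq] : exists2 q, squarefree q & forall g, sf g -> g ^+ q = e.
  have /(@finite_seqP M)[s sE] := squarefree_torsion_finite.
  suff H : forall t : seq M, {subset t <= s} ->
      exists2 q, squarefree q & forall g, g \in t -> g ^+ q = e.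
    by have [q sq qs] := H s (fun x => id); exists q => // g; rewrite sE => /qs.
  elim=> [|g t IH] ts.
    by exists 1%N => //; split=> // p _; rewrite logn1.
  have [q sq qt] := IH (fun x xt => ts _ (@mem_behead _ (g :: t) _ xt)).
  have [Hg [n sn gn]] : sf g by rewrite sE; exact/ts/mem_head.
  have [l0 sl] := squarefree_lcm sn sq.
  have /dvdnP[a aE] := dvdn_lcml n q; have /dvdnP[b bE] := dvdn_lcmr n q.
  exists (lcmn n q) => // h; rewrite inE => /orP[/eqP->|/qt hq].
    rewrite aE mulnC expgnA gn expg_unit//.
    by case: a aE l0 => // ->.
  rewrite bE mulnC expgnA hq expg_unit//.
  by case: b bE l0 => // ->.
have Hq g k : maxgroup e g -> maxgroup e (g ^+ (q ^ k)%N).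
  by move=> Hg; apply: (torsion_groupX HH) => //; rewrite expn_gt0 q0.
have sf_prime g p : maxgroup e g -> prime p -> g ^+ p = e -> sf g.
  move=> Hg pp gp; split=> //; exists p => //; split; first exact: prime_gt0.
  by move=> r rp; rewrite logn_prime//; case: eqP.
have qtorsion g : maxgroup e g -> exists k, g ^+ (q ^ k)%N = e.
  move=> Hg; have [_ [n n0 gn]] := Hg.
  elim/ltn_ind: n g Hg n0 gn => n IH g Hg n0 gn.
  have [n1|n1] := leqP n 1.
    exists 0%N; rewrite expn0; have n_1 : n = 1%N by lia.
    by rewrite -n_1.
  have pp := pdiv_prime n1; have /dvdnP[c nE] := pdiv_dvd n.
  have c0 : (0 < c)%N by case: c nE n0 => // ->.
  have [|||k kE] := IH c _ (g ^+ q) _ c0.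
  - by rewrite nE ltn_Pmulr// prime_gt1.
  - by rewrite -[q]expn1; exact: Hq.
  - rewrite -expgnA mulnC expgnA; apply: sfq; apply: (sf_prime _ _ _ pp).
      exact: (torsion_groupX HH).
    by rewrite -expgnA -nE.
  - by exists k.+1; rewrite expnS expgnA.
pose D x := [set h | maxgroup e h /\ exists k, h ^+ (q ^ k)%N = x].
pose fib x := [set h | maxgroup e h /\ h ^+ q = x].
have fib_finite x : finite_set (fib x).
  case: (pselect (fib x !=set0)) => [[h0 [Hh0 h0q]]|]; last first.
    by move/set0P/negP/negPn/eqP->; exact: finite_set0.
  apply: (@sub_finite_set _ _ (mul h0 @` sf)); last first.
    exact/finite_image/squarefree_torsion_finite.
  move=> h [Hh hq]; have [h1 Hh1 hh1] := torsion_groupV mulC HH Hh0.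
  exists (h1 * h); last by rewrite mulgA hh1 eH.
  split; first exact: HM.
  exists q => //; rewrite expg_mulC// hq -h0q mulC -expg_mulC// hh1.
  exact: expg_unit.
(* The root [e] is its own child; excluding it keeps the branch from being constant. *)
have DU x : D x `<=` [set x] `|` \bigcup_(h in fib x `\` [set e]) D h.
  move=> h [Hh [k]]; elim: k => [|k IH] hk; first by left; rewrite -hk expn0.
  have [he|he] := pselect (h ^+ (q ^ k)%N = e).
    apply: IH; rewrite he -hk expnS mulnC expgnA he.
    by rewrite expg_unit.
  right; exists (h ^+ (q ^ k)%N); last by split=> //; exists k.
  split=> //; split; first exact: Hq.
  by rewrite -expgnA mulnC -expnS.
have [|x [Hx Ix]|c c0 cP] := @dependent_choice _
    [set x | maxgroup e x /\ infinite_set (D x)] (fun x x' => x' ^+ q = x /\ x' <> e) e.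
- split=> // fD; apply: infH; apply: sub_finite_set fD => g Hg; split=> //.
  exact: qtorsion.
- apply: contrapT => nx; apply: Ix; apply: (sub_finite_set (@DU x)).
  rewrite finite_setU; split; first exact: finite_set1.
  apply: bigcup_finite => [|h [[Hh hx] he]].
    exact: sub_finite_set (fib_finite x).
  by apply: contrapT => Ih; apply: nx; exists h.
have order_prime n g : (0 < n)%N -> g ^+ n = e -> g <> e -> exists p a,
    [/\ prime p, (p %| n)%N, (0 < a)%N, g ^+ a <> e & g ^+ (a * p)%N = e].
  elim/ltn_ind: n => n IH n0 gn ge.
  have n1 : (1 < n)%N by case: n {IH} n0 gn => [|[|n]].
  have pp := pdiv_prime n1; have /dvdnP[a nE] := pdiv_dvd n.
  have a0 : (0 < a)%N by case: a nE n0 => // ->.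
  have [ga|ga] := pselect (g ^+ a = e); last first.
    by exists (pdiv n), a; split=> //; [exact: pdiv_dvd|rewrite -nE].
  have [|p [b [pp' pa b0 gb gbp]]] := IH a _ a0 ga ge.
    by rewrite nE ltn_Pmulr// prime_gt1.
  by exists p, b; split=> //; rewrite nE dvdn_mulr.
have cH i : maxgroup e (c i) by have [[]] := cP i.
have cq i : c i.+1 ^+ q = c i by have [_ []] := cP i.
have ce : c 1%N <> e by have [_ []] := cP 0%N.
have [|p [a [pp /dvdnP[u qE] a0 ca cap]]] := order_prime q (c 1%N) q0 _ ce.
  by rewrite cq.
have u0 : (0 < u)%N by case: u qE q0 => // ->.
(* The branch consists of [q]-th roots with [q = u * p]; the powers of [u] turn them into [p]-th
   roots, and [a] makes [y 1] an element of order [p]. *)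
pose y i := if i is j.+1 then c j.+1 ^+ (a * u ^ j)%N else e.
apply: (@no_pruefer _ mulC ic p y pp).
- by rewrite /= expn0 muln1.
- case=> [|i]; first exact: ee.
  apply: eH; apply: (torsion_groupX HH) => //.
  by rewrite muln_gt0 a0 expn_gt0 u0.
- case=> [|i] /=; first by rewrite expn0 muln1 -expgnA.
  rewrite -expgnA (_ : (a * u ^ i.+1 * p)%N = (q * (a * u ^ i))%N); last first.
    by rewrite qE expnS; nia.
  by rewrite expgnA cq.
Qed.

End MaximalSubgroups.

(** * Bounded exponent *)

(** The idempotent among the positive powers of [x], which is unique; the default 1 is returned only
    if there is none. *)
Definition ipow (M : monoidType) (x : M) : M :=
  xget 1 [set e | idem e /\ exists2 n, (0 < n)%N & e = x ^+ n].

(** For periodic [x] this says that [x] lies in a subgroup, namely in the maximal subgroup of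
    [ipow x]. *)
Definition regular (M : monoidType) (x : M) := ipow x * x = x.

Section Periodic.
Variables (M : monoidType).
Hypothesis mulC : commutative (@mul M).
Hypothesis per : forall x : M, exists2 n, (0 < n)%N & idem (x ^+ n).

Lemma ipowP (x : M) : idem (ipow x) /\ exists2 n, (0 < n)%N & ipow x = x ^+ n.
Proof.
rewrite /ipow; case: xgetP => [e _ //|nx]; have [n n0 xn] := per x.
by case: (nx (x ^+ n)); split=> //; exists n.
Qed.

Lemma ipow_idem (x : M) : idem (ipow x). Proof. by have [] := ipowP x. Qed.

Lemma ipow_uniq (x : M) n : (0 < n)%N -> idem (x ^+ n) -> ipow x = x ^+ n.
Proof.
have [xx [m m0 xm]] := ipowP x => n0 xn.
by rewrite -(expg_unit xx n0) xm -expgnA mulnC expgnA expg_unit.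
Qed.

Lemma ipow_id (e : M) : idem e -> ipow e = e.
Proof. by move=> ee; rewrite (@ipow_uniq e 1). Qed.

Lemma ipowM (x y : M) : ipow (x * y) = ipow x * ipow y.
Proof.
have [xx [m m0 xm]] := ipowP x; have [yy [n n0 yn]] := ipowP y.
have xmn : x ^+ (m * n)%N = ipow x by rewrite expgnA -xm expg_unit.
have ymn : y ^+ (m * n)%N = ipow y by rewrite mulnC expgnA -yn expg_unit.
rewrite (@ipow_uniq _ (m * n)) ?muln_gt0 ?m0 ?expg_mulC ?xmn ?ymn//.
exact: idem_mul.
Qed.

Lemma ipowX (x : M) n : (0 < n)%N -> ipow (x ^+ n) = ipow x.
Proof.
move=> n0; have [xx [m m0 xm]] := ipowP x.
have e : x ^+ n ^+ m = ipow x by rewrite -expgnA mulnC expgnA -xm expg_unit.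
by rewrite -e; apply: ipow_uniq; rewrite ?e.
Qed.

Lemma ipow_fix (g u : M) : idem g -> g * u = u -> g * ipow u = ipow u.
Proof. by move=> gg gu; rewrite -[in RHS]gu ipowM (ipow_id gg). Qed.

Lemma maxgroupP (e x : M) : idem e -> maxgroup e x <-> ipow x = e /\ e * x = x.
Proof.
move=> ee; split=> [[ex [n n0 xn]]|[xe ex]].
  by split=> //; rewrite (@ipow_uniq _ n) ?xn.
by split=> //; have [_ [n n0 xn]] := ipowP x; exists n; rewrite // -xn.
Qed.

Lemma regular_idem (e : M) : idem e -> regular e.
Proof. by move=> ee; rewrite /regular ipow_id. Qed.

Lemma regularM (x y : M) : regular x -> regular y -> regular (x * y).
Proof. by rewrite /regular ipowM (commACA mulC) => -> ->. Qed.

Lemma regular_mulr (x t : M) : regular x -> ipow x * ipow t = ipow x -> regular (x * t).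
Proof.
by rewrite /regular ipowM => rx xt; rewrite xt mulgA rx.
Qed.

Lemma regular_fix (e x : M) : e * x = x -> ipow x * e = e -> regular x.
Proof. by move=> ex xe; rewrite /regular -{2}ex mulgA xe. Qed.

End Periodic.

(** * A topology in which an antichain of idempotents converges *)

Section AntichainTopology.
Variables (M : monoidType).
Hypothesis mulC : commutative (@mul M).
Hypothesis ic : injectively_closed TzS M.
Let per := closed_periodic mulC ic.
Let cf := closed_chain_finite mulC ic.

(** [S i n] tells which elements of the group of [f i] count as close to [e M]. It is everything
    when the [a i] lie outside all subgroups, and restricts exponents when the [a i] are regular of
    unbounded order. *)
Variables (e : M) (f a : nat -> M) (S : nat -> nat -> set M).
Hypotheses (ee : idem e) (ff : forall i, idem (f i)).
Hypotheses (ef : forall i, e * f i = e) (fe : forall i, f i <> e).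
Hypothesis f_anti : forall i j, f i * f j = f j -> i = j.
Hypothesis f_lim : forall q, idem q -> e * q = e -> q <> e ->
  exists n, forall i, (n <= i)%N -> q * f i <> q.
Hypothesis af : forall i, ipow (a i) = f i.
Hypothesis aa_reg : forall i j, regular (a i * a j).
Hypothesis S_le : forall i m n, (m <= n)%N -> S i n `<=` S i m.
Hypothesis SM : forall i n u v, S i n.+1 u -> S i n.+1 v -> S i n (u * v).
Hypothesis S_act : forall w, exists n0, forall i n u, (n0 <= n <= i)%N ->
  f i * ipow w = f i -> maxgroup (f i) u -> S i n u -> S i n (w * u).
Hypothesis aS : forall i n u, maxgroup (f i) u -> S i n.+1 u -> S i n (a i * u).
Hypothesis aaS : forall i n, (n < i)%N -> S i n (a i * a i).
Hypothesis aNS : forall i, maxgroup (f i) (a i) -> ~ S i 0 (a i).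

(* Neighbourhoods of [z], for [z] below [e], in a topology making the [f i]
   converge to [e]; they do not let the [a i] converge because of [aNS]. *)
Let U n z : set M := [set u | [/\ e * u = z,
  exists2 j, (n <= j)%N & f j * u = u & forall i, maxgroup (f i) u -> S i n u]].

Let U_le m n z : (m <= n)%N -> U n z `<=` U m z.
Proof.
move=> mn u [eu [j nj fju] uS]; split=> //; first by exists j => //; exact: leq_trans nj.
by move=> i /uS; exact: S_le.
Qed.

Let below i j u : f j * u = u -> f i * ipow u = f i -> j = i /\ maxgroup (f i) u.
Proof.
move=> fju fiu; have fj := ipow_fix mulC per (ff j) fju.
have ji : j = i by apply: f_anti; rewrite -fiu (mulC (f i)) mulgA fj.
subst j; split=> //; apply/(maxgroupP per _ (ff i)); split=> //.
by rewrite -fj.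
Qed.

Let belowM i j u v : f j * u = u -> ipow (v * u) = f i -> j = i /\ maxgroup (f i) u.
Proof.
move=> fju vu; apply: below fju _.
have uu : ipow u * ipow u = ipow u := ipow_idem per u.
by rewrite -vu ipowM// -mulgA uu.
Qed.

Let U_self n z : e * z = z -> U n z z.
Proof.
move=> ez; split=> //; first by exists n => //; rewrite -ez mulgA (mulC _ e) ef.
move=> i /(maxgroupP per _ (ff i))[zi _].
by case: (fe (i := i)); rewrite -(ef i) -zi ipow_fix.
Qed.

Let UM n z z' u u' : e * z = z -> U n.+1 z u -> U n.+1 z' u' -> U n (z * z') (u * u').
Proof.
move=> ez [eu [j nj fju] uS] [eu' [j' nj' fju'] uS']; split.
- by rewrite mulgA eu -eu' mulgA (mulC z e) ez.
- by exists j; [exact: ltnW|rewrite mulgA fju].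
move=> i /(maxgroupP per _ (ff i))[uui _].
have [_ ui] : j = i /\ maxgroup (f i) u by apply: (@belowM i j u u'); rewrite // mulC.
have [_ ui'] : j' = i /\ maxgroup (f i) u' by apply: (@belowM i j' u' u).
by apply: SM; [exact: uS|exact: uS'].
Qed.

Let U_act w n : exists m, forall z u, U m z u -> U n (w * z) (w * u).
Proof.
have [n0 wS] := S_act w; exists (maxn n n0) => z u [eu [j nj fju] uS]; split.
- by rewrite mulgA (mulC e) -mulgA eu.
- by exists j; [lia|rewrite mulgA (mulC (f j)) -mulgA fju].
move=> i /(maxgroupP per _ (ff i))[wui _].
have [ji ui] := belowM fju wui; subst j.
apply: (@S_le _ _ (maxn n n0)); first exact: leq_maxl.
apply: wS => //; [lia| |exact: uS].
have ww : ipow w * ipow w = ipow w := ipow_idem per w.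
by rewrite -wui ipowM// (mulC (ipow w)) -mulgA ww.
Qed.

(** If [x] is fixed by infinitely many [f j], then the least idempotent above [e] that fixes [x] is
    below all of these, so by [f_lim] it is [e]. *)
Let U_out x : e * x <> x -> exists n, forall z, ~ U n z x.
Proof.
move=> ex; pose D := [set q : M | [/\ idem q, e * q = e & q * x = x]].
case: (pselect (exists n, forall j, (n <= j)%N -> f j * x <> x)) => [[n nx]|nn].
  by exists n => z [_ [j nj fjx] _]; exact: nx nj fjx.
have fx n : exists2 j, (n <= j)%N & f j * x = x.
  apply: contrapT => nj; apply: nn; exists n => j nj' fjx.
  by apply: nj; exists j.
have [j0 _ j0x] := fx 0%N.
have [|||q [qq eq qx] qmin] := @idem_least _ mulC cf D (f j0).
- by move=> q [].
- by split.
- move=> d d' [dd ed dx] [dd' ed' dx']; split; first exact: idem_mul.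
    by rewrite mulgA ed.
  by rewrite -mulgA dx'.
have [qe|qe] := pselect (q = e); first by case: ex; rewrite -qe.
have [n nq] := f_lim qq eq qe; have [j nj fjx] := fx n.
by case: (nq j nj); apply: qmin; split.
Qed.

(** The products [e * a i] stay in the maximal subgroup of [e], whose finiteness makes them constant
    along [uoo]. *)
Let h_ex : exists2 h, e * h = h & uoo [set i | e * a i = h].
Proof.
have [|h [eh _] hU] := @ultra_finite _ _ uoo (fun i => e * a i) _ uoo_ultra
  (maxgroup_finite mulC ic ee); last by exists h.
apply: (filterS (F := uoo)) filterT => i _.
apply/(maxgroupP per _ ee); rewrite ipowM// ipow_id// af ef; split=> //.
by rewrite mulgA ee.
Qed.

Let h := sval (cid2 h_ex).
Let eh : e * h = h. Proof. exact: (s2valP (cid2 h_ex)). Qed.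
Let hU : uoo [set i | e * a i = h]. Proof. exact: (s2valP' (cid2 h_ex)). Qed.
Let UU := uoo_ultra.

Let Psi z : set_system M := fmap (fun i => z * a i) uoo.
Let nb x : set_system M := if pselect (e * x = x) is left _
  then filter_from setT (U^~ x) else principal_filter x.

Let nb_in x : e * x = x -> nb x = filter_from setT (U^~ x).
Proof. by move=> ex; rewrite /nb; case: pselect. Qed.

Let nb_out x : e * x <> x -> nb x = principal_filter x.
Proof. by move=> ex; rewrite /nb; case: pselect. Qed.

Let Phi : set (set_system M) := [set F | (exists x, F = nb x) \/ exists z, F = Psi z].

Let nb_Phi x : Phi (nb x). Proof. by left; exists x. Qed.

Let nb_proper x : ProperFilter (nb x).
Proof.
rewrite /nb; case: pselect => ex; last by have [] := principal_filter_ultra x.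
apply: filter_from_proper => [|n _]; last by exists x; exact: U_self.
apply: filter_fromT_filter; first by exists 0%N.
move=> i j; exists (maxn i j) => u Uu; split; apply: U_le Uu;
  [exact: leq_maxl|exact: leq_maxr].
Qed.

Let Phi_proper F : Phi F -> ProperFilter F.
Proof. by case=> -[x ->]; [exact: nb_proper|exact: fmap_proper_filter]. Qed.

Let nb_mem x W : nb x W -> W x.
Proof.
rewrite /nb; case: pselect => ex; last by move/principal_filterP.
by move=> [n _]; apply; exact: U_self.
Qed.

Let dec_nb W : decided Phi W <-> forall x, e * x = x ->
  (exists n, U n x `<=` W) \/ exists n, U n x `<=` ~` W.
Proof.
split=> [dW x ex|dW _ [[x ->]|[z ->]]].
- by have := dW _ (nb_Phi x); rewrite nb_in// => -[[n _ nW]|[n _ nW]]; [left|right]; exists n.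
- rewrite /nb; case: pselect => ex.
    by case: (dW x ex) => -[n nW]; [left|right]; exists n.
  by case: (pselect (W x)) => Wx; [left|right]; apply/principal_filterP.
- exact: (in_ultra_setVsetC ((fun i => z * a i) @^-1` W)).
Qed.

Let dec_out x : e * x <> x -> decided Phi [set x].
Proof.
move=> ex; apply/dec_nb => z _; have [n nx] := U_out ex.
by right; exists n => u zu /= ux; apply: (nx z); rewrite -ux.
Qed.

Let dec_U n x : decided Phi (U n x).
Proof.
apply/dec_nb => z ez; case: (pselect (z = x)) => [->|zx]; [left|right].
  by exists n.
by exists n => u [eu _ _] [eu' _ _]; apply: zx; rewrite -eu -eu'.
Qed.

Let dec_act x W : decided Phi W -> decided Phi [set u | W (x * u)].
Proof.
move=> /dec_nb dW; apply/dec_nb => z ez.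
have exz : e * (x * z) = x * z by rewrite mulgA (mulC e) -mulgA ez.
have [[n nW]|[n nW]] := dW _ exz; [left|right];
  by have [m mU] := U_act x n; exists m => u /mU/nW.
Qed.

Let nb_sep x y : x <> y -> exists W, [/\ decided Phi W, nb x W & ~ W y].
Proof.
move=> xy; case: (pselect (e * x = x)) => ex; last first.
  exists [set x]; rewrite nb_out//; split=> [|//|/= yx].
    exact: dec_out.
  exact: xy.
case: (pselect (e * y = y)) => ey; last first.
  have [n ny] := U_out ey; exists (U n x).
  by split; [exact: dec_U|rewrite nb_in//; exists n|exact: ny].
exists (U 0%N x); split; [exact: dec_U|by rewrite nb_in//; exists 0%N|].
by move=> [exy _ _]; apply: xy; rewrite -exy.
Qed.

Let rel F H K := forall W, decided Phi W -> K W -> exists P Q,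
  [/\ decided Phi P, F P, decided Phi Q, H Q & forall x y : M, P x -> Q y -> W (x * y)].

Let relC F H K : rel F H K -> rel H F K.
Proof.
move=> FHK W dW /(FHK _ dW)[P [Q [dP FP dQ HQ PQ]]]; exists Q, P; split=> // x y Qx Py.
by rewrite mulC; exact: PQ.
Qed.

Let rel_out x y : e * x <> x -> rel (nb x) (nb y) (nb (x * y)).
Proof.
move=> ex W dW xyW; rewrite (nb_out ex); exists [set x], [set u | W (x * u)].
split; [exact: dec_out|exact/principal_filterP|exact: dec_act| |by move=> _ u ->].
case: (pselect (e * y = y)) => ey; last first.
  by rewrite (nb_out ey); apply/principal_filterP; exact: nb_mem xyW.
have exy : e * (x * y) = x * y by rewrite mulgA (mulC e) -mulgA ey.
move: xyW; rewrite nb_in// nb_in// => -[n _ nW].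
by have [m mU] := U_act x n; exists m => // u /mU/nW.
Qed.

Let rel_nb x y : rel (nb x) (nb y) (nb (x * y)).
Proof.
case: (pselect (e * x = x)) => ex; last exact: rel_out.
case: (pselect (e * y = y)) => ey; last by rewrite mulC; exact/relC/rel_out.
have exy : e * (x * y) = x * y by rewrite mulgA ex.
move=> W dW; rewrite !nb_in// => -[n _ nW].
exists (U n.+1 x), (U n.+1 y); split; [exact: dec_U|by exists n.+1|exact: dec_U|
  by exists n.+1|move=> u v xu yv; apply: nW; exact: UM].
Qed.

Let rel_out_Psi x z : e * x <> x -> rel (nb x) (Psi z) (Psi (x * z)).
Proof.
move=> ex W dW xzW; rewrite nb_out//; exists [set x], [set u | W (x * u)].
split; [exact: dec_out|exact/principal_filterP|exact: dec_act| |by move=> _ u ->].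
by apply: (filterS (F := uoo)) xzW => i /=; rewrite mulgA.
Qed.

(** Either [Psi z] is the point [h * z] of [M] or it is a new point; the products are computed
    differently in the two cases. *)
Let conv z := forall n, Psi z (U n (h * z)).

Let ehz z : e * (h * z) = h * z. Proof. by rewrite mulgA eh. Qed.

Let eaz i z : e * a i = h -> e * (z * a i) = h * z.
Proof. by move=> ai; rewrite mulgA (mulC e) -mulgA ai mulC. Qed.

Let conv_nb z W : conv z -> decided Phi W -> Psi z W <-> nb (h * z) W.
Proof.
move=> cz dW; rewrite nb_in ?ehz//; split=> [zW|[n _ nW]]; last first.
  by apply: (filterS (F := uoo)) (cz n) => i /nW.
have [[n nW]|[n nW]] := (dec_nb W).1 dW _ (ehz z); first by exists n.
have [i [Wi /nW]] := filter_ex (filterI zW (cz n)); by [].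
Qed.

Let rel_conv z F K : conv z -> rel (nb (h * z)) F K -> rel (Psi z) F K.
Proof.
move=> cz zF W dW /(zF _ dW)[P [Q [dP zP dQ FQ PQ]]]; exists P, Q; split=> //.
exact/(conv_nb cz dP).
Qed.

(** If [Psi z] misses the neighbourhood [U n0 (h * z)], this set belongs to [Psi z] and is disjoint
    from [U n0 x] for every [x] in [e M]. It therefore is a decided set close to the new point. *)
Let discr z n0 (I : set nat) := [set z * a i | i in I] `\` U n0 (h * z).

Let dec_discr z n0 I : (forall i, I i -> e * a i = h) -> decided Phi (discr z n0 I).
Proof.
move=> Ih; apply/dec_nb => x ex; right; exists n0 => u xu [[i Ii zu] nu]; apply: nu.
by have [xE _ _] := xu; rewrite -(eaz z (Ih _ Ii)) zu xE.
Qed.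

Let Psi_discr z n0 I : uoo I -> ~ Psi z (U n0 (h * z)) -> Psi z (discr z n0 I).
Proof.
move=> uI nz; have [//|zU] := in_ultra_setVsetC
  ((fun i => z * a i) @^-1` (U n0 (h * z))) UU.
by apply: (filterS (F := uoo)) (filterI uI zU) => i [Ii nU]; split=> //; exists i.
Qed.

Let rel_in_Psi x z : e * x = x -> ~ conv z -> rel (nb x) (Psi z) (nb (h * z * x)).
Proof.
move=> ex /existsNP[n0 nz] W dW; rewrite nb_in ?mulgA ?eh// => -[n _ nW].
have [n1 zU] := U_act z n.
exists (U n1.+1 x), (discr z n0 [set i | e * a i = h]).
split; [exact: dec_U|by rewrite nb_in//; exists n1.+1|exact: dec_discr| |].
  exact: Psi_discr.
move=> u _ xu [[i /= ai <-] _]; apply: nW.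
have -> : h * z * x = z * (h * x) by rewrite (mulC h) mulgA.
have -> : u * (z * a i) = z * (a i * u) by rewrite mulC mulgA.
apply: zU.
have [eu [j nj fju] uS] := xu; split.
- by rewrite mulgA ai -eu mulgA (mulC h e) eh.
- by exists j; [exact: ltnW|rewrite mulgA (mulC (f j)) -mulgA fju].
move=> k /(maxgroupP per _ (ff k))[auk _].
have [jk uk] := belowM fju auk; subst j.
have ik : i = k.
  by apply: f_anti; rewrite -{1}auk ipowM// af mulgA (ff i) -af -ipowM.
by subst i; apply: aS => //; exact: uS.
Qed.

(** By regularity [a i * a j] is fixed by [f i]. By the antichain property it lies in a group of
    some [f k] only for [i = j = k], where [aaS] applies. *)
Let rel_Psi z z' : ~ conv z -> ~ conv z' -> rel (Psi z) (Psi z') (nb (h * h * (z * z'))).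
Proof.
move=> /existsNP[n0 nz] /existsNP[n0' nz'] W dW.
rewrite nb_in ?mulgA ?eh// => -[n _ nW].
have [n1 zU] := U_act (z * z') n.
pose I := [set i | e * a i = h] `&` [set i | (n1 < i)%N].
have uI : uoo I by apply: filterI => //; exact: uoo_ge.
exists (discr z n0 I), (discr z' n0' I).
split; [by apply: dec_discr => i []|exact: Psi_discr|
        by apply: dec_discr => i []|exact: Psi_discr|].
move=> _ _ [[i [ai ni] <-] _] [[j [aj nj] <-] _]; apply: nW.
have -> : h * h * z * z' = z * z' * (h * h) by rewrite -mulgA mulC.
rewrite (commACA mulC z z' (a i)); apply: zU; split.
- by rewrite mulgA ai -[X in _ = _ * X]aj mulgA (mulC h e) eh.
- exists i; first exact: ltnW.
  have fw : f i * ipow (a i * a j) = ipow (a i * a j) by rewrite ipowM// !af mulgA ff.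
  by rewrite -[in LHS](aa_reg i j) mulgA fw aa_reg.
move=> k /(maxgroupP per _ (ff k))[]; rewrite ipowM// !af => fij _.
have ik : i = k by apply: f_anti; rewrite -fij mulgA ff.
have jk : j = k by apply: f_anti; rewrite -fij mulgA (mulC (f j)) -mulgA ff.
by subst i j; exact: aaS.
Qed.

Let Phi_rel F H : Phi F -> Phi H -> exists2 K, Phi K & rel F H K.
Proof.
have nbz x z : exists2 K, Phi K & rel (nb x) (Psi z) K.
  case: (pselect (e * x = x)) => ex; last first.
    by exists (Psi (x * z)); [right; exists (x * z)|exact: rel_out_Psi].
  case: (pselect (conv z)) => cz; last by exists (nb (h * z * x)); [|exact: rel_in_Psi].
  exists (nb (h * z * x)) => //; apply: relC; apply: rel_conv => //; exact: rel_nb.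
case=> -[x ->] [] [y ->].
- by exists (nb (x * y)); [|exact: rel_nb].
- exact: nbz.
- by have [K PK /relC] := nbz y x; exists K.
case: (pselect (conv x)) => cx.
  by have [K PK xK] := nbz (h * x) y; exists K => //; exact: rel_conv.
case: (pselect (conv y)) => cy; last first.
  by exists (nb (h * h * (x * y))); [|exact: rel_Psi].
have [K PK yK] := nbz (h * y) x; exists K => //.
by apply: relC; exact: rel_conv.
Qed.

(** Closedness makes the limit of the [a i] an element [x] of [M]. It is not isolated because [a] is
    injective, and otherwise [U 0 x] contains some [a i], against [aNS]. *)
Lemma no_antichain_limit : False.
Proof.
pose D := Completion nb_Phi Phi_proper nb_mem nb_sep Phi_rel (fun x y => rel_nb (x := x) (y := y)).
have [|x /= xF] := @closed_completion _ D ic (Psi 1); first by right; exists 1.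
have a_inj : injective a.
  by move=> i j ij; apply: f_anti; rewrite -!af ij ipow_idem.
case: (pselect (e * x = x)) => ex; last first.
  have /(xF _ (dec_out ex)).2 : nb x [set x] by rewrite nb_out//; exact/principal_filterP.
  move=> F1; apply: (uoo_inj (x := x) a_inj).
  by apply: (filterS (F := uoo)) F1 => i /=; rewrite mul1g.
have /(xF _ (dec_U 0 x)).2 FU : nb x (U 0 x) by rewrite nb_in//; exists 0%N.
have [i /=] := @filter_ex _ uoo _ _ FU.
rewrite mul1g => -[_ [j _ fja] aS0].
have fi : f j * f i = f i by rewrite -(af i); exact: ipow_fix.
have ji := f_anti fi; subst j.
have ma : maxgroup (f i) (a i) by apply/(maxgroupP per _ (ff i)).
exact: aNS ma (aS0 _ ma).
Qed.

End AntichainTopology.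

Definition unbounded (J : set nat) := forall n, exists2 m, (n <= m)%N & J m.

Lemma unbounded_enum J : unbounded J -> exists2 s : nat -> nat,
  forall i, J (s i) & forall i j, (i < j)%N -> (s i < s j)%N.
Proof.
move=> uJ; have [j0 _ Jj0] := uJ 0%N.
have [|s _ sP] := @dependent_choice _ J (fun i j => (i < j)%N) j0 Jj0.
  by move=> i _; have [j ij Jj] := uJ i.+1; exists j.
exists s => [i|]; first by have [] := sP i.
move=> i; elim=> // j IH; rewrite ltnS leq_eqVlt => /orP[/eqP->|/IH lt].
  by have [] := sP j.
by apply: ltn_trans lt _; have [] := sP j.
Qed.

Lemma enum_ge (s : nat -> nat) : (forall i j, (i < j)%N -> (s i < s j)%N) ->
  forall i, (i <= s i)%N.
Proof.
by move=> sm; elim=> // i IH; apply: leq_ltn_trans IH _; exact: sm.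
Qed.

Lemma not_unbounded J : ~ unbounded J -> exists n, forall m, (n <= m)%N -> ~ J m.
Proof.
move=> nJ; apply: contrapT => nn; apply: nJ => n; apply: contrapT => nm.
by apply: nn; exists n => m nm' Jm; apply: nm; exists m.
Qed.

Lemma uoo_unbounded J : uoo J -> unbounded J.
Proof.
by move=> uJ n; have [m [Jm nm]] := filter_ex (filterI uJ (uoo_ge n)); exists m.
Qed.

(** Take [e] maximal among the idempotents below infinitely many [f i]. The antichain consists of
    the [f i] that are minimal strictly above [e], each at its first index. There are infinitely
    many: each of them is below only finitely many [f i], yet together they lie below every [f i]
    strictly above [e]. *)
Lemma idem_antichain (S : semigroupType) (mulC : commutative (@mul S))
    (cf : chain_finite S) (f : nat -> S) :
  (forall i, idem (f i)) -> (forall e, ~ unbounded [set i | f i = e]) ->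
  exists e (s : nat -> nat), [/\ idem e,
    forall i, e * f (s i) = e /\ f (s i) <> e, forall i, (i <= s i)%N,
    forall i j, f (s i) * f (s j) = f (s j) -> i = j &
    forall q, idem q -> e * q = e -> q <> e ->
      exists n, forall i, (n <= i)%N -> q * f (s i) <> q].
Proof.
move=> ff fin; pose J q := [set i | q * f i = q].
have [q0 q0q0 q0P] := idem_least mulC cf (fun x => id) (ff 0%N) (idem_mul mulC).
have [||e [ee Je] emax] :=
    idem_maximal mulC cf (D := [set q | idem q /\ unbounded (J q)]) (d0 := q0).
- by move=> q [].
- by split=> // n; exists n => //; exact: q0P.
have lim q : idem q -> e * q = e -> q <> e -> exists n, forall i, (n <= i)%N -> q * f i <> q.
  by move=> qq eq qe; apply: not_unbounded => Jq; apply: qe; exact: emax.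
pose J1 := [set i | e * f i = e /\ f i <> e].
have uJ1 : unbounded J1.
  move=> n; have [m mP] := not_unbounded (fin e).
  have [k nmk Jk] := Je (n + m)%N; exists k; first by lia.
  by split=> //; apply: mP; lia.
pose J2 := [set i | J1 i /\ forall j, J1 j -> f j * f i = f j -> f j = f i].
pose J3 := [set i | J2 i /\ forall j, (j < i)%N -> f j <> f i].
have below i : J1 i -> exists2 k, J3 k & f k * f i = f k.
  move=> J1i; pose D := [set q | exists j, [/\ J1 j, f j * f i = f j & q = f j]].
  have [||q [j [J1j ji ->]] qmin] := idem_minimal mulC cf (D := D) (d0 := f i).
  - by move=> _ [j [_ _ ->]].
  - by exists i; split=> //; exact: ff.
  have exk : exists k, `[< f k = f j >] by exists j; apply/asboolP.
  case: (ex_minnP exk) => k /asboolP kj kmin; exists k; last by rewrite kj.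
  split; last first.
    move=> l lk lkE; have := kmin l; rewrite leqNgt lk => /(_ _)/notF; apply.
    by apply/asboolP; rewrite lkE.
  split; first by rewrite /J1 /= kj.
  move=> l J1l; rewrite kj => lj; apply: qmin => //.
  by exists l; split=> //; rewrite -lj -mulgA ji.
have uJ3 : unbounded J3.
  apply: contrapT => /not_unbounded[n nJ3].
  have /choice[g gP] : forall k, exists N, J3 k -> forall i, (N <= i)%N -> f k * f i <> f k.
    move=> k; case: (pselect (J3 k)) => [[[[ek ke] _] _]|nk]; last by exists 0%N.
    by have [N NP] := lim _ (ff k) ek ke; exists N.
  have [i Ni J1i] := uJ1 (\max_(k < n) g k)%N.
  have [k J3k ki] := below _ J1i.
  have kn : (k < n)%N by rewrite ltnNge; apply/negP => nk; exact: nJ3 nk J3k.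
  apply: (gP k J3k i _ ki); apply: leq_trans Ni.
  exact: (leq_bigmax (Ordinal kn)).
have [s sJ3 sm] := unbounded_enum uJ3; exists e, s; split=> //.
- by move=> i; have [[]] := sJ3 i.
- exact: enum_ge.
- move=> i j sij; have [[J1i J2i] J3i] := sJ3 i; have [[J1j J2j] J3j] := sJ3 j.
  have fij : f (s j) = f (s i) by apply: J2i => //; rewrite mulC.
  by case: (ltngtP i j) => // /sm lt; [case: (J3j _ lt)|case: (J3i _ lt)].
- move=> q qq eq qe; have [n nP] := lim q qq eq qe; exists n => i ni.
  by apply: nP; apply: leq_trans ni (enum_ge sm i).
Qed.

(** * Bounds on index and exponent *)

Section Bounded.
Variables (M : monoidType).
Hypothesis mulC : commutative (@mul M).
Hypothesis ic : injectively_closed TzS M.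
Let per := closed_periodic mulC ic.
Let cf := closed_chain_finite mulC ic.

(** If infinitely many [a i] share their idempotent [e], then for infinitely many of them [e * a i]
    is one element [k] and all products are [k * k], against [closed_nonsingular]. Otherwise the
    idempotents contain an antichain, and [aNS] holds vacuously since the [a i] lie in no
    subgroup. *)
Lemma closed_clifford_nonsingular (a : nat -> M) : injective a ->
  (forall i, ~ regular (a i)) -> ~ forall i j, regular (a i * a j).
Proof.
move=> a_inj a_reg aa.
have fin e : ~ unbounded [set i | ipow (a i) = e].
  move=> /unbounded_enum[s se sm].
  have ee : idem e by rewrite -(se 0%N); exact: ipow_idem.
  have [|k _ /uoo_unbounded/unbounded_enum[t tk tm]] :=
      @ultra_finite _ _ uoo (fun i => e * a (s i)) _ uoo_ultra (maxgroup_finite mulC ic ee).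
    apply: (filterS (F := uoo)) filterT => i _; apply/(maxgroupP per _ ee).
    by rewrite ipowM// ipow_id// se ee mulgA ee.
  apply: (@closed_nonsingular _ mulC ic (k * k) (fun i => a (s (t i)))).
    move=> i j /a_inj sij; case: (ltngtP i j) => // /tm/sm; rewrite sij ltnn//.
  move=> i j; rewrite -[LHS](aa (s (t i)) (s (t j))) ipowM// !se.
  by rewrite (commACA mulC) !tk.
have [e [s [ee es is_ s_anti s_lim]]] :=
  idem_antichain mulC cf (fun i => ipow_idem per (a i)) fin.
apply: (@no_antichain_limit _ mulC ic e (fun i => ipow (a (s i))) (fun i => a (s i))
  (fun _ _ => setT)) => //.
- by move=> i; exact: ipow_idem.
- by move=> i; have [] := es i.
- by move=> i; have [] := es i.
- by move=> w; exists 0%N.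
- by move=> i /(maxgroupP per _ (ipow_idem per _))[_ /(a_reg _)].
Qed.

Lemma closed_exponent : exists2 N, (0 < N)%N & forall x : M, regular x -> x ^+ N = ipow x.
Proof.
(* If [a i = a i ^+ m * s] with [1 < m <= 2 ^ i] and the order of [s] divides i!, then the order of
   [a i] divides (m - 1) i! and hence [N i]. This will give [aNS]. *)
apply: contrapT => nN; pose N i := ((2 ^ i)`! * i`!)%N.
have N0 i : (0 < N i)%N by rewrite muln_gt0 !fact_gt0.
have NX (x : M) m n : (0 < n)%N -> (m %| n)%N -> x ^+ m = ipow x -> x ^+ n = ipow x.
  move=> n0 /dvdnP[k nE] xm; rewrite nE mulnC expgnA xm expg_unit//; first exact: ipow_idem.
  by case: k nE n0 => // ->.
have /choice[x xP] : forall i, exists x : M, regular x /\ x ^+ N i <> ipow x.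
  move=> i; apply: contrapT => nx; apply: nN; exists (N i) => // x rx.
  by apply: contrapT => xN; apply: nx; exists x.
have fin e : ~ unbounded [set i | ipow (x i) = e].
  move=> /unbounded_enum[s se sm].
  have ee : idem e by rewrite -(se 0%N); exact: ipow_idem.
  have [|y _ yU] := @ultra_finite _ _ uoo (fun i => x (s i)) _ uoo_ultra
      (maxgroup_finite mulC ic ee).
    apply: (filterS (F := uoo)) filterT => i _; apply/(maxgroupP per _ ee).
    by split; [exact: se|rewrite -[X in X * _](se i); exact: (xP _).1].
  have [_ [n n0 yn]] := ipowP per y.
  have [i [yi ni]] := filter_ex (filterI yU (uoo_ge n)).
  have [_] := xP (s i); apply; rewrite yi; apply: (NX _ n) => //.
  by apply: dvdn_mull; rewrite dvdn_fact// n0 (leq_trans ni)// enum_ge.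
have [e [s [ee es is_ s_anti s_lim]]] :=
  idem_antichain mulC cf (fun i => ipow_idem per (x i)) fin.
pose a i := x (s i); pose f i := ipow (a i).
have ff i : idem (f i) by exact: ipow_idem.
have ra i : f i * a i = a i by exact: (xP _).1.
have aN i : a i ^+ N i <> f i.
  move=> ai; have [_] := xP (s i); apply; apply: NX ai => //.
  by apply: dvdn_mul; apply: fact_dvdn; rewrite ?leq_exp2l.
have fG i := maxgroup_torsion mulC (ff i).
(* Essentially the powers of [a i] with exponents between 2 and [2 ^ (i - n)]. *)
pose S i n : set M := [set u | exists m s, [/\ (1 < m)%N, (m * 2 ^ n <= 2 ^ i)%N,
  maxgroup (f i) s, s ^+ i`! = f i & u = a i ^+ m * s]].
apply: (@no_antichain_limit _ mulC ic e f a S) => //.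
- by move=> i; have [] := es i.
- by move=> i; have [] := es i.
- by move=> i j; apply: regularM => //; exact: (xP _).1.
- move=> i m n mn _ [k [t [k1 ki Gt ti ->]]]; exists k, t; split=> //.
  by apply: leq_trans ki; rewrite leq_mul2l leq_exp2l// mn orbT.
- move=> i n u v [k [t [k1 ki Gt ti ->]]] [k' [t' [k1' ki' Gt' ti' ->]]].
  exists (k + k')%N, (t * t'); split.
  + by lia.
  + by move: ki ki'; rewrite expnS; nia.
  + by have [_ GM _ _] := fG i; exact: GM.
  + by rewrite expg_mulC// ti ti'; exact: ff.
  + by rewrite (commACA mulC) expgnDr.
- move=> w; have [_ [k k0 wk]] := ipowP per w; exists k => i n u /andP[kn ni] fw _.
  move=> [m [t [m1 mi Gt ti ->]]]; exists m, (t * w); split=> //.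
  + have /(maxgroupP per _ (ff i))[tf ft] := Gt.
    by apply/(maxgroupP per _ (ff i)); rewrite ipowM// tf fw mulgA ft.
  + rewrite expg_mulC// ti (NX w k) ?fact_gt0//.
    by rewrite dvdn_fact// k0 (leq_trans kn).
  + by rewrite mulC mulgA.
- move=> i n u _ [m [t [m1 mi Gt ti ->]]]; exists m.+1, t; split=> //.
  + exact: leqW.
  + by move: mi; rewrite expnS; nia.
  + by rewrite expgS mulgA.
- move=> i n ni; exists 2%N, (f i); split=> //.
  + by rewrite -expnS leq_exp2l.
  + by have [] := fG i.
  + by rewrite expg_unit// fact_gt0.
  + by rewrite expg2 mulC mulgA ra.
- move=> i Ga [m [t [m1 mi Gt ti aE]]]; apply: (aN i).
  have [m' mE] : exists m', m = m'.+2 by exists m.-2; lia.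
  have e1 : f i = a i ^+ m'.+1 * t.
    apply: (torsion_group_cancel mulC (fG i) Ga); first exact: ff.
      by rewrite mulgA [f i * _](_ : _ = a i ^+ m'.+1)// expgS mulgA ra.
    by rewrite ra [LHS]aE mE expgS -mulgA mulC.
  apply: (NX _ (m'.+1 * i`!)%N) => //.
    apply: dvdn_mul => //; rewrite dvdn_fact//.
    by move: mi; rewrite mE expn0 muln1; lia.
  have [_ _ eG _] := fG i; rewrite -[RHS](expg_unit (ff i) (fact_gt0 i)) [in RHS]e1.
  rewrite expg_mulC// ti -expgnA mulC eG//.
  by apply: torsion_groupX (fG i) Ga _; rewrite muln_gt0 fact_gt0.
Qed.

Let reg_exp (x : M) k m : (0 < k <= m)%N -> regular (x ^+ k) -> regular (x ^+ m).
Proof.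
move=> /andP[k0 km] rk; case: (posnP (m - k)) => [mk|mk].
  by rewrite (_ : m = k)//; lia.
rewrite -(subnKC km) expgnDr; apply: regular_mulr => //.
by rewrite !ipowX//; exact: ipow_idem.
Qed.

(* [P] contains elements of arbitrarily large index. *)
Let unb (P : set M) := forall k, (0 < k)%N -> exists2 x, P x & ~ regular (x ^+ k).

(** Let [f] be the idempotent of [b]. It is strictly below [g], so indices are bounded under [f],
    and the nonregular [b * x ^+ m] with [m] large have regular products; hence they form a finite
    set. If the claim fails, one of them, [c0], arises from [x] of arbitrarily large index, and it
    is fixed by their idempotents. By maximality of [e], the least idempotent above [e] fixing [c0]
    is [e], and this makes [c0] regular. *)
Let index_step (g e b : M) (P := [set x | g * x = x /\ e * ipow x = e]) :
  idem g -> (forall g', idem g' -> g' * g = g' -> g' <> g -> ~ unb [set x | g' * x = x]) ->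
  idem e -> (forall q, idem q -> e * q = e -> q <> e ->
    ~ unb [set x | g * x = x /\ q * ipow x = q]) ->
  P b -> ~ regular b -> regular (b * b) ->
  exists k, forall x m, P x -> (k <= m)%N -> ~ regular (x ^+ m) -> regular (b * x ^+ m).
Proof.
move=> gg gmin ee emax [gb eb] nb rbb; pose f := ipow b.
have ff : idem f := ipow_idem per b.
have gf : g * f = f by exact: ipow_fix.
have fg : f <> g by move=> fg; apply: nb; rewrite /regular -/f fg.
have [k k0 kP] : exists2 k, (0 < k)%N & forall x, f * x = x -> regular (x ^+ k).
  apply: contrapT => nk; apply: (gmin f) => //; first by rewrite mulC.
  move=> k k0; apply: contrapT => nx; apply: nk; exists k => // x fx.
  by apply: contrapT => nr; apply: nx; exists x.
have fX (x : M) m : (k <= m)%N -> regular (f * x ^+ m).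
  move=> km; have m0 : (0 < m)%N := leq_trans k0 km.
  rewrite -(expg_unit ff m0) -expg_mulC//; apply: (@reg_exp _ k); first by rewrite k0.
  by apply: kP; rewrite mulgA ff.
pose D := [set c | exists x m, [/\ (k <= m)%N, c = b * x ^+ m & ~ regular c]].
have fD : finite_set D.
  apply: contrapT => /infinite_seq[c c_inj cD].
  apply: (closed_clifford_nonsingular c_inj) => [i|i j].
    by have [x [m []]] := cD i.
  have [x [m [km -> _]]] := cD i; have [y [n [kn -> _]]] := cD j.
  have fbb : f * (b * b) = b * b by rewrite -[RHS]rbb ipowM// -/f [f * f]ff.
  rewrite (commACA mulC).
  have -> : b * b * (x ^+ m * y ^+ n) = b * b * ((f * x ^+ m) * (f * y ^+ n)).
    by rewrite (commACA mulC f) [f * f]ff (mulgA _ f) (mulC _ f) fbb.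
  by apply: regularM => //; apply: regularM => //; exact: fX.
have /(@finite_seqP M)[s sE] := fD; pose d := size s.
apply: contrapT => nk.
have /choice[xm xmP] : forall j, exists xm : M * nat, [/\ P xm.1, (k + d + j < xm.2)%N,
    ~ regular (xm.1 ^+ xm.2) & ~ regular (b * xm.1 ^+ xm.2)].
  move=> j; apply: contrapT => nx; apply: nk; exists (k + d + j).+1 => x m Px jm nr.
  by apply: contrapT => nr'; apply: nx; exists (x, m).
pose c j := b * (xm j).1 ^+ (xm j).2.
have cD j : D (c j) by have [_ jm _ nr] := xmP j; exists (xm j).1, (xm j).2; split=> //; lia.
(* The [d + 1] products [b * x ^+ i] with [k <= i <= k + d] lie in the [d]-element set [D]. Two
   coincide, so the sequence is periodic from there on and its later terms are fixed by [ipow x]. *)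
have fix_c j : ipow (xm j).1 * c j = c j.
  have [_ jm _ nr] := xmP j; rewrite /c; move: (xm j) jm nr => [x m] /= jm nr.
  have bD i : (k <= i <= m)%N -> D (b * x ^+ i).
    move=> /andP[ki im]; exists x, i; split=> // ri; apply: nr.
    rewrite -(subnKC im) expgnDr mulgA; case: (posnP (m - i)) => [->|mi].
      by rewrite expg0 mulg1.
    apply: regular_mulr => //; rewrite ipowM// !ipowX//; last exact: leq_trans ki.
    by rewrite -mulgA [ipow x * ipow x](ipow_idem per).
  have /(uniqPn b)[i [l [il]]] : ~~ uniq [seq b * x ^+ i | i <- iota k d.+1].
    apply/negP => u; have := @uniq_leq_size _ _ s u; rewrite size_map size_iota ltnn.
    move=> H; suff : false by []; apply: H => y /mapP[i]; rewrite mem_iota => ik ->.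
    by have : D (b * x ^+ i) by [apply: bD; lia]; rewrite sE.
  rewrite size_map size_iota => ld.
  rewrite !(nth_map 0%N) ?size_iota ?nth_iota; try lia.
  move=> bil; have [_ [n n0 xn]] := ipowP per x.
  have bm : b * x ^+ m = b * x ^+ (m + n * (l - i))%N.
    apply: (@expg_period _ b x (k + i)); first by lia.
    by rewrite bil; congr (_ * _ ^+ _); lia.
  rewrite mulC [in RHS]bm.
  by rewrite expgnDr mulgA expgnA -xn (expg_unit (ipow_idem per x))// subn_gt0.
have [|c0 c0D uc0] := @ultra_finite _ _ uoo c D uoo_ultra fD.
  by apply: (filterS (F := uoo)) filterT => j _; exact: cD.
pose Q := [set q : M | [/\ idem q, e * q = e & q * c0 = c0]].
have Qx j : c j = c0 -> Q (ipow (xm j).1).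
  move=> cj; have [[_ ex] _ _ _] := xmP j.
  by split=> //; [exact: ipow_idem|rewrite -cj].
have [j0 /Qx Qj0] := filter_ex uc0.
have [||q [qq eq qc] qmin] := idem_least mulC cf (D := Q) _ Qj0.
- by move=> q [].
- move=> q q' [qq eq qc] [qq' eq' qc']; split; first exact: idem_mul.
    by rewrite mulgA eq.
  by rewrite -mulgA qc'.
have qe : q = e.
  apply: contrapT => qe; apply: (emax q) => // K K0.
  have [j [cj /= Kj]] := filter_ex (filterI uc0 (uoo_ge K)).
  have [[gx _] jm nr _] := xmP j; exists (xm j).1.
    by split=> //; apply: qmin; exact: Qx.
  by move=> rK; apply: nr; apply: reg_exp rK; rewrite K0; lia.
have [x [m [km c0E nr]]] := c0D; apply: nr.
apply: (regular_fix (e := e)); first by rewrite -qe.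
have [j cj] := filter_ex uc0; have [[_ ex] jm _ _] := xmP j.
rewrite mulC -cj ipowM// ipowX//; last by lia.
by rewrite -/f mulgA eb.
Qed.

(** With [g] minimal and then [e] maximal for unbounded index, some [x] in [P] have nonregular
    powers of high exponent with regular square. By [index_step] such a power has regular products
    with finitely many elements chosen before, so a greedy choice contradicts
    [closed_clifford_nonsingular]. *)
Lemma closed_index : exists2 k, (0 < k)%N & forall x : M, regular (x ^+ k).
Proof.
apply: contrapT => nk.
have [||g [gg ug] gmin] := @idem_minimal _ mulC cf
    [set g | idem g /\ unb [set x | g * x = x]] 1.
- by move=> g [].
- split; first by rewrite /idem /= mulg1.
  move=> k k0; apply: contrapT => nx; apply: nk; exists k => // x.
  by apply: contrapT => nr; apply: nx; exists x => //=; rewrite mul1g.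
have [|||q0 q0q0 q0P] := @idem_least _ mulC cf (@idem M) 1.
- by [].
- by rewrite /idem /= mulg1.
- exact: idem_mul.
have [||e [ee ue] emax] := @idem_maximal _ mulC cf
    [set e | idem e /\ unb [set x | g * x = x /\ e * ipow x = e]] q0.
- by move=> e [].
- split=> // k k0; have [x gx nr] := ug k k0; exists x => //; split=> //.
  by apply: q0P; exact: ipow_idem.
pose P := [set x | g * x = x /\ e * ipow x = e].
have step b : P b -> ~ regular b -> regular (b * b) ->
    exists k, forall x m, P x -> (k <= m)%N -> ~ regular (x ^+ m) -> regular (b * x ^+ m).
  apply: index_step => //.
    by move=> g' gg' g'g ng ug'; apply: ng; apply: gmin.
  by move=> q qq eq qe uq; apply: qe; apply: emax.
have [|a aQ aR] := @greedy M [set b | [/\ P b, ~ regular b & regular (b * b)]]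
    (fun x y => regular (x * y) /\ x <> y).
  move=> s sQ.
  have [K KP] : exists K, forall b, b \in s -> forall x m, P x -> (K <= m)%N ->
      ~ regular (x ^+ m) -> regular (b * x ^+ m).
    elim: s sQ => [|b s IH] sQ; first by exists 0%N.
    have [Pb nb rb] := sQ b (mem_head _ _); have [k kP] := step b Pb nb rb.
    have [c cs|K KP] := IH; first by apply: sQ; rewrite inE cs orbT.
    exists (k + K)%N => c; rewrite inE => /orP[/eqP->|cs] x m Px Km.
      by apply: kP => //; lia.
    by apply: KP => //; lia.
  pose t := (K + size s).+1.
  have [//|x Px nrx] := ue (2 * t)%N.
  have exn : exists n, (0 < n)%N && `[< regular (x ^+ n) >].
    have [_ [n n0 xn]] := ipowP per x; exists n; rewrite n0; apply/asboolP.
    by rewrite -xn; apply: regular_idem => //; exact: ipow_idem.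
  case: (ex_minnP exn) => n /andP[n0 /asboolP rn] nmin.
  have nt : (2 * t < n)%N.
    rewrite ltnNge; apply/negP => nt; apply: nrx; apply: reg_exp rn.
    by rewrite n0.
  have nreg i : (0 < i < n)%N -> ~ regular (x ^+ i).
    move=> /andP[i0 iltn] ri; have := nmin i; rewrite i0 leqNgt iltn => /(_ _)/notF.
    by apply; apply/asboolP.
  have x_inj i j : (0 < i < j)%N -> (j < n)%N -> x ^+ i <> x ^+ j.
    move=> ij jn xij; apply: (nreg i); first by lia.
    have [_ [r r0 xr]] := ipowP per x.
    have e' : x ^+ i = x ^+ i * ipow x.
      have := @expg_period _ 1 x i (j - i) i r (leqnn i).
      rewrite !mul1g subnKC; last by lia.
      move=> /(_ xij) e1; rewrite [LHS]e1 expgnDr expgnA -xr.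
      by rewrite (expg_unit (ipow_idem per x)) ?subn_gt0//; lia.
    have i0 : (0 < i)%N by lia.
    by rewrite /regular (ipowX per _ i0) mulC -e'.
  (* For exponents from [n / 2] to [n - 1] the power is nonregular and its square regular. These are
     more than [size s] distinct powers, so one of them is not in [s]. *)
  pose h := uphalf n.
  have /hasP[m /[!mem_iota] mh xms] : has (fun m => x ^+ m \notin s) (iota h (size s).+1).
    rewrite has_predC; apply/negP => /allP als.
    have u : uniq [seq x ^+ m | m <- iota h (size s).+1].
      rewrite map_inj_in_uniq ?iota_uniq// => i j; rewrite !mem_iota => hi hj xij.
      by case: (ltngtP i j) => // ij; [case: (x_inj i j)|case: (x_inj j i)] => //; lia.
    have := @uniq_leq_size _ _ s u; rewrite size_map size_iota ltnn.
    move=> H; suff : false by []; apply: H => y /mapP[m mh ->].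
    exact: als.
  have hn : (n <= 2 * h)%N by rewrite /h; lia.
  have hm : (K <= m < n)%N by rewrite /h in mh; lia.
  have m0 : (0 < m)%N by rewrite /h in mh; lia.
  have nrm : ~ regular (x ^+ m) by apply: nreg; lia.
  exists (x ^+ m).
    split=> //; last by rewrite -expgnDr; apply: reg_exp rn; lia.
    have [gx ex] := Px; split; last by rewrite ipowX.
    by case: m m0 {mh xms hm nrm} => // m _; rewrite expgS mulgA gx.
  move=> b bs; split; first by apply: (KP _ bs) => //; lia.
  by move=> bx; move: xms; rewrite -bx bs.
apply: (@closed_clifford_nonsingular a).
- move=> i j ij; case: (ltngtP i j) => // /aR[_]; by rewrite ij.
- by move=> i; have [] := aQ i.
- move=> i j; case: (ltngtP i j) => [/aR[]//|/aR[]|->]; first by rewrite mulC.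
  by have [] := aQ j.
Qed.

Lemma closed_bounded : exists2 N, (0 < N)%N & forall x : M, idem (x ^+ N).
Proof.
have [k k0 kP] := closed_index; have [n n0 nP] := closed_exponent.
exists (k * n)%N; first by rewrite muln_gt0 k0.
by move=> x; rewrite expgnA nP//; exact: ipow_idem.
Qed.

End Bounded.

(** * Idempotents in the T1 case *)

Lemma injectively_closed_sub (C D : topSemigroupType -> Prop) (X : semigroupType) :
  (forall Y, C Y -> D Y) -> injectively_closed D X -> injectively_closed C X.
Proof. by move=> CD DX Y h /CD; exact: DX. Qed.

Lemma TzS_T1S (Y : topSemigroupType) : TzS Y -> T1S Y.
Proof. by case=> + _; exact: hausdorff_accessible. Qed.

Section Twin.
Variables (M : monoidType).
Hypothesis mulC : commutative (@mul M).
Hypothesis cf : chain_finite M.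
Variables (e : M) (f : nat -> M).
Hypotheses (ee : idem e) (ff : forall i, idem (f i)).
Hypotheses (ef : forall i, e * f i = e) (fe : forall i, f i <> e).
Hypothesis f_lim : forall q, idem q -> e * q = e -> q <> e ->
  exists n, forall i, (n <= i)%N -> q * f i <> q.

Let U n z : set M := [set u | e * u = z /\ exists2 j, (n <= j)%N & f j * u = u].

Let U_le m n z : (m <= n)%N -> U n z `<=` U m z.
Proof.
by move=> mn u [eu [j nj fju]]; split=> //; exists j => //; exact: leq_trans nj.
Qed.

Let U_out x : e * x <> x -> exists n, forall z, ~ U n z x.
Proof.
move=> ex; pose D := [set q : M | [/\ idem q, e * q = e & q * x = x]].
case: (pselect (exists n, forall j, (n <= j)%N -> f j * x <> x)) => [[n nx]|nn].
  by exists n => z [_ [j nj fjx]]; exact: nx nj fjx.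
have fx n : exists2 j, (n <= j)%N & f j * x = x.
  apply: contrapT => nj; apply: nn; exists n => j nj' fjx.
  by apply: nj; exists j.
have [j0 _ j0x] := fx 0%N.
have [|||q [qq eq qx] qmin] := @idem_least _ mulC cf D (f j0).
- by move=> q [].
- by split.
- move=> d d' [dd ed dx] [dd' ed' dx']; split; first exact: idem_mul.
    by rewrite mulgA ed.
  by rewrite -mulgA dx'.
have [qe|qe] := pselect (q = e); first by case: ex; rewrite -qe.
have [n nq] := f_lim qq eq qe; have [j nj fjx] := fx n.
by case: (nq j nj); apply: qmin; split.
Qed.

Let U_self n z : e * z = z -> U n z z.
Proof.
by move=> ez; split=> //; exists n => //; rewrite -ez mulgA (mulC _ e) ef.
Qed.

(* A second copy [None] of [e], to which the [f i] converge. *)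
Definition twin := option M.

Definition untwin (y : twin) : M := if y is Some x then x else e.

(** No product is [None], so continuity involves only neighbourhoods of values [Some x]. *)
Definition twin_mul (x y : twin) : twin := Some (untwin x * untwin y).

HB.instance Definition _ := Choice.copy twin (option M).

Lemma twin_mulA : associative twin_mul.
Proof. by move=> x y z; rewrite /twin_mul /= mulgA. Qed.

HB.instance Definition _ := isSemigroup.Build twin twin_mulA.

(** [None] and [Some e] have the same punctured neighbourhoods, so they cannot be separated, as T1
    permits. Elements outside [e M] are isolated. *)
Definition twin_open : set_system twin := [set V |
  (forall z, e * z = z -> V (Some z) -> exists n, forall u, U n z u -> V (Some u)) /\
  (V None -> exists n, forall u, U n e u -> u <> e -> V (Some u))].

Lemma twin_openT : twin_open setT.
Proof. by split=> [z _ _|_]; exists 0%N. Qed.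

Lemma twin_openI : setI_closed twin_open.
Proof.
move=> V W [V1 V2] [W1 W2]; split=> [z ez [Vz Wz]|[VN WN]].
  have [m mV] := V1 z ez Vz; have [n nW] := W1 z ez Wz.
  exists (maxn m n) => u uU; split; [apply: mV|apply: nW]; apply: U_le uU;
    [exact: leq_maxl|exact: leq_maxr].
have [m mV] := V2 VN; have [n nW] := W2 WN.
exists (maxn m n) => u uU ue; split; [apply: mV|apply: nW] => //; apply: U_le uU;
  [exact: leq_maxl|exact: leq_maxr].
Qed.

Lemma twin_open_bigU (I : Type) (V : I -> set twin) :
  (forall i, twin_open (V i)) -> twin_open (\bigcup_i V i).
Proof.
move=> oV; split=> [z ez [i _ Viz]|[i _ ViN]].
  have [n nV] := (oV i).1 z ez Viz; exists n => u /nV; by exists i.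
have [n nV] := (oV i).2 ViN; exists n => u uU ue; exists i => //; exact: nV.
Qed.

HB.instance Definition _ :=
  isOpenTopological.Build twin twin_openT twin_openI twin_open_bigU.

Let B n x : set M := [set u | if pselect (e * x = x) then U n x u else u = x].

Let BM n x y u v : B n x u -> B n y v -> B n (x * y) (u * v).
Proof.
rewrite /B /=; case: pselect => ex; case: pselect => ey; case: pselect => exy //.
- move=> [eu [j nj fju]] [ev [k nk fkv]]; split.
    by rewrite mulgA eu -ev mulgA (mulC x e) ex.
  by exists j => //; rewrite mulgA fju.
- by case: exy; rewrite mulgA ex.
- move=> [eu [j nj fju]] ->; split; first by rewrite mulgA eu.
  by exists j => //; rewrite mulgA fju.
- by case: exy; rewrite mulgA ex.
- move=> -> [ev [j nj fjv]]; split; first by rewrite mulgA (mulC e) -mulgA ev.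
  by exists j => //; rewrite mulgA (mulC (f j)) -mulgA fjv.
- by case: exy; rewrite mulgA (mulC e) -mulgA ey.
- by move=> -> ->; exact: U_self.
- by move=> -> ->.
Qed.

Let N n (p : twin) : set twin :=
  if p is Some x then Some @` B n x else [set None] `|` Some @` (U n e `\ e).

Let N_open n p : open (N n p).
Proof.
case: p => [x|]; split.
- move=> z ez [y + [yz]]; rewrite {}yz /B /=; case: pselect => ex.
    move=> [ezx _]; exists n => u uU; exists u => //.
    have <- : z = x by rewrite -ez.
    by rewrite /B /=; case: pselect.
  by move=> /= zx; exfalso; apply: (ex); rewrite -zx.
- by move=> [].
- by move=> z ez [//|[y [[ey _] ye] [yz]]]; case: ye; rewrite /= -ey yz ez.
- by move=> _; exists n => u uU ue; right; exists u.
Qed.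

Let N_self n p : N n p p.
Proof.
case: p => [x|]; last by left.
by exists x => //; rewrite /B /=; case: pselect => // ex; exact: U_self.
Qed.

Let untwin_N n p q : N n p q -> B n (untwin p) (untwin q).
Proof.
case: p => [x [u uB qE]|[qE|[u [uU _] qE]]]; first by rewrite -qE.
  by rewrite qE /B /=; case: pselect => //= _; exact: U_self.
by rewrite -qE /B /=; case: pselect => //=.
Qed.

Lemma twin_continuous : continuous (fun z : twin * twin => (z.1 * z.2)%g).
Proof.
move=> [p q] V /=; rewrite nbhsE => -[W [oW Wpq] WV]; apply: filterS WV _.
have [n nW] : exists n, forall u, B n (untwin p * untwin q) u -> W (Some u).
  rewrite /B; case: (pselect (e * (untwin p * untwin q) = untwin p * untwin q)) => epq.
    have [n nW] := oW.1 _ epq Wpq; exists n => u /= uU; exact: nW.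
  by exists 0%N => u /= ->.
exists (N n p, N n q).
  by split; apply: open_nbhs_nbhs; split; [exact: N_open|exact: N_self|
    exact: N_open|exact: N_self].
move=> [p' q'] [/= /untwin_N pp' /untwin_N qq']; apply: nW; exact: BM.
Qed.

HB.instance Definition _ := isTopologicalSemigroup.Build twin twin_continuous.

Lemma twin_T1S : T1S twin.
Proof.
move=> p q /eqP pq; suff [n nq] : exists n, ~ N n p q.
  by exists (N n p); rewrite !inE; split=> //; exact: N_self.
case: p pq => [x|]; case: q => [y|] // pq.
- case: (pselect (e * y = y)) => ey.
    exists 0%N => -[u + [uy]]; rewrite uy /B /=; case: pselect => ex.
      by move=> [exy _]; apply: pq; rewrite -ey exy.
    by move=> yx; apply: pq; rewrite yx.
  case: (pselect (e * x = x)) => ex; last first.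
    exists 0%N => -[u + [uy]]; rewrite uy /B /=; case: pselect => //= _ yx.
    by apply: pq; rewrite yx.
  have [n nU] := U_out ey; exists n => -[u + [uy]]; rewrite uy /B /=.
  by case: pselect => //= _; exact: nU.
- by exists 0%N => -[].
- case: (pselect (e * y = y)) => ey.
    exists 0%N => -[//|[u [[eu _] ue] [uy]]]; apply: ue; rewrite /= -eu uy ey //.
  have [n nU] := U_out ey; exists n => -[//|[u [uU _] [uy]]].
  by apply: (nU e); rewrite -uy.
Qed.

Definition twin_emb (x : M) : twin := Some x.

Lemma twin_embM : {morph twin_emb : x y / x * y}.
Proof. by []. Qed.

HB.instance Definition _ := isMultiplicative.Build M twin twin_emb twin_embM.

Lemma no_twin : ~ injectively_closed T1S M.
Proof.
move=> ic; have emb_inj : injective twin_emb by move=> x y [].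
suff [x _ //] : range twin_emb (None : twin).
apply: (ic twin twin_emb twin_T1S emb_inj) => V; rewrite nbhsE => -[W [oW WN] WV].
have [n nW] := oW.2 WN; exists (Some (f n)); split; first by exists (f n).
by apply/WV/nW => //; split=> //; exists n; [|exact: ff].
Qed.

End Twin.

Lemma closed_T1_idem_finite (M : monoidType) : commutative (@mul M) ->
  injectively_closed T1S M -> finite_set (@idem M).
Proof.
move=> mulC ic; have ic' := injectively_closed_sub TzS_T1S ic.
have cf := closed_chain_finite mulC ic'.
apply: contrapT => /infinite_seq[f f_inj ff].
have fin e : ~ unbounded [set i | f i = e].
  move=> uf; have [i _ fi] := uf 0%N; have [j ij fj] := uf i.+1.
  by have := f_inj i j; rewrite fi fj => /(_ erefl) E; rewrite E ltnn in ij.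
have [e [s [ee es is_ s_anti s_lim]]] := idem_antichain mulC cf ff fin.
apply: (@no_twin M mulC cf e (fun i => f (s i))) => //.
- by move=> i; have [] := es i.
- by move=> i; have [] := es i.
Qed.

(** * Closed images *)

(* [pw n x] is [x ^+ n.+1], which makes sense in a semigroup. *)
Definition pw (S : magmaType) n (x : S) : S := iter n (mul x) x.

Lemma filter_seq (T : eqType) U (F : set_system U) (P : T -> set U) (s : seq T) :
  Filter F -> (forall x, x \in s -> F (P x)) -> F [set u | forall x, x \in s -> P x u].
Proof.
move=> FF; elim: s => [|x s IH] sP; first by apply: filterS filterT.
have Fs : F [set u | forall x, x \in s -> P x u].
  by apply: IH => z zs; apply: sP; rewrite inE zs orbT.
apply: filterS (filterI (sP _ (mem_head _ _)) Fs) => u [xu su] z.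
by rewrite inE => /orP[/eqP->|/su].
Qed.

Lemma ultra_not T (F : set_system T) (A : set T) : UltraFilter F ->
  ~ F A -> F (~` A).
Proof. by move=> UF nA; have [] := in_ultra_setVsetC A UF. Qed.

Section TopologicalSemigroup.
Variables (Y : topSemigroupType) (T : Type) (F : set_system T).
Context {FF : Filter F}.

Lemma cvg_mul (u v : T -> Y) a b : u @ F --> a -> v @ F --> b ->
  (fun x => u x * v x) @ F --> (a * b)%g.
Proof.
move=> ua vb V /(@mulg_continuous Y (a, b))[[A B] [/= nA nB] ABV].
have FA : F (u @^-1` A) := ua A nA; have FB : F (v @^-1` B) := vb B nB.
by apply: (filterS (F := F) _ (filterI FA FB)) => x [Ax Bx]; exact: (ABV (u x, v x) (conj Ax Bx)).
Qed.

Lemma cvg_pw n (u : T -> Y) a : u @ F --> a -> (fun x => pw n (u x)) @ F --> pw n a.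
Proof. by move=> ua; elim: n => //= n IH; exact: cvg_mul. Qed.

End TopologicalSemigroup.

Lemma T1_cvg_const (Y : topologicalType) T (F : set_system T) (u : T -> Y) a b :
  accessible_space Y -> ProperFilter F -> u @ F --> a -> F [set x | u x = b] -> a = b.
Proof.
move=> Y1 FF ua ub; apply: contrapT => /eqP/Y1[A [oA]]; rewrite !inE => aA bA.
have nA : nbhs a A by exact: open_nbhs_nbhs.
have FA : F (u @^-1` A) := ua A nA.
by have [x [/= xb xA]] := filter_ex (filterI ub FA); apply: bA; rewrite -xb.
Qed.

Lemma T2_cvg_eq (Y : topologicalType) T (F : set_system T) (u v : T -> Y) (a b : Y) :
  hausdorff_space Y -> ProperFilter F -> u @ F --> a -> v @ F --> b ->
  F [set x | u x = v x] -> a = b.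
Proof.
move=> Y2 FF ua vb uv; apply: Y2 => A B nA nB.
have FA : F (u @^-1` A) := ua A nA; have FB : F (v @^-1` B) := vb B nB.
have [x [[Ax Bx] uvx]] := filter_ex (filterI (filterI FA FB) uv).
by exists (u x); split=> //; rewrite uvx.
Qed.

Section Closedness.
Variables (S : semigroupType) (Y : topSemigroupType) (h : {multiplicative S -> Y}).
Hypotheses (mulC : commutative (@mul S)) (h_inj : injective h).
Variables (n J : nat).
Local Notation f := (@pw S n).
Local Notation reg x := (f x * x = x).
Local Notation sq := (fun x : S => x * x).
Hypothesis ff : forall x : S, idem (f x).
Hypothesis fM : forall x y : S, f (x * y) = f x * f y.
Hypothesis f_id : forall e : S, idem e -> f e = e.
(** Regularity is reached by iterated squaring so that the arguments below can proceed one square at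
    a time. *)
Hypothesis sq_reg : forall x : S, reg (iter J sq x).
Hypothesis cf : chain_finite S.
Hypothesis ns : nonsingular S.
Hypothesis cns : forall a : nat -> S, injective a -> (forall i, ~ reg (a i)) ->
  ~ forall i j, reg (a i * a j).
Hypothesis fin_group : forall e : S, idem e -> finite_set [set x | f x = e /\ e * x = x].
Hypothesis fin_mul : forall z : S, finite_set (mul z @` [set x | f x = f z]).
Hypothesis Y1 : T1S Y.

Let hM x y : h (x * y) = h x * h y. Proof. exact: gmulfM. Qed.

Let fsq x : f (x * x) = f x. Proof. by rewrite fM; exact: ff. Qed.

Let h_pw x : h (f x) = pw n (h x).
Proof. by rewrite /pw; elim: n => //= k IH; rewrite hM IH. Qed.

Let h_mul a (G : set_system S) (y : Y) : Filter G -> h @ G --> y ->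
  h @ fmap (mul a) G --> h a * y.
Proof.
move=> FG Gy V nV; change (G [set x : S | V (h (a * x))]).
have GV : G [set x : S | V (h a * h x)] by exact: (cvg_mul (cvg_cst (h a)) Gy nV).
by apply: filterS GV => x; rewrite /= hM.
Qed.

Let h_sq (G : set_system S) (y : Y) : Filter G -> h @ G --> y ->
  h @ fmap sq G --> y * y.
Proof.
move=> FG Gy V nV; change (G [set x : S | V (h (x * x))]).
have GV : G [set x : S | V (h x * h x)] by exact: (cvg_mul Gy Gy nV).
by apply: filterS GV => x; rewrite /= hM.
Qed.

Let h_f (G : set_system S) (y : Y) : Filter G -> h @ G --> y ->
  (fun x => h (f x)) @ G --> pw n y.
Proof.
move=> FG Gy; rewrite (_ : (fun x => h (f x)) = fun x => pw n (h x)).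
  exact: cvg_pw.
by apply/funext => x; exact: h_pw.
Qed.

Section Unipotent.
Variables (e : S).
Let Se := [set x | f x = e].

Let fin_mul' z : Se z -> finite_set (mul z @` Se).
Proof. by rewrite /Se /= => <-; exact: fin_mul. Qed.

Let SeM x y : Se x -> Se y -> Se (x * y).
Proof.
by rewrite /Se /= fM => xe ->; rewrite -xe; exact: ff.
Qed.

Let ultra_mul z (G : set_system S) : UltraFilter G -> G Se -> Se z ->
  exists2 c, Se c & G [set b | z * b = c].
Proof.
move=> UG GSe ze; have [|c [b eb <-] Gc] := ultra_finite UG (fin_mul' ze) (f := mul z).
  by apply: filterS GSe => b eb; exists b.
by exists (z * b) => //; exact: SeM.
Qed.

(** For [a] in [Se] the product [a * b] has a constant value [l a] for almost all [b]. If [l] is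
    almost constant, its value is [d], and a nonprincipal [G] allows a greedy sequence with all
    products [d]. Otherwise [l] has infinitely many values on [Th], and (a x)(b x) = a b d = g shows
    that all their products are [g]. Both contradict [ns]. *)
Let step (G : set_system S) (y : Y) d : UltraFilter G -> G Se -> h @ G --> y ->
  G [set x | x * x = d] -> exists x, G [set x].
Proof.
move=> UG GSe hy Gd; apply: contrapT => nG.
have [d0 [d0e d0d]] := filter_ex (filterI GSe Gd).
have de : Se d by rewrite -d0d; exact: SeM.
have yy : y * y = h d.
  apply: (T1_cvg_const (F := G) (u := fun x => h x * h x) Y1) => //.
    exact: cvg_mul.
  by apply: filterS Gd => x xd; rewrite /= -hM xd.
have /choice[l lP] : forall a, exists c, Se a -> Se c /\ G [set b | a * b = c].
  move=> a; case: (pselect (Se a)) => [ae|nae]; last by exists a.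
  by have [c ce Gc] := ultra_mul UG GSe ae; exists c.
have hl a : Se a -> h a * y = h (l a).
  move=> ae; apply: (T1_cvg_const Y1 _ (cvg_mul (cvg_cst (h a)) hy)).
  by have [_ Gl] := lP a ae; apply: filterS Gl => b abl; rewrite /= -hM abl.
have [[c Gc]|nc] := pselect (exists c, G [set a | l a = c]).
  have cd : c = d.
    apply: h_inj; rewrite -yy; apply: esym.
    apply: (T1_cvg_const (F := G) (u := fun x => h x * y) Y1) => //.
      by apply: cvg_mul => //; exact: cvg_cst.
    by apply: filterS (filterI GSe Gc) => a [ae /= ac]; rewrite hl// ac.
  subst c; have [s sQ|a aQ aR] := @greedy S [set a | [/\ Se a, a * a = d & l a = d]]
      (fun x y => x * y = d /\ x <> y).
    have Gs : G [set b | forall x, x \in s -> x * b = d /\ x <> b].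
      apply: filter_seq => x /sQ[xe xx xl]; apply: filterI.
        by have [_] := lP x xe; rewrite xl.
      have /(ultra_not UG) : ~ G [set x] by move=> Gx; apply: nG; exists x.
      by apply: filterS => b xb /esym.
    have [b [[be [bb bl]] bs]] := filter_ex (filterI (filterI GSe (filterI Gd Gc)) Gs).
    by exists b.
  apply: (@ns d a).
    by move=> i j ij; case: (ltngtP i j) => // /aR[_]; rewrite ij.
  move=> i j; case: (ltngtP i j) => [/aR[]//|/aR[]|->]; first by rewrite mulC.
  by have [] := aQ j.
have [p pe Gp] := ultra_mul UG GSe de.
have [g _ Gg] := ultra_mul UG GSe pe.
pose Th := [set a | [/\ Se a, d * a = p & p * a = g]].
have GT : G Th by apply: filterS (filterI GSe (filterI Gp Gg)) => a [? []].
have : infinite_set (l @` Th).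
  move=> fT; apply: nc; have [|c _ Gc] := ultra_finite UG fT (f := l).
    by apply: filterS GT => a Ta; exists a.
  by exists c.
move=> /infinite_seq[c c_inj cT]; apply: (@ns g c) => // i j.
have [a [ae ad ag] <-] := cT i; have [b [be bd bg] <-] := cT j.
have [_ Ga] := lP a ae; have [_ Gb] := lP b be.
have [x [[/= <- <-] xd]] := filter_ex (filterI (filterI Ga Gb) Gd).
by rewrite (commACA mulC) xd -mulgA (mulC b) mulgA (mulC a) ad bg.
Qed.

(** Induction on the number of squarings needed for regularity. Regular elements of [Se] form a
    finite group; otherwise the squares are almost constant by induction and [step] applies. *)
Lemma unipotent_principal (G : set_system S) (y : Y) : UltraFilter G -> G Se ->
  h @ G --> y -> exists x, G [set x].
Proof.
move=> UG GSe hy; have [x0 x0e] := filter_ex GSe.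
have ee : idem e by rewrite -x0e; exact: ff.
have : G [set x | reg (iter J sq x)] by apply: filterS filterT => x _; exact: sq_reg.
elim: J G y UG GSe hy => [|k IH] G y UG GSe hy Gk /=.
  have [|x _ Gx] := ultra_finite UG (fin_group ee) (f := id); last by exists x.
  by apply: filterS (filterI GSe Gk) => x [/= xe]; rewrite xe.
have [||||x Gx] := IH (fmap sq G) (y * y).
- exact: ultra_fmap.
- by apply: (filterS (F := G)) GSe => x xe; exact: (SeM xe xe).
- exact: h_sq.
- apply: (filterS (F := G)) Gk => x; have : iter k.+1 sq x = iter k sq (x * x) by rewrite iterSr.
  by rewrite /= => ->.
exact: (step UG GSe hy Gx).
Qed.

End Unipotent.

(** In a counterexample with minimal [g'], almost all elements are strictly below [g']; let [m] be
    maximal among the idempotents strictly below [g']. Multiplication by [m] gives an ultrafilter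
    converging to [h m], so by minimality of [g'] almost all elements are above [m], and by
    maximality they equal [m]. *)
Lemma below_principal (G : set_system S) g : UltraFilter G -> G (@idem S) ->
  G [set x | x * g = x] -> idem g -> h @ G --> h g -> G [set g].
Proof.
move=> UG GE Gg gg hg; apply: contrapT => nGg.
pose D := [set g : S | idem g /\ exists G : set_system S, [/\ UltraFilter G, G (@idem S),
   G [set x | x * g = x], h @ G --> h g & ~ G [set g]]].
have [|g' [gg' [G' [UG' GE' Gg' hg' nGg']]] gmin] :=
    @idem_minimal _ mulC cf D g (fun x (Dx : D x) => Dx.1).
  by split=> //; exists G.
pose P := [set x | [/\ idem x, x * g' = x & x <> g']].
have GP : G' P.
  by apply: filterS (filterI GE' (filterI Gg' (ultra_not UG' nGg'))) => x [? []].
have [x0 Px0] := filter_ex GP.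
have PE : P `<=` @idem S by move=> x [].
have [m [mm mg mng] mmax] := idem_maximal mulC cf PE Px0.
have Gm : G' [set x | m * x = m].
  apply: contrapT => nGm; apply: (mng); apply: gmin => //; split=> //.
  exists (fmap (mul m) G'); split=> //.
  - exact: ultra_fmap.
  - by apply: (filterS (F := G')) GE' => x xx; exact: (idem_mul mulC).
  - apply: (filterS (F := G')) filterT => x _ /=.
    by rewrite -mulgA (mulC x) mulgA mm.
  - by have := @h_mul m _ _ _ hg'; rewrite -hM mg; apply.
have nGm' : ~ G' [set m].
  move=> Gm'; apply: mng; apply/esym/h_inj.
  by apply: (T1_cvg_const (F := G') (u := h) Y1) => //; apply: filterS Gm' => x ->.
have [x [[Px mx] xm]] := filter_ex (filterI (filterI GP Gm) (ultra_not UG' nGm')).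
by apply: xm; apply: mmax.
Qed.

Lemma range_ultra (y : Y) : closure (range h) y ->
  exists2 G : set_system S, UltraFilter G & h @ G --> y.
Proof.
move=> cy; pose B := filter_from (nbhs y) (fun V => h @^-1` V).
have PB : ProperFilter B.
  apply: filter_from_proper.
    apply: filter_from_filter; first by exists setT; exact: filterT.
    by move=> V W nV nW; exists (V `&` W); first exact: filterI.
  by move=> V /cy[_ [[x _ <-] Vx]]; exists x.
have [G [UG BG]] := ultraFilterLemma PB.
by exists G => // V nV; apply: BG; exists V.
Qed.

Lemma T1_closed_range : finite_set (@idem S) -> closed (range h).
Proof.
move=> fE y /range_ultra[G UG Gy].
have [|e ee Ge] := ultra_finite UG fE (f := f).
  by apply: filterS filterT => x _; exact: ff.
have [x Gx] := unipotent_principal UG Ge Gy.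
exists x => //; apply/esym; apply: (T1_cvg_const (F := G) (u := h) Y1) => //.
by apply: filterS Gx => z /= ->.
Qed.

Hypothesis Y2 : T2S Y.

Section IdempotentLimits.
Variables (eps : Y) (P : set S) (G : set_system S).
Hypothesis PE : P `<=` @idem S.
Hypothesis Peps : forall x, P x -> exists2 z, idem z & h x * eps = h z.
Hypotheses (UG : UltraFilter G) (GP : G P) (Geps : h @ G --> eps).

(** Let [h x * eps = h (l x)] for [x] in [P]. By [below_principal], [l x] is below almost all [u],
    hence below [l u]. For a maximal [l x] this gives [l u = l x], so [h u * eps] is almost constant
    and its limit [eps * eps = eps] is [h (l x)]. *)
Lemma idem_limit_ascent : exists2 z, idem z & eps = h z.
Proof.
have eps2 : eps * eps = eps.
  apply: (T2_cvg_eq (F := G) (u := fun x => h x * h x) (v := h) Y2) => //.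
    exact: cvg_mul.
  by apply: filterS GP => x /PE xx; rewrite /= -hM xx.
have /choice[l lP] : forall x, exists z, P x -> idem z /\ h x * eps = h z.
  move=> x; case: (pselect (P x)) => [/Peps[z zz xz]|nP]; first by exists z.
  by exists x.
have lG x : P x -> G [set u | l x * u = l x].
  move=> Px; have [ll xl] := lP x Px.
  have : fmap (mul (l x)) G [set l x].
    apply: below_principal => //.
    - exact: ultra_fmap.
    - by apply: (filterS (F := G)) GP => u /PE uu; exact: (idem_mul mulC).
    - apply: (filterS (F := G)) filterT => u _ /=.
      by rewrite -mulgA (mulC u) mulgA ll.
    - by have := @h_mul (l x) _ _ _ Geps; rewrite -xl -mulgA eps2; apply.
  by [].
have [x0 Px0] := filter_ex GP.
have [||_ [x Px <-] lmax] := @idem_maximal _ mulC cf (l @` P) (l x0).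
- by move=> _ [x Px <-]; have [] := lP x Px.
- by exists x0.
have [ll xl] := lP x Px.
exists (l x) => //.
apply/esym; rewrite -eps2; apply/esym.
apply: (T1_cvg_const (F := G) (u := fun u => h u * eps) Y1) => //.
  by apply: cvg_mul => //; exact: cvg_cst.
apply: filterS (filterI GP (lG x Px)) => u [Pu /= lu].
have [_ ul] := lP u Pu; rewrite ul; congr (h _); apply: lmax; first by exists u.
by apply: h_inj; rewrite hM -ul mulgA -hM lu -xl -mulgA eps2.
Qed.

End IdempotentLimits.

(** If some [h g * eps] is not the image of an idempotent, choose [g] minimal: [idem_limit_ascent]
    applies to the translate of [G] by [g]. If there is no such [g], it applies to [G]. *)
Lemma idem_limit (G : set_system S) (eps : Y) : UltraFilter G -> G (@idem S) ->
  h @ G --> eps -> exists2 z, idem z & eps = h z.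
Proof.
move=> UG GE Geps.
pose D := [set g : S | idem g /\ ~ exists2 z, idem z & h g * eps = h z].
have [[g Dg]|nD] := pselect (D !=set0); last first.
  apply: (@idem_limit_ascent eps (@idem S) G) => // x xx.
  by apply: contrapT => nx; apply: nD; exists x.
have [g0 [gg gne] gmin] := idem_minimal mulC cf (fun x (Dx : D x) => Dx.1) Dg.
exfalso; apply: gne.
have hG : h @ (fmap (mul g0) G) --> h g0 * eps.
  exact: h_mul.
have UG' : UltraFilter (fmap (mul g0) G) by exact: ultra_fmap.
have [Gg|nGg] := pselect (fmap (mul g0) G [set g0]).
  exists g0 => //; apply: (T1_cvg_const (F := fmap (mul g0) G) (u := h) Y1) => //.
  by apply: (filterS (F := G)) Gg => x /= ->.
apply: (@idem_limit_ascent (h g0 * eps) [set x | [/\ idem x, x * g0 = x & x <> g0]]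
  (fmap (mul g0) G)) => //.
- by move=> x [].
- move=> x [xx xg xng]; apply: contrapT => nx; apply: xng; apply: gmin => //.
  by split=> //; rewrite mulgA -hM xg in nx.
- have nG : G [set x | g0 * x <> g0] := ultra_not UG' nGg.
  apply: (filterS (F := G) _ (filterI GE nG)) => x [xx gx]; split=> //.
    exact: (idem_mul mulC).
  by rewrite -mulgA (mulC x) mulgA gg.
Qed.

Section SingularLimits.
Variables (e : S).
Hypothesis ee : idem e.

Let fix_ae (G : set_system S) (y : Y) : UltraFilter G -> h @ G --> y ->
  pw n y = h e -> G [set x | e * f x = e].
Proof.
move=> UG Gy ye; have UG' : UltraFilter (fmap (mul e \o f) G) by exact: ultra_fmap.
suff : fmap (mul e \o f) G [set e] by [].
apply: below_principal => //.
- apply: (filterS (F := G)) filterT => x _ /=; exact: (idem_mul mulC).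
- apply: (filterS (F := G)) filterT => x _ /=.
  by rewrite -mulgA (mulC (f x)) mulgA ee.
- move=> V nV; change (G [set x : S | V (h (e * f x))]).
  have {}nV : nbhs (h e * pw n y) V by rewrite ye -hM ee.
  have GV : G [set x : S | V (h e * h (f x))] .
    exact: (cvg_mul (cvg_cst (h e)) (h_f (G := G) _ Gy) nV).
  by apply: filterS GV => x; rewrite /= hM.
Qed.

Let const_ae (G : set_system S) (y : Y) : UltraFilter G -> h @ G --> y ->
  pw n y = h e -> exists k, [/\ f k = e, e * k = k & h e * y = h k].
Proof.
move=> UG Gy ye; have Ge := fix_ae UG Gy ye.
have [|k [ke ek] Gk] := ultra_finite UG (fin_group ee) (f := mul e).
  apply: filterS Ge => x /= ex.
  by rewrite mulgA ee fM f_id.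
exists k; split=> //.
apply: (T1_cvg_const (F := G) (u := fun x => h e * h x) Y1) => //.
  by apply: cvg_mul => //; exact: cvg_cst.
by apply: filterS Gk => x /= <-; rewrite hM.
Qed.

(** The case in which neither the regular elements nor the elements with idempotent [e] belong to
    [G]. *)
Definition singular_limit (G : set_system S) (y : Y) := [/\ UltraFilter G,
  h @ G --> y, pw n y = h e, G [set x | ~ reg x] & G [set x | f x <> e]].

Let singular_square (P : set S) (G : set_system S) (y : Y) : singular_limit G y ->
  G [set x | P (f x)] -> exists G' y', [/\ singular_limit G' y',
    G' [set x | P (f x)] & G' [set x | reg (x * x)]].
Proof.
move=> Gy GP.
have [UG _ _ _ _] := Gy.
have : G [set x | reg (iter J sq x)] by apply: filterS filterT => x _; exact: sq_reg.
elim: J G y {UG} Gy GP => [|k IH] G y Gy GP Gk.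
  have [UG _ _ Gn _] := Gy.
  by have [x [/= nx rx]] := filter_ex (filterI Gn Gk).
have [UG hG ye Gn Ge] := Gy.
have [Gs|nGs] := pselect (G [set x | reg (x * x)]); first by exists G, y.
have UG' : UltraFilter (fmap sq G) by exact: ultra_fmap.
apply: (IH (fmap sq G) (y * y)).
- split=> //.
  + exact: h_sq.
  + apply: (T2_cvg_eq (F := G) (u := fun x => h (f (x * x))) (v := fun x => h (f x)) Y2).
    * by apply: (@h_f (fmap sq G) (y * y)); exact: h_sq.
    * by rewrite -ye; exact: h_f.
    * by apply: filterS filterT => x _ /=; rewrite fsq.
  + exact: (ultra_not UG nGs).
  + by apply: (filterS (F := G)) Ge => x /=; rewrite fsq.
- by apply: (filterS (F := G)) GP => x /=; rewrite fsq.
- apply: (filterS (F := G)) Gk => x; have : iter k.+1 sq x = iter k sq (x * x) by rewrite iterSr.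
  by rewrite /= => ->.
Qed.

Definition singular_below g := exists G y, singular_limit G y /\ G [set x | f x * g = f x].

(** If almost all [a] have regular products with almost all [b], a greedy choice contradicts [cns].
    Otherwise, for almost all [a], the products [a * b] are almost all nonregular with idempotent
    [e], since else the translate of [G] by [a] would be a singular limit below [f a]. By
    [unipotent_principal] they have an almost constant value [c a]. *)
Let singular_step (G : set_system S) (y : Y) : singular_limit G y ->
  G [set x | reg (x * x)] -> ~ G [set x | ~ singular_below (f x)].
Proof.
move=> [UG Gy ye Gn Gne] Gr Gb.
have Ge := fix_ae UG Gy ye; have [k [ke ek hk]] := const_ae UG Gy ye.
pose N := [set a | G [set b | reg (a * b)]].
have GN : G N.
  apply: contrapT => /(ultra_not UG) GN.
  pose Q := [set a | [/\ ~ N a, e * f a = e & ~ singular_below (f a)]].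
  have GQ : G Q by apply: filterS (filterI GN (filterI Ge Gb)) => a [? []].
  have Qe a : Q a -> G [set b | ~ reg (a * b)] /\ G [set b | f (a * b) = e].
    move=> [Na ea ba]; have Gab := ultra_not UG Na; split=> //.
    apply: contrapT => /(ultra_not UG) Gabe; apply: ba.
    exists (fmap (mul a) G), (h a * y); split.
      split=> //.
      - exact: ultra_fmap.
      - exact: h_mul.
      - apply: (T2_cvg_eq (F := G) (u := fun x => h (f (a * x)))
          (v := fun x => h (f a) * h (f x)) Y2).
        + by apply: (@h_f (fmap (mul a) G) (h a * y)); exact: h_mul.
        + rewrite -ea (mulC e) hM -ye; apply: cvg_mul; first exact: cvg_cst.
          exact: h_f.
        + by apply: filterS filterT => x _ /=; rewrite fM hM.
    apply: (filterS (F := G)) filterT => x _ /=.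
    by rewrite fM -mulgA (mulC (f x)) mulgA ff.
  have /choice[c cP] : forall a, exists c, Q a -> G [set b | a * b = c].
    move=> a; case: (pselect (Q a)) => [Qa|nQ]; last by exists a.
    have UGa : UltraFilter (fmap (mul a) G) by exact: ultra_fmap.
    have [|c Gc] := @unipotent_principal e (fmap (mul a) G) (h a * y) UGa (Qe a Qa).2.
      exact: h_mul.
    by exists c.
  have ce a : Q a -> f (c a) = e.
    by move=> Qa; have [x [<- /= ]] := filter_ex (filterI (cP a Qa) (Qe a Qa).2).
  have cn a : Q a -> ~ reg (c a).
    by move=> Qa; have [x [<- /= ]] := filter_ex (filterI (cP a Qa) (Qe a Qa).1).
  have hc a : Q a -> h a * y = h (c a).
    move=> Qa; apply: (T1_cvg_const (F := G) (u := fun x => h a * h x) Y1) => //.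
      by apply: cvg_mul => //; exact: cvg_cst.
    by apply: filterS (cP a Qa) => x /= <-; rewrite hM.
  have ckk a : Q a -> c a = k * k -> False.
    by move=> Qa ck; apply: (cn a Qa); rewrite ck fM ke ee mulgA ek.
  have Uc : UltraFilter (fmap c G) by exact: ultra_fmap.
  have hcy : (fun a => h a * y) @ G --> y * y.
    by apply: cvg_mul => //; exact: cvg_cst.
  (* The [c a] tend to [y * y], so they are almost constant: [y * y] is the image of a nonregular
     [x]. It will also be the image of the regular [k * k]. *)
  have [||x Gx] := @unipotent_principal e (fmap c G) (y * y) Uc.
  - by apply: (filterS (F := G)) GQ => a; exact: ce.
  - move=> V nV; change (G [set a : S | V (h (c a))]).
    have GV : G [set a : S | V (h a * y)] := hcy V nV.
    by apply: (filterS (F := G) _ (filterI GQ GV)) => a [Qa /=]; rewrite hc.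
  have {}Gx : G [set a | c a = x] := Gx.
  have yyx : y * y = h x.
    apply: (T1_cvg_const (F := G) (u := fun a => h a * y) Y1) => //.
    by apply: filterS (filterI GQ Gx) => a [Qa /= <-]; rewrite hc.
  (* [y * y] is a limit of regular elements. *)
  have yyk : y * y = h (k * k).
    have -> : h (k * k) = pw n y * (y * y).
      by rewrite ye mulgA hk -{3}ek (mulC e) [h (k * e)]hM -mulgA hk hM.
    apply: (T2_cvg_eq (F := G) (u := fun a => h a * h a)
      (v := fun a => h (f a) * (h a * h a)) Y2).
    + exact: cvg_mul.
    + by apply: cvg_mul; [exact: h_f|exact: cvg_mul].
    + by apply: filterS Gr => a /=; rewrite fsq -!hM => ->.
  have [a [Qa /= ax]] := filter_ex (filterI GQ Gx).
  by apply: (ckk a Qa); rewrite ax; apply: h_inj; rewrite -yyx.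
have [s sQ|a aQ aR] := @greedy S
    [set a | [/\ N a, ~ reg a, reg (a * a) & f a <> e]]
    (fun x y => reg (x * y) /\ x <> y).
  have Gs : G [set b | forall x, x \in s -> reg (x * b) /\ x <> b].
    apply: filter_seq => x /sQ[Nx _ _ xe]; apply: filterI => //.
    have /(ultra_not UG) : ~ G [set x].
      move=> Gx; apply: xe; apply: h_inj; rewrite h_pw -ye; congr (pw n _).
      by apply/esym/(T1_cvg_const (F := G) (u := h) Y1) => //; apply: filterS Gx => z /= ->.
    by apply: filterS => b xb /esym.
  have [b [[[Nb nb] [rb be]] bs]] :=
    filter_ex (filterI (filterI (filterI GN Gn) (filterI Gr Gne)) Gs).
  by exists b.
apply: (cns (a := a)).
- by move=> i j ij; case: (ltngtP i j) => // /aR[_]; rewrite ij.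
- by move=> i; have [] := aQ i.
- move=> i j; case: (ltngtP i j) => [/aR[]//|/aR[]|->]; first by rewrite (mulC (a i)).
  by have [] := aQ j.
Qed.

(** For minimal [g] with a singular limit below it, [singular_step] and minimality give an
    ultrafilter on which often, hence almost always, [f x = g]. As the [f x] tend to [h e], this
    means [g = e], which singular limits exclude. *)
Lemma no_singular_limit (G : set_system S) (y : Y) : ~ singular_limit G y.
Proof.
move=> Gy.
have [[g0 Dg]|nD] := pselect ((@idem S `&` singular_below) !=set0).
  have [g [gg [G' [y' [Gy' Gg']]]] gmin] :=
    @idem_minimal _ mulC cf _ g0 (fun x (Dx : (@idem S `&` singular_below) x) => Dx.1) Dg.
  have [G'' [y'' [Gy'' Gg'' Gr'']]] := @singular_square [set z | z * g = z] G' y' Gy' Gg'.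
  have [UG Gy2 ye2 _ Gne] := Gy''.
  apply: (singular_step Gy'' Gr''); apply: contrapT => /(ultra_not UG) Gs.
  have Gfg : G'' [set x | f x = g].
    apply: filterS (filterI Gg'' Gs) => x [/= xg /contrapT sx].
    by apply: gmin => //; split=> //; exact: ff.
  have ge : g = e.
    apply: h_inj; rewrite -ye2; apply/esym.
    apply: (T1_cvg_const (F := G'') (u := fun x => h (f x)) Y1) => //; first exact: h_f.
    by apply: filterS Gfg => x /= ->.
  have [x [/= xg xe]] := filter_ex (filterI Gfg Gne).
  by apply: xe; rewrite xg.
have [UG _ _ _ _] := Gy; have GT : G setT by exact: filterT.
have [G' [y' [Gy' _ Gr']]] := @singular_square setT G y Gy GT.
apply: (singular_step Gy' Gr'); have [UG' _ _ _ _] := Gy'.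
by apply: filterS filterT => x _ sx; apply: nD; exists (f x); split=> //; exact: ff.
Qed.

Lemma limit_in_range (G : set_system S) (y : Y) : UltraFilter G ->
  h @ G --> y -> pw n y = h e -> exists x, y = h x.
Proof.
move=> UG Gy ye.
have [Gr|/(ultra_not UG) Gn] := pselect (G [set x | reg x]).
  have [k [_ _ hk]] := const_ae UG Gy ye.
  exists k; rewrite -hk -ye.
  apply: (T2_cvg_eq (F := G) (u := h) (v := fun x => h (f x) * h x) Y2) => //.
    by apply: cvg_mul => //; exact: h_f.
  by apply: filterS Gr => x /=; rewrite -hM => ->.
have [Ge|/(ultra_not UG) Ge] := pselect (G [set x | f x = e]).
  have [x Gx] := unipotent_principal UG Ge Gy.
  exists x; apply: (T1_cvg_const (F := G) (u := h) Y1) => //.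
  by apply: filterS Gx => z /= ->.
by case: (@no_singular_limit G y).
Qed.

End SingularLimits.

Lemma T2_closed_range : closed (range h).
Proof.
move=> y /range_ultra[G UG Gy].
have UG' : UltraFilter (fmap f G) by exact: ultra_fmap.
have [|e ee ye] := @idem_limit (fmap f G) (pw n y) UG' _ (h_f _ Gy).
  by apply: (filterS (F := G)) filterT => x _; exact: ff.
by have [x ->] := limit_in_range ee UG Gy ye; exists x.
Qed.

End Closedness.

(** * Subsemigroups *)

Section AdjoinUnit.
Variable X : semigroupType.

(* [None] is a new unit, even if [X] has one. *)
Definition with_unit := option X.

Definition with_unit_mul (x y : with_unit) : with_unit :=
  if x is Some a then if y is Some b then Some (a * b) else x else y.

Fact with_unit_mulA : associative with_unit_mul.
Proof. by case=> [x|] [y|] [z|] //=; rewrite mulgA. Qed.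

Fact with_unit_1mul : left_id None with_unit_mul. Proof. by case. Qed.

Fact with_unit_mul1 : right_id None with_unit_mul. Proof. by case. Qed.

HB.instance Definition _ := Choice.copy with_unit (option X).
HB.instance Definition _ := isMonoid.Build with_unit
  with_unit_mulA with_unit_1mul with_unit_mul1.

Definition with_unit_emb (x : X) : with_unit := Some x.

Fact with_unit_embM : {morph with_unit_emb : x y / x * y}.
Proof. by []. Qed.

HB.instance Definition _ := isMultiplicative.Build X with_unit with_unit_emb with_unit_embM.

Lemma with_unit_mulC : commutative (@mul X) -> commutative (@mul with_unit).
Proof. by move=> mulC [x|] [y|] //; congr Some; exact: mulC. Qed.

(** The image grows by a single point, which is closed in a T1 space. *)
Lemma injectively_closed_with_unit (C : topSemigroupType -> Prop) :
  (forall Y, C Y -> T1S Y) -> injectively_closed C X -> injectively_closed C with_unit.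
Proof.
move=> CT1 ic Y h CY h_inj.
have -> : range h = range (h \o with_unit_emb) `|` [set h None].
    apply/seteqP; split=> [_ [[x|] _ <-]|_ [[x _ <-]|->]].
  - by left; exists x.
  - by right.
  - by exists (Some x).
  - by exists None.
apply: closedU; last exact/accessible_closed_set1/CT1.
by apply: (ic Y (h \o with_unit_emb)) => // x y /h_inj[].
Qed.

End AdjoinUnit.

(** Suppose infinitely many distinct elements z^(k+1) t have the same z^(k+2) t = c. The product of
    two of them is c z^k t', independent of the first factor and by commutativity of both, against
    [nonsingular]. *)
Lemma finite_mul_exp (M : monoidType) (z : M) (T : set M) k :
  commutative (@mul M) -> nonsingular M ->
  finite_set (mul (z ^+ k.+1) @` T) -> finite_set (mul z @` T).
Proof.
move=> mulC ns; elim: k => [//|k IH fT]; apply: IH.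
pose D c := mul (z ^+ k.+1) @` (T `&` [set t | z ^+ k.+2 * t = c]).
apply: (@sub_finite_set _ _ (\bigcup_(c in mul (z ^+ k.+2) @` T) D c)).
  by move=> _ [t Tt <-]; exists (z ^+ k.+2 * t); exists t.
apply: bigcup_finite => // c _; apply: contrapT => /infinite_seq[a a_inj aD].
have /choice[t tP] : forall i, exists t, z ^+ k.+1 * t = a i /\ z ^+ k.+2 * t = c.
  by move=> i; have [t [_ tc] ta] := aD i; exists t.
have aa i j : a i * a j = c * (z ^+ k * t j).
  have [ai ci] := tP i; have [aj _] := tP j; rewrite -ai -aj -ci.
  rewrite [LHS](commACA mulC) [RHS](commACA mulC) -[in LHS]expgnDr -[in RHS]expgnDr.
  by rewrite (addSnnS k.+1).
apply: (ns (c * (z ^+ k * t 0%N)) a a_inj) => i j.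
by rewrite aa -(aa 0%N) mulC aa.
Qed.

Section Subsemigroup.
Variables (M : monoidType) (S : semigroupType) (i : {multiplicative S -> M}).
Hypotheses (mulC : commutative (@mul M)) (ic : injectively_closed TzS M).
Hypothesis i_inj : injective i.

Let iM x y : i (x * y) = i x * i y. Proof. exact: gmulfM. Qed.

Let smulC : commutative (@mul S).
Proof. by move=> x y; apply: i_inj; rewrite !iM mulC. Qed.

Let per := closed_periodic mulC ic.
Let ns := closed_nonsingular mulC ic.

Let fin_mul (z : M) : finite_set (mul z @` [set x | ipow x = ipow z]).
Proof.
have [zz [k k0 zk]] := ipowP per z.
apply: (@finite_mul_exp M z _ k.-1 mulC ns); rewrite prednK// -zk.
apply: sub_finite_set (maxgroup_finite mulC ic zz) => _ [x /= xz <-].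
apply/(maxgroupP per _ zz); rewrite ipowM// ipow_id// xz mulgA.
by split; rewrite zz.
Qed.

Variables (Y : topSemigroupType) (h : {multiplicative S -> Y}).
Hypothesis h_inj : injective h.

Section Exponent.
Variable n : nat.
Hypothesis exp_idem : forall x : M, idem (x ^+ n.+1).
Local Notation f := (@pw S n).

Let i_pw x : i (f x) = i x ^+ n.+1.
Proof. by rewrite /pw; elim: n => //= k IH; rewrite iM IH -expgS. Qed.

Let i_ipow x : i (f x) = ipow (i x).
Proof. by rewrite i_pw (ipow_uniq per _ (exp_idem (i x))). Qed.

Let i_idem x : idem x <-> idem (i x).
Proof. by rewrite /idem /= -iM; split=> [->|/i_inj]. Qed.

Let i_reg x : f x * x = x <-> regular (i x).
Proof. by rewrite /regular -i_ipow -iM; split=> [->|/i_inj]. Qed.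

Let ff x : idem (f x).
Proof. by apply/i_idem; rewrite i_ipow; exact: ipow_idem. Qed.

Let fM x y : f (x * y) = f x * f y.
Proof. by apply: i_inj; rewrite iM !i_ipow iM ipowM. Qed.

Let f_id e : idem e -> f e = e.
Proof. by move=> /i_idem ee; apply: i_inj; rewrite i_ipow ipow_id. Qed.

Let i_sq k x : i (iter k (fun x => x * x) x) = i x ^+ (2 ^ k)%N.
Proof.
elim: k => [|k IH] /=; first by rewrite expn0.
by rewrite iM IH -expgnDr addnn -mul2n -expnS.
Qed.

Let sq_reg x : f (iter n.+1 (fun x => x * x) x) * iter n.+1 (fun x => x * x) x =
  iter n.+1 (fun x => x * x) x.
Proof.
apply/i_reg; rewrite i_sq /regular ipowX ?expn_gt0// (ipow_uniq per _ (exp_idem (i x)))//.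
have n2 : (n.+1 <= 2 ^ n.+1)%N by apply/ltnW/ltn_expl.
by rewrite -(subnKC n2) expgnDr mulgA exp_idem.
Qed.

Let cf : chain_finite S.
Proof.
move=> c c_inj cc; apply: (closed_chain_finite mulC ic (c := i \o c)).
  exact: inj_comp.
by move=> k l /=; rewrite -iM; case: (cc k l) => ->; [left|right].
Qed.

Let sns : nonsingular S.
Proof.
move=> c a a_inj ac; apply: (ns (c := i c) (a := i \o a)); first exact: inj_comp.
by move=> k l /=; rewrite -iM ac.
Qed.

Let cns (a : nat -> S) : injective a -> (forall k, f (a k) * a k <> a k) ->
  ~ forall k l, f (a k * a l) * (a k * a l) = a k * a l.
Proof.
move=> a_inj an aa; apply: (closed_clifford_nonsingular mulC ic (a := i \o a)).
- exact: inj_comp.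
- by move=> k /i_reg/an.
- by move=> k l /=; rewrite -iM; exact/i_reg.
Qed.

Let fin_preim (A : set M) : finite_set A -> finite_set (i @^-1` A).
Proof. by apply: finite_preimage => x y _ _; exact: i_inj. Qed.

Let fin_group e : idem e -> finite_set [set x | f x = e /\ e * x = x].
Proof.
move=> /i_idem ee; apply: sub_finite_set (fin_preim (maxgroup_finite mulC ic ee)).
by move=> x [xe ex]; apply/(maxgroupP per _ ee); rewrite -i_ipow xe -iM ex.
Qed.

Let fin_mul' z : finite_set (mul z @` [set x | f x = f z]).
Proof.
apply: sub_finite_set (fin_preim (fin_mul (i z))) => _ [x /= xz <-].
by exists (i x); rewrite /= -?i_ipow ?xz ?iM.
Qed.

Lemma T1_closed_of_exponent : T1S Y -> finite_set (@idem M) -> closed (range h).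
Proof.
move=> Y1 fE.
apply: (T1_closed_range smulC h_inj ff fM sq_reg sns fin_group fin_mul' Y1).
by apply: sub_finite_set (fin_preim fE) => x /i_idem.
Qed.

Lemma T2_closed_of_exponent : T2S Y -> closed (range h).
Proof.
move=> Y2.
exact: (T2_closed_range smulC h_inj ff fM f_id sq_reg cf sns cns fin_group
  fin_mul' (hausdorff_accessible Y2) Y2).
Qed.

End Exponent.

Lemma subsemigroup_T1_closed : T1S Y -> finite_set (@idem M) -> closed (range h).
Proof. by have [[//|n] _] := closed_bounded mulC ic; exact: T1_closed_of_exponent. Qed.

Lemma subsemigroup_T2_closed : T2S Y -> closed (range h).
Proof. by have [[//|n] _] := closed_bounded mulC ic; exact: T2_closed_of_exponent. Qed.

End Subsemigroup.

Theorem corollary1p10 (C : topSemigroupType -> Prop)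
    (hC : (forall Y, C Y <-> T1S Y) \/
          (forall Y, TzS Y -> C Y) /\ (forall Y, C Y -> T2S Y))
    (X : semigroupType) (mulC : forall x y : X, (x * y = y * x)%g)
    (hX : injectively_closed C X)
    (S : {pred X}) (A : subSemigroupType S) :
  injectively_closed C A.
Proof.
move=> Y h CY h_inj; have mulCu := with_unit_mulC mulC.
pose i : {multiplicative A -> with_unit X} := @with_unit_emb X \o val.
have i_inj : injective i by move=> x y [] /val_inj.
have TzC Z : TzS Z -> C Z.
  by move=> TzZ; case: hC => [CT1|[TzC _]]; [apply/CT1/TzS_T1S|exact: TzC].
have icu : injectively_closed TzS (with_unit X).
  exact: (injectively_closed_with_unit TzS_T1S (injectively_closed_sub TzC hX)).
case: hC => [CT1|[_ CT2]]; last first.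
  exact: (subsemigroup_T2_closed mulCu icu i_inj h_inj (CT2 Y CY)).
apply: (subsemigroup_T1_closed mulCu icu i_inj h_inj); first exact/CT1.
apply: (closed_T1_idem_finite mulCu).
apply: (injectively_closed_with_unit (C := T1S)) => //.
by apply: injectively_closed_sub hX => Z /CT1.
Qed.
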